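(* Let $V$ be a real finite dimensional vector space with a $\mathbb{Q}$-structure $V(\mathbb{Q})\subset V$, let $C\subset V$ be an open nondegenerate convex cone, and let $\Gamma$ be a subgroup of $\mathrm{GL}(V)$ which stabilizes $C$ and some lattice in $V(\mathbb{Q})$. Then the following conditions are equivalent: (i) There exists a polyhedral cone $\Pi$ in $C_+$ with $\Gamma\cdot\Pi=C_+$. (ii) There exists a polyhedral cone $\Pi$ in $C_+$ with $\Gamma\cdot\Pi\supset C$. (iii) For every $\Gamma$-invariant lattice $L\subset V(\mathbb{Q})$, $\Gamma$ has finitely many orbits in the set of extreme points of $[C\cap L]$. (iv) For some $\Gamma$-invariant lattice $L\subset V(\mathbb{Q})$, $\Gamma$ has finitely many orbits in the set of extreme points of $[C\cap L]$. (i)$^*$–(iv)$^*$ The corresponding property for the contragradient action of $\Gamma$ on $C^\circ$, i.e. the property obtained from (i)–(iv) by replacing $V, V(\mathbb{Q}), C, C_+$ by $V^*, V^*(\mathbb{Q}), C^\circ, C^\circ_+$. Moreover, in case (ii), any $\Pi$ as in (ii) necessarily satisfies $\Gamma\cdot\Pi=C_+$.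
   Context: A cone is a nonempty subset invariant under multiplication by positive scalars; a convex set is nondegenerate if it contains no affine line. A $\mathbb{Q}$-structure is a $\mathbb{Q}$-subspace $V(\mathbb{Q})\subset V$ with $V(\mathbb{Q})\otimes_{\mathbb{Q}}\mathbb{R}\cong V$; $V^*(\mathbb{Q})$ is the induced $\mathbb{Q}$-structure on the dual $V^*$. A lattice in $V(\mathbb{Q})$ is a subgroup of $V(\mathbb{Q})$ that is a lattice in $V$ (the $\mathbb{Z}$-span of a basis). $[Z]$ denotes the convex hull of $Z$. $C_+:=[\bar C\cap V(\mathbb{Q})]$. $C^*\subset V^*$ is the set of linear forms that are $\ge 0$ on $C$, the open dual $C^\circ$ is the interior of $C^*$ (again an open nondegenerate convex cone, with closure $C^*$), and $C^\circ_+:=[C^*\cap V^*(\mathbb{Q})]$. A polyhedral cone is a convex cone spanned (over $\mathbb{R}_{\ge 0}$) by a finite set of vectors. $\Gamma\cdot\Pi=\bigcup_{\gamma\in\Gamma}\gamma\Pi$. If one of these equivalent conditions is fulfilled, $(V(\mathbb{Q}),C,\Gamma)$ is called a polyhedral triple, and $(C_+,\Gamma)$ is said to be of polyhedral type. *)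

(* Defs.v *)
From HB Require Import structures.
From mathcomp Require Import all_boot all_order all_algebra.
From mathcomp Require Import boolp classical_sets cardinality.
From mathcomp Require Import reals topology normedtype convex.

Set Implicit Arguments.
Unset Strict Implicit.
Unset Printing Implicit Defensive.

Import Order.TTheory GRing.Theory Num.Theory.
Import numFieldNormedType.Exports.

Local Open Scope classical_set_scope.
Local Open Scope ring_scope.

(* The topology of a finite-dimensional real vector space, transported from
   'rV[R]_n along the coordinate isomorphism [v2r].  Every linear automorphism
   of 'rV[R]_n being a homeomorphism, it does not depend on the coordinates. *)
Definition lin_top (R : realType) (V : vectType R) : topologicalType :=
  initial_topology (@VectorInternalTheory.v2r R V).

Section Cones.
Variables (R : realType) (V : vectType R).
Implicit Types (A C K P : set V) (VQ L : set V) (Gam : set 'End(V)).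

Definition lin_open A : Prop := @open (lin_top V) A.
Definition lin_closure A : set V := @closure (lin_top V) A.
Definition lin_interior A : set V := @interior (lin_top V) A.

Definition convex_hull A : set V := smallest (@convex_set R V) A.

Definition is_cone A : Prop :=
  A !=set0 /\ forall (r : R) x, 0 < r -> A x -> A (r *: x).

Definition nondegenerate A : Prop :=
  ~ exists x v : V, v != 0 /\ forall t : R, A (x + t *: v).

Definition open_nondegenerate_convex_cone C : Prop :=
  [/\ lin_open C, nondegenerate C, convex_set (C : set (convex_lmodType V))
    & is_cone C].

Definition polyhedral_cone P : Prop :=
  exists s : seq V,
    P = [set \sum_(i < size s) a i *: s`_i | a in [set a : nat -> R |
                                               forall i, 0 <= a i]].

Definition extreme_points K : set V :=
  [set x | K x /\ forall y z (t : R), K y -> K z -> 0 < t < 1 ->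
             x = t *: y + (1 - t) *: z -> y = z].

Definition Q_subspace VQ : Prop :=
  [/\ VQ 0, forall u v, VQ u -> VQ v -> VQ (u + v)
    & forall (q : rat) u, VQ u -> VQ (ratr q *: u)].

(* [f] is only meaningful on [VQ]; its values elsewhere are ignored. *)
Definition Q_linear_on VQ (W : lmodType R) (f : V -> W) : Prop :=
  (forall u v, VQ u -> VQ v -> f (u + v) = f u + f v) /\
  (forall (q : rat) u, VQ u -> f (ratr q *: u) = ratr q *: f u).

(* The inclusion of VQ in V induces an isomorphism of the tensor product of VQ
   with R over Q onto V.  This is expressed by the universal property defining
   that tensor product: every Q-linear map from VQ to a real vector space
   extends uniquely to an R-linear map on V. *)
Definition Q_structure VQ : Prop :=
  Q_subspace VQ /\
  forall (W : lmodType R) (f : V -> W), Q_linear_on VQ f ->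
    exists F : {linear V -> W},
      (forall u, VQ u -> F u = f u) /\
      forall G : {linear V -> W}, (forall u, VQ u -> G u = f u) -> G =1 F.

Definition is_lattice L : Prop :=
  exists b : seq V, basis_of fullv b /\
    L = [set \sum_(i < size b) (m i)%:~R *: b`_i | m in [set: nat -> int]].

Definition lattice_in VQ L : Prop := is_lattice L /\ L `<=` VQ.

(* In finite dimension an endomorphism with trivial kernel is invertible, and
   [g^-1] is then its inverse. *)
Definition GL_subgroup Gam : Prop :=
  [/\ Gam \1%VF,
      forall g h, Gam g -> Gam h -> Gam (g \o h)%VF
    & forall g, Gam g -> lker g = 0%VS /\ Gam (g^-1)%VF].

Definition stabilizes Gam A : Prop := forall g, Gam g -> g @` A = A.

Definition translates Gam A : set V := \bigcup_(g in Gam) (g @` A).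

Definition orbit_of Gam (x : V) : set V := [set g x | g in Gam].

Definition finitely_many_orbits Gam A : Prop :=
  finite_set [set orbit_of Gam x | x in A].

Definition C_plus VQ C : set V := convex_hull (lin_closure C `&` VQ).

(* The cone [Cp] is a parameter of the following conditions, so that they can
   be applied to C with its C_+ as well as to the open dual of C with the
   corresponding cone in the dual space. *)

Definition cond_i Cp Gam : Prop :=
  exists P, [/\ polyhedral_cone P, P `<=` Cp & translates Gam P = Cp].

Definition cond_ii C Cp Gam : Prop :=
  exists P, [/\ polyhedral_cone P, P `<=` Cp & C `<=` translates Gam P].

Definition cond_iii VQ C Gam : Prop :=
  forall L, lattice_in VQ L -> stabilizes Gam L ->
    finitely_many_orbits Gam (extreme_points (convex_hull (C `&` L))).

Definition cond_iv VQ C Gam : Prop :=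
  exists L, [/\ lattice_in VQ L, stabilizes Gam L
    & finitely_many_orbits Gam (extreme_points (convex_hull (C `&` L)))].

End Cones.

Section Duality.
Variables (R : realType) (V : vectType R).
Implicit Types (C VQ : set V) (Gam : set 'End(V)) (f : 'Hom(V, R^o)).

Definition dual_cone C : set 'Hom(V, R^o) :=
  [set f | forall x, C x -> 0 <= (f x : R)].

Definition open_dual C : set 'Hom(V, R^o) := lin_interior (dual_cone C).

Definition dual_Q VQ : set 'Hom(V, R^o) :=
  [set f | forall x, VQ x -> exists q : rat, f x = ratr q :> R].

Definition dual_plus VQ C : set 'Hom(V, R^o) :=
  convex_hull (dual_cone C `&` dual_Q VQ).

Definition precomp_inv (g : 'End(V)) f : 'Hom(V, R^o) := (f \o g^-1)%VF.

Definition contragredient_map (g : 'End(V)) : 'End('Hom(V, R^o)) :=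
  linfun (precomp_inv g).

(* [linfun] is only meaningful on linear functions. *)
Fact contragredient_mapE (g : 'End(V)) f :
  contragredient_map g f = (f \o g^-1)%VF.
Proof.
have lin : linear (precomp_inv g).
  by move=> a u v; rewrite /precomp_inv comp_lfunDl comp_lfunZl.
pose F := GRing.isLinear.Build _ _ _ _ (precomp_inv g) lin.
pose h : {linear _ -> _} := HB.pack (precomp_inv g) F.
by rewrite /contragredient_map (lfunE h).
Qed.

Definition contragredient Gam : set 'End('Hom(V, R^o)) :=
  [set contragredient_map g | g in Gam].

End Duality.

(* Main.v *)
(** The heart of the matter involves no group: if [C] is an open convex cone, [L]
    a lattice and [x] a point of [C `&` L], then finitely many differences
    [y - x] with [y] in [C `&` L] generate a cone containing the closure of [C].
    By compactness this is local at a direction [e].  Dirichlet's theorem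
    provides lattice points arbitrarily close to the ray of [e]; they span a
    subspace [U] containing [e], and suitable ones generate a neighbourhood of
    [e] in [U].  The directions transverse to [U] are handled by induction,
    replacing [C] by [C + U].

    With Dickson's lemma it follows that the linear forms attaining their
    minimum over [C `&` L] at [x] form a rational polyhedral cone, whence
    (iv) => (ii)*.  For (ii) => (i) the Siegel property is proved by attaching
    to a point of [C] the forms of the dual lattice in the open dual that are
    minimal there; then a point of C_+ is approached along a segment inside
    [C].  In (ii) => (iii) an extreme point has coefficients at most 1 on
    integral generators.  By the bipolar theorem [C] and its open dual play
    symmetric roles, which closes the circle of implications. *)
Require Import Defs.
From HB Require Import structures.
From mathcomp Require Import all_boot all_order all_algebra.
From mathcomp Require Import boolp classical_sets cardinality.
From mathcomp Require Import reals interval_inference topology normedtype convex derive.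
From mathcomp Require Import ring lra zify.

Set Implicit Arguments.
Unset Strict Implicit.
Unset Printing Implicit Defensive.

Import Order.TTheory GRing.Theory Num.Theory.
Import numFieldNormedType.Exports.
Import VectorInternalTheory.

Local Open Scope classical_set_scope.
Local Open Scope ring_scope.

(** * The topology of a finite-dimensional space through a norm *)

Section Coordinates.
Variables (R : realType) (V : vectType R).
Implicit Types (u v : V).

(** The obstacle is a boundary ray of [C] that contains no rational point. Lattice points close to
    such a ray need not lie in [C], but adding one to a point of [C] stays in [C] as soon as that
    point has a ball in [C] larger than the distance to the ray. This is why the statement concerns
    differences [y - x] with a fixed [x] inside [C]. After passing to [C + U], the points found by
    induction lie in [C + U] only and have to be moved back into [C] by lattice vectors of [U].
    These moves spoil the decomposition of a vector near [e] by an error that must be small compared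
    with its distance from the boundary of a neighbourhood of [e] in [U]. Hence the induction
    carries bounds on the coefficients, linear in the norm of the vector. Since [C + U] may contain
    lines, everything up to the local result is done for open cones that may be degenerate.
    Integrality enters twice through Dickson's lemma: forms of the dual lattice take natural values
    on integral generators of the closure, and lattice points of [C] are indexed by a finite
    remainder and a vector of natural numbers. *)

Lemma v2r_coordD i u v : v2r (u + v) 0 i = v2r u 0 i + v2r v 0 i.
Proof. by rewrite linearD mxE. Qed.

Lemma v2r_coordN i u : v2r (- u) 0 i = - v2r u 0 i.
Proof. by rewrite linearN mxE. Qed.

Lemma v2r_coordZ i (a : R) u : v2r (a *: u) 0 i = a * v2r u 0 i.
Proof. by rewrite linearZ mxE. Qed.

Lemma v2r_coord0 i : v2r (0 : V) 0 i = 0.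
Proof. by rewrite linear0 mxE. Qed.

Lemma eq_v2r_coord u v : (forall i, v2r u 0 i = v2r v 0 i) -> u = v.
Proof. by move=> uv; apply: v2r_inj; apply/rowP. Qed.

End Coordinates.

Ltac vec_coord := apply: eq_v2r_coord => ?;
  rewrite ?(v2r_coordD, v2r_coordN, v2r_coordZ, v2r_coord0).
Ltac vec_ring := by clear; vec_coord; ring.

Section Norm.
Variables (R : realType) (V : vectType R).
Implicit Types (u v w x y : V) (A K : set V).

(* Linear forms as bare functions, so that their values live in R rather than
   in the regular module R^o. *)
Definition linfunction (h : V -> R) : Prop :=
  (forall u v, h (u + v) = h u + h v) /\ (forall a v, h (a *: v) = a * h v).

Definition vnorm v : R := `|v2r v|.

Lemma vnorm_ge0 v : 0 <= vnorm v. Proof. exact: normr_ge0. Qed.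

Lemma vnormD u v : vnorm (u + v) <= vnorm u + vnorm v.
Proof. by rewrite /vnorm linearD ler_normD. Qed.

Lemma vnormZ a v : vnorm (a *: v) = `|a| * vnorm v.
Proof. by rewrite /vnorm linearZ normrZ. Qed.

Lemma vnormN v : vnorm (- v) = vnorm v.
Proof. by rewrite /vnorm linearN normrN. Qed.

Lemma vnorm0 : vnorm 0 = 0.
Proof. by rewrite /vnorm linear0 normr0. Qed.

Lemma vnormC u v : vnorm (u - v) = vnorm (v - u).
Proof. by rewrite -vnormN opprB. Qed.

Lemma vnorm_eq0 v : vnorm v = 0 -> v = 0.
Proof.
move=> /normr0_eq0 v0.
by apply: (can_inj v2rK); rewrite v0 linear0.
Qed.

Lemma vnorm_triangle w u v : vnorm (u - v) <= vnorm (u - w) + vnorm (w - v).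
Proof. by rewrite -[u - v](subrKA w) vnormD. Qed.

Lemma vnorm_sum (I : Type) (r : seq I) (P : pred I) (F : I -> V) :
  vnorm (\sum_(i <- r | P i) F i) <= \sum_(i <- r | P i) vnorm (F i).
Proof.
elim/big_rec2: _ => [|i y1 y2 _ h]; first by rewrite vnorm0.
by rewrite (le_trans (vnormD _ _))// lerD2l.
Qed.

(** Expansion in the standard basis gives the constant; its summand 1 keeps it positive in dimension
    zero. Linear forms and linear maps are both bounded through this. *)
Lemma seminorm_bounded (g : V -> R) :
  (forall u v, g (u + v) <= g u + g v) ->
  (forall a v, g (a *: v) = `|a| * g v) ->
  exists2 K : R, 0 < K & forall v, g v <= K * vnorm v.
Proof.
move=> gD gZ.
have g0 : g 0 = 0 by rewrite -(scale0r 0) gZ normr0 mul0r.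
have g_ge0 v : 0 <= g v.
  have := gD v (-1 *: v); rewrite gZ normrN1 mul1r scaleN1r subrr g0; lra.
have gsum (I : Type) (r : seq I) (F : I -> V) :
    g (\sum_(i <- r) F i) <= \sum_(i <- r) g (F i).
  elim/big_rec2: _ => [|i y1 y2 _ h]; first by rewrite g0.
  by rewrite (le_trans (gD _ _))// lerD2l.
pose e i := r2v (delta_mx 0 i) : V.
exists (1 + \sum_i g (e i)).
  by rewrite ltr_pwDl// sumr_ge0.
move=> v; rewrite -{1}[v]v2rK.
rewrite [v2r v]row_sum_delta linear_sum/=.
apply: le_trans (gsum _ _ _) _.
rewrite mulrDl mul1r mulr_suml -[leLHS]add0r lerD ?vnorm_ge0//.
apply: ler_sum => i _; rewrite linearZ/= gZ mulrC ler_wpM2l//.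
rewrite /vnorm [leRHS]mx_normrE.
by apply: (le_bigmax _ (fun ij => `|v2r v ij.1 ij.2|) (0, i)).
Qed.

Lemma linfunctionD (h : V -> R) : linfunction h -> forall u v, h (u + v) = h u + h v.
Proof. by case. Qed.

Lemma linfunctionZ (h : V -> R) : linfunction h -> forall a v, h (a *: v) = a * h v.
Proof. by case. Qed.

Lemma linfunction0 (h : V -> R) : linfunction h -> h 0 = 0.
Proof. by move=> hl; rewrite -(scale0r 0) (linfunctionZ hl) mul0r. Qed.

Lemma linfunctionN (h : V -> R) : linfunction h -> forall v, h (- v) = - h v.
Proof. by move=> hl v; rewrite -scaleN1r (linfunctionZ hl) mulN1r. Qed.

Lemma linfunctionB (h : V -> R) : linfunction h -> forall u v, h (u - v) = h u - h v.
Proof. by move=> hl u v; rewrite (linfunctionD hl) (linfunctionN hl). Qed.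

Lemma linfunction_sum (h : V -> R) : linfunction h ->
  forall (I : Type) (r : seq I) (P : pred I) (F : I -> V),
  h (\sum_(i <- r | P i) F i) = \sum_(i <- r | P i) h (F i).
Proof.
move=> hl I r P F.
exact: (big_morph h (linfunctionD hl) (linfunction0 hl)).
Qed.

Lemma linfunction_bounded (h : V -> R) : linfunction h ->
  exists2 K : R, 0 < K & forall v, `|h v| <= K * vnorm v.
Proof.
move=> hl; apply: (@seminorm_bounded (fun v => `|h v|)) => [u v|a v].
  by rewrite (linfunctionD hl) ler_normD.
by rewrite (linfunctionZ hl) normrM.
Qed.

Lemma linear_vnorm_bounded (W : vectType R) (f : {linear V -> W}) :
  exists2 K : R, 0 < K & forall v, `|v2r (f v)| <= K * vnorm v.
Proof.
apply: (@seminorm_bounded (fun v => `|v2r (f v)|)) => [u v|a v].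
  by rewrite !linearD ler_normD.
by rewrite !linearZ normrZ.
Qed.

Lemma nbhs_linP x A :
  @nbhs _ (lin_top V) x A <->
  exists2 r, 0 < r & forall y, vnorm (y - x) < r -> A y.
Proof.
split.
  move=> [B [[U oU <-] /= Ux] sBA].
  have /nbhs_ballP[r /= r0 rU] : nbhs (v2r x) U.
    exact: open_nbhs_nbhs.
  exists r => // y yx; apply: sBA; apply: rU.
  by rewrite -ball_normE/= distrC -linearB.
move=> [r r0 rA].
have h : nbhs (v2r x) (ball (v2r x) r).
  exact: nbhsx_ballx.
have H := @initial_continuous V _ (@v2r R V) x _ h.
apply: (@filterS _ _ (@nbhs_filter (lin_top V) x) _ _ _ H) => y /=.
rewrite -ball_normE/= => yx.
by apply: rA; rewrite vnormC /vnorm linearB.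
Qed.

Lemma lin_openP A : lin_open A <->
  forall x, A x -> exists2 r, 0 < r & forall y, vnorm (y - x) < r -> A y.
Proof.
rewrite /lin_open openE; split=> h x Ax; first exact/nbhs_linP/h.
exact/nbhs_linP/h.
Qed.

Lemma lin_interiorP A x : lin_interior A x <->
  exists2 r, 0 < r & forall y, vnorm (y - x) < r -> A y.
Proof. exact: nbhs_linP. Qed.

Lemma lin_closureP A x : lin_closure A x <->
  forall r, 0 < r -> exists2 y, A y & vnorm (y - x) < r.
Proof.
split=> [h r r0|h B /nbhs_linP[r r0 rB]].
  have /h[y [Ay xy]] : @nbhs _ (lin_top V) x [set y | vnorm (y - x) < r].
    by apply/nbhs_linP; exists r.
  by exists y.
by have [y Ay xy] := h _ r0; exists y; split => //; apply: rB.
Qed.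

Lemma sub_lin_closure A : A `<=` lin_closure A.
Proof. exact: (@subset_closure (lin_top V)). Qed.

Lemma lin_closure_idem A : lin_closure (lin_closure A) `<=` lin_closure A.
Proof.
move=> x /lin_closureP h; apply/lin_closureP => r r0.
have r20 : 0 < r / 2 by lra.
have [y /lin_closureP/(_ _ r20)[z Az zy] yx] := h _ r20.
by exists z => //; have := vnorm_triangle y z x; lra.
Qed.

(** Compactness is obtained in coordinates, where closed bounded sets are compact. *)
Lemma compact_v2r_image A (M : R) :
  lin_closure A `<=` A -> (forall v, A v -> vnorm v <= M) ->
  compact (@v2r R V @` A).
Proof.
move=> clA bA; apply: bounded_closed_compact.
  exists M; split; first exact: num_real.
  by move=> N MN _ [v Av <-]; apply: le_trans (bA _ Av) (ltW MN).
move=> z clz; exists (r2v z); last first.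
  exact: r2vK.
apply: clA; apply/lin_closureP => r r0.
have [_ [[v Av <-]]] := clz _ (nbhsx_ballx z _ r0).
rewrite -ball_normE/= => zv; exists v => //.
by rewrite vnormC /vnorm linearB/= r2vK.
Qed.

Lemma compact_finite_cover A (M : R) (r : V -> R) :
  lin_closure A `<=` A -> (forall v, A v -> vnorm v <= M) ->
  (forall v, A v -> 0 < r v) ->
  exists s : seq V, (forall e, e \in s -> A e) /\
    forall v, A v -> exists2 e, e \in s & vnorm (v - e) < r e.
Proof.
move=> clA bA r0; have := compact_v2r_image clA bA.
rewrite compact_cover => /(_ V A
  (fun e => ball (v2r e) (r e)))[].
- by move=> e Ae; apply: ball_open; exact: r0.
- move=> _ [v Av <-]; exists v => //; exact/ballxx/r0.
move=> D DA cov; exists (finmap.enum_fset D); split.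
  by move=> e eD; have := DA e eD; rewrite inE.
move=> v Av; have [e /= eD] := cov (v2r v) (ex_intro2 _ _ v Av erefl).
by rewrite -ball_normE/= => h; exists e => //; rewrite vnormC /vnorm linearB.
Qed.

Lemma compact_attains_min A (M : R) (f : V -> R) :
  A !=set0 -> lin_closure A `<=` A -> (forall v, A v -> vnorm v <= M) ->
  (forall x, A x -> forall e, 0 < e -> exists2 r, 0 < r &
     forall y, vnorm (y - x) < r -> `|f y - f x| < e) ->
  exists2 c, A c & forall v, A v -> f c <= f v.
Proof.
move=> [a Aa] clA bA cf; have cA := compact_v2r_image clA bA.
have := @EVT_min_rV R _ (f \o @r2v R V) _ _ cA.
case=> [||_ /set_mem[c Ac <-] /= h].
- by exists (v2r a), a.
- apply: continuous_in_subspaceT => z /set_mem[x Ax <-].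
  move=> B /nbhs_ballP[e /= e0 eB]; have [r r0 rf] := cf _ Ax _ e0.
  apply/nbhs_ballP; exists r => // z0; rewrite -ball_normE/= => xz0.
  apply: eB; rewrite -ball_normE/= v2rK distrC; apply: rf.
  by rewrite /vnorm linearB/= r2vK distrC.
- exists c => // v Av; have := h (v2r v).
  by rewrite !v2rK; apply; apply/mem_set; exists v.
Qed.

End Norm.

(** * Convex hulls and finitely generated cones *)

Section Convexity.
Variables (R : realType) (V : vectType R).
Implicit Types (u v w x y : V) (A B : set V).

Lemma convex_setP A : convex_set (A : set (convex_lmodType V)) <->
  forall x y t, A x -> A y -> 0 < t < 1 -> A (t *: x + (1 - t) *: y).
Proof.
split=> [/convex_setW cA x y t Ax Ay /andP[t0 t1]|cA].
  have := cA x y (mem_set Ax) (mem_set Ay) (Itv01 (ltW t0) (ltW t1)) t0 t1.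
  by move=> /set_mem.
apply/convex_setW => x y /set_mem Ax /set_mem Ay k k0 k1.
by apply/mem_set; apply: cA => //; rewrite k0 k1.
Qed.

Lemma sub_convex_hull A : A `<=` convex_hull A.
Proof. exact: sub_smallest. Qed.

Lemma convex_hull_min A B : convex_set (B : set (convex_lmodType V)) ->
  A `<=` B -> convex_hull A `<=` B.
Proof. by move=> cB AB; apply: smallest_sub. Qed.

Lemma convex_hull_convex A : convex_set (convex_hull A : set (convex_lmodType V)).
Proof.
apply/convex_setP => x y t hx hy t01 B [cB AB].
by move/convex_setP: (cB); apply; [exact: hx|exact: hy|].
Qed.

(* Removing an extreme point from a convex set leaves it convex. *)
Lemma extreme_points_hull A : extreme_points (convex_hull A) `<=` A.
Proof.
move=> x [hx ex]; apply: contrapT => nAx.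
have : convex_hull A `<=` [set y | convex_hull A y /\ y <> x].
  apply: convex_hull_min; last first.
    by move=> y Ay; split; [exact: sub_convex_hull|move=> yx; rewrite yx in Ay].
  apply/convex_setP => y z t [hy yx] [hz zx] t01; split.
    by move/convex_setP: (@convex_hull_convex A); apply.
  move=> /esym xE; have yz := ex _ _ _ hy hz t01 xE.
  by apply: yx; rewrite xE yz -scalerDl addrC subrK scale1r.
by move=> /(_ _ hx)[].
Qed.

End Convexity.

Section GeneratedCones.
Variables (R : realType) (V : vectType R).
Implicit Types (u v w x y : V) (s t : seq V).

Definition cone_over s : set V := [set v | exists2 a : nat -> R,
  (forall i, 0 <= a i) & v = \sum_(i < size s) a i *: s`_i].

Lemma polyhedral_coneP (P : set V) :
  polyhedral_cone P <-> exists s, P = cone_over s.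
Proof.
by split=> -[s ->]; exists s; apply/seteqP; split=> v;
  [move=> [a a0 <-]|move=> [a a0 ->]|move=> [a a0 ->]|move=> [a a0 <-]]; exists a.
Qed.

Lemma cone_over_nil v : cone_over [::] v <-> v = 0.
Proof.
split=> [[a _ ->]|->]; first by rewrite big_ord0.
by exists (fun=> 0) => //; rewrite big_ord0.
Qed.

Lemma cone_over_cons x s v : cone_over (x :: s) v <->
  exists c u, [/\ 0 <= c, cone_over s u & v = c *: x + u].
Proof.
split=> [[a a0 ->]|[c [_ [c0 [a a0 ->] ->]]]].
  exists (a 0%N), (\sum_(i < size s) a i.+1 *: s`_i).
  split=> //; last by rewrite big_ord_recl.
  by exists (fun i => a i.+1).
exists (fun i => if i is j.+1 then a j else c); first by case.
by rewrite big_ord_recl.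
Qed.

(** Serves as the induction principle for membership in a generated cone. *)
Lemma cone_over_min s (P : V -> Prop) :
  P 0 -> (forall u v, P u -> P v -> P (u + v)) ->
  (forall c u, 0 <= c -> P u -> P (c *: u)) ->
  (forall x, x \in s -> P x) -> forall v, cone_over s v -> P v.
Proof.
move=> P0 PD PZ Ps v [a a0 ->].
by apply: big_ind => // i _; apply: PZ => //; apply: Ps; rewrite mem_nth.
Qed.

Lemma cone_over0 s : cone_over s 0.
Proof. by exists (fun=> 0) => //; rewrite big1// => i _; rewrite scale0r. Qed.

Lemma cone_overD s u v : cone_over s u -> cone_over s v -> cone_over s (u + v).
Proof.
move=> [a a0 ->] [b b0 ->]; exists (fun i => a i + b i) => [i|].
  by rewrite addr_ge0.
by rewrite -big_split; apply: eq_bigr => i _; rewrite scalerDl.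
Qed.

Lemma cone_overZ s c u : 0 <= c -> cone_over s u -> cone_over s (c *: u).
Proof.
move=> c0 [a a0 ->]; exists (fun i => c * a i) => [i|].
  by rewrite mulr_ge0.
by rewrite scaler_sumr; apply: eq_bigr => i _; rewrite scalerA.
Qed.

Lemma cone_over_mem s x : x \in s -> cone_over s x.
Proof.
elim: s => // y s IH; rewrite inE => /orP[/eqP<-|/IH h]; apply/cone_over_cons.
  by exists 1, 0; rewrite ler01 scale1r addr0; split=> //; exact: cone_over0.
by exists 0, x; rewrite lexx scale0r add0r.
Qed.

Lemma cone_over_sub s t :
  (forall x, x \in s -> cone_over t x) -> cone_over s `<=` cone_over t.
Proof.
move=> st; apply: cone_over_min => //.
- exact: cone_over0.
- exact: cone_overD.
- exact: cone_overZ.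
Qed.

Lemma cone_over_subset s t : {subset s <= t} -> cone_over s `<=` cone_over t.
Proof. by move=> st; apply: cone_over_sub => x /st; exact: cone_over_mem. Qed.

Lemma cone_over_filter0 s v : cone_over s v ->
  cone_over [seq x <- s | x != 0] v.
Proof.
apply: cone_over_sub => x xs; have [->|x0] := eqVneq x 0; first exact: cone_over0.
by apply: cone_over_mem; rewrite mem_filter x0.
Qed.

(* The Motzkin double description step. *)
Let cut (h : V -> R) s :=
  [seq x <- s | 0 <= h x] ++
  [seq h x *: y - h y *: x | x <- [seq x <- s | 0 < h x], y <- [seq y <- s | h y < 0]].

Let cone_cut (h : V -> R) s v : linfunction h ->
  cone_over (cut h s) v <-> cone_over s v /\ 0 <= h v.
Proof.
move=> hl; split.
  move: v; apply: (@cone_over_min _ (fun v => cone_over s v /\ 0 <= h v)).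
  - by split; [exact: cone_over0|rewrite (linfunction0 hl)].
  - move=> u v [su hu] [sv hv]; split; first exact: cone_overD.
    by rewrite (linfunctionD hl) addr_ge0.
  - move=> c u c0 [su hu]; split; first exact: cone_overZ.
    by rewrite (linfunctionZ hl) mulr_ge0.
  move=> x; rewrite mem_cat => /orP[|].
    by rewrite mem_filter => /andP[hx xs]; split=> //; exact: cone_over_mem.
  move=> /allpairsP[[y z] /= []]; rewrite !mem_filter.
  move=> /andP[hy ys] /andP[hz zs] ->; split; last first.
    by rewrite (linfunctionB hl) !(linfunctionZ hl) mulrC subrr.
  rewrite -scaleNr; apply: cone_overD; apply: cone_overZ.
  - exact: ltW.
  - exact: cone_over_mem.
  - by rewrite oppr_ge0 ltW.
  - exact: cone_over_mem.
move=> [sv hv].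
pose N := cone_over (cut h s).
pose pos := [seq x <- s | 0 <= h x].
pose neg := [seq x <- s | h x < 0].
have posN : cone_over pos `<=` N.
  by apply: cone_over_subset => x xs; rewrite mem_cat xs.
have [p [q [pp qq vE]]] : exists p q, [/\ cone_over pos p, cone_over neg q & v = p + q].
  move: v sv {hv}; apply: cone_over_min.
  - by exists 0, 0; rewrite addr0; split=> //; exact: cone_over0.
  - move=> _ _ [p [q [pp qq ->]]] [p' [q' [pp' qq' ->]]].
    by exists (p + p'), (q + q'); rewrite addrACA; split=> //; exact: cone_overD.
  - move=> c _ c0 [p [q [pp qq ->]]]; exists (c *: p), (c *: q).
    by rewrite scalerDr; split=> //; exact: cone_overZ.
  - move=> x xs; have [hx|hx] := leP 0 (h x).
      exists x, 0; rewrite addr0; split=> //; last exact: cone_over0.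
      by apply: cone_over_mem; rewrite mem_filter hx.
    exists 0, x; rewrite add0r; split=> //; first exact: cone_over0.
    by apply: cone_over_mem; rewrite mem_filter hx.
have hp : 0 <= h p.
  move: p pp {vE hv}; apply: cone_over_min.
  - by rewrite (linfunction0 hl).
  - by move=> u w hu hw; rewrite (linfunctionD hl) addr_ge0.
  - by move=> c u c0 hu; rewrite (linfunctionZ hl) mulr_ge0.
  - by move=> x; rewrite mem_filter => /andP[].
(* Strictness matters: together with [0 <= h v] it forces [0 < h p], so that [h p] can be divided
   by. *)
have hq : q = 0 \/ h q < 0.
  move: q qq {vE hv sv}; apply: cone_over_min.
  - by left.
  - move=> u w [->|hu] [->|hw]; rewrite ?addr0 ?add0r; [by left|by right|by right|].
    by right; rewrite (linfunctionD hl); lra.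
  - move=> c u; rewrite le_eqVlt => /orP[/eqP<-|c0]; first by rewrite scale0r; left.
    move=> [->|hu]; first by rewrite scaler0; left.
    by right; rewrite (linfunctionZ hl) pmulr_rlt0.
  - by move=> x; rewrite mem_filter => /andP[hx _]; right.
(* The expression is bilinear in [p] and [q], so it suffices to treat pairs of generators. Such a
   pair is a generator of the cut, except when [h] vanishes on the first one, which then is itself
   kept in the cut. *)
have mix : N (h p *: q - h q *: p).
  move: q qq {vE hv hq}; apply: cone_over_min.
  - by rewrite scaler0 (linfunction0 hl) scale0r subrr; exact: cone_over0.
  - move=> u w hu hw; rewrite (linfunctionD hl) scalerDr scalerDl opprD addrACA.
    exact: cone_overD.
  - move=> c u c0 hu; have -> : h p *: (c *: u) - h (c *: u) *: p
      = c *: (h p *: u - h u *: p).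
      by rewrite (linfunctionZ hl) scalerBr !scalerA mulrC.
    exact: cone_overZ.
  move=> y ny; move: p pp {hp}; apply: cone_over_min.
  - by rewrite scaler0 (linfunction0 hl) scale0r subrr; exact: cone_over0.
  - move=> u w hu hw; rewrite (linfunctionD hl) scalerDr scalerDl opprD addrACA.
    exact: cone_overD.
  - move=> c u c0 hu; have -> : h (c *: u) *: y - h y *: (c *: u)
      = c *: (h u *: y - h y *: u).
      by rewrite (linfunctionZ hl) scalerBr !scalerA [_ * c]mulrC.
    exact: cone_overZ.
  move=> x; rewrite mem_filter => /andP[]; rewrite le_eqVlt => /orP[/eqP hx|hx] xs.
    rewrite -hx scale0r add0r -scaleNr; apply: cone_overZ.
      by move: ny; rewrite mem_filter => /andP[hy _]; rewrite oppr_ge0 ltW.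
    by apply/posN/cone_over_mem; rewrite mem_filter xs -hx lexx.
  apply: cone_over_mem; rewrite mem_cat; apply/orP; right.
  by apply/allpairsP; exists (x, y); split=> //=; rewrite mem_filter hx.
rewrite vE; rewrite vE (linfunctionD hl) in hv.
case: hq => [->|hq]; first by rewrite addr0; exact: posN.
have hp0 : 0 < h p by rewrite (lt_le_trans _ (_ : - h q <= _))//; lra.
set a := h p in hp hp0 mix hv; set b := h q in hq mix hv.
(* The coefficient of [p] is [h v / h p], which is nonnegative by hypothesis. *)
have -> : p + q = (1 + b / a) *: p + a^-1 *: (a *: q - b *: p).
  rewrite scalerBr !scalerA mulVf ?gt_eqF// scale1r scalerDl scale1r.
  by rewrite addrACA [a^-1 * b]mulrC subrr addr0.
apply: cone_overD; last by apply: cone_overZ => //; rewrite invr_ge0 ltW.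
apply: cone_overZ; last exact: posN.
have -> : 1 + b / a = (a + b) / a by rewrite mulrDl mulfV ?gt_eqF.
by rewrite mulr_ge0// invr_ge0 ltW.
Qed.

(** The half-spaces are cut off one at a time from the whole space, generated by [s0]. The predicate
    [Q] is carried along in order to keep the generators rational: the combinations formed by a cut
    preserve rationality when the forms take rational values. *)
Lemma polyhedral_of_inequalities (T : eqType) (Q : V -> Prop) (l : seq T)
    (h : T -> V -> R) s0 :
  (forall i, i \in l -> linfunction (h i)) ->
  (forall v, cone_over s0 v) -> (forall x, x \in s0 -> Q x) ->
  (forall i, i \in l -> forall x y, Q x -> Q y -> Q (h i x *: y - h i y *: x)) ->
  exists2 s, forall x, x \in s -> Q x &
    forall v, cone_over s v <-> forall i, i \in l -> 0 <= h i v.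
Proof.
move=> h_lin full Q0; elim: l h_lin => [|i l IH] h_lin Qh.
  by exists s0 => // v; split.
have [| |s Qs sP] := IH.
- by move=> j jl; apply: h_lin; rewrite inE jl orbT.
- by move=> j jl; apply: Qh; rewrite inE jl orbT.
have il : i \in i :: l by rewrite inE eqxx.
have hl := h_lin _ il.
exists (cut (h i) s) => [x|v].
  rewrite mem_cat => /orP[|]; first by rewrite mem_filter => /andP[_ /Qs].
  move=> /allpairsP[[y z] /= []]; rewrite !mem_filter => /andP[_ /Qs Qy] /andP[_ /Qs Qz] ->.
  exact: Qh.
rewrite (cone_cut _ _ hl); split=> [[/sP H hv] j|H].
  by rewrite inE => /orP[/eqP ->//|]; exact: H.
by split; [apply/sP => j jl; apply: H; rewrite inE jl orbT|exact: H].
Qed.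

End GeneratedCones.

(** * Inequalities for finitely generated cones, and their closedness *)

Section ClosedCones.
Variables (R : realType) (V : vectType R).
Implicit Types (u v w x y : V) (s t : seq V).

Lemma linfunction_comb (h k : V -> R) (a b : R) :
  linfunction h -> linfunction k -> linfunction (fun v => a * h v + b * k v).
Proof.
move=> hl kl; split=> [u v|c v].
  by rewrite (linfunctionD hl) (linfunctionD kl); ring.
by rewrite (linfunctionZ hl) (linfunctionZ kl); ring.
Qed.

Lemma linfunction_v2r i : linfunction (fun v => v2r v 0 i : R).
Proof.
by split=> [u v|c v]; rewrite ?linearD ?linearZ mxE.
Qed.

Lemma in_map_iff (T U : Type) (f : T -> U) (l : seq T) (y : U) :
  List.In y (map f l) <-> exists2 x, List.In x l & y = f x.
Proof.
have := List.in_map_iff f l y; rewrite -/(map f l) => ->.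
by split=> [[x [<- xl]]|[x xl ->]]; exists x.
Qed.

Lemma in_cat_iff (T : Type) (l1 l2 : seq T) (y : T) :
  List.In y (l1 ++ l2) <-> List.In y l1 \/ List.In y l2.
Proof. exact: List.in_app_iff. Qed.

(** The bound is the maximum of 0 and the values of [f]. In the elimination below it is the least
    admissible coefficient of the eliminated generator. *)
Lemma exists_upper_bound_attained (T : Type) (l : seq T) (f : T -> R) :
  exists t : R, [/\ 0 <= t, forall x : T, List.In x l -> f x <= t &
    t = 0 \/ exists2 x : T, List.In x l & t = f x].
Proof.
elim: l => [|a l [t [t0 lt tE]]]; first by exists 0; split=> //; left.
have [ta|ta] := leP (f a) t.
  exists t; split=> // [x [<-//|]|]; first exact: lt.
  by case: tE => [->|[x xl ->]]; [left|right; exists x => //; right].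
exists (f a); split=> [|x [<-//|/lt xt]|]; first lra.
  by rewrite (le_trans xt)// ltW.
by right; exists a => //; left.
Qed.

(* Fourier-Motzkin elimination. *)
Lemma cone_over_inequalities s : exists2 hs : seq (V -> R),
  forall h, List.In h hs -> linfunction h &
  forall v, cone_over s v <-> forall h, List.In h hs -> 0 <= h v.
Proof.
elim: s => [|x s [hs hs_lin hsP]].
  pose e i (v : V) : R := v2r v 0 i.
  exists ([seq e i | i <- enum 'I_(dim V)] ++ [seq (fun v => - e i v) | i <- enum 'I_(dim V)]).
    move=> h /in_cat_iff[]/in_map_iff[i _ ->]; first exact: linfunction_v2r.
    have -> : (fun v => - e i v) = (fun v => -1 * e i v + 0 * e i v).
      by apply/funext => v; ring.
    by apply: linfunction_comb; exact: linfunction_v2r.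
  have inE (i : 'I_(dim V)) : List.In i (enum 'I_(dim V)).
    have : i \in enum 'I_(dim V) by rewrite mem_enum.
    by elim: (enum _) => // a l IH; rewrite inE => /orP[/eqP ->|/IH]; [left|right].
  move=> v; rewrite cone_over_nil; split=> [-> h /in_cat_iff[]/in_map_iff[i _ ->]|H].
  - by rewrite /e linear0 mxE.
  - by rewrite /e linear0 mxE oppr0.
  apply: (can_inj v2rK); rewrite linear0; apply/rowP => i; rewrite [RHS]mxE.
  apply/eqP; rewrite eq_le -oppr_ge0; apply/andP; split.
    by apply: (H (fun v => - e i v)); apply/in_cat_iff; right; apply/in_map_iff; exists i.
  by apply: (H (e i)); apply/in_cat_iff; left; apply/in_map_iff; exists i.
pose nonneg := List.filter (fun h : V -> R => 0 <= h x) hs.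
pose pos := List.filter (fun h : V -> R => 0 < h x) hs.
pose neg := List.filter (fun h : V -> R => h x < 0) hs.
(* This combination of a form positive at [x] and one negative at [x] vanishes at [x], and its
   coefficients are positive. *)
pose mix (p : (V -> R) * (V -> R)) v := p.1 x * p.2 v + (- p.2 x) * p.1 v.
exists (nonneg ++ map mix (List.list_prod pos neg)).
  move=> h /in_cat_iff[/List.filter_In[hh _]|/in_map_iff[[h1 h2] + ->]].
    exact: hs_lin.
  move=> /List.in_prod_iff[/List.filter_In[h1s _] /List.filter_In[h2s _]].
  by apply: linfunction_comb; exact: hs_lin.
move=> v; rewrite cone_over_cons; split.
  move=> [c [u [c0 /hsP su ->]]] h /in_cat_iff[/List.filter_In[hh hx]|/in_map_iff[[h1 h2] + ->]].
    have hl := hs_lin _ hh; rewrite (linfunctionD hl) (linfunctionZ hl).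
    by rewrite addr_ge0 ?mulr_ge0// su.
  move=> /List.in_prod_iff[/List.filter_In[h1s h1x] /List.filter_In[h2s h2x]].
  have l1 := hs_lin _ h1s; have l2 := hs_lin _ h2s.
  rewrite /mix/= (linfunctionD l1) (linfunctionZ l1) (linfunctionD l2) (linfunctionZ l2).
  have h1u := su _ h1s; have h2u := su _ h2s; nra.
(* The least [t >= 0] for which [v - t *: x] satisfies the constraints negative at [x]. Those
   positive at [x] hold by [nonneg] if [t = 0], and otherwise by mixing with the constraint that
   determines [t]. *)
move=> H; have [t [t0 tub tE]] := exists_upper_bound_attained neg (fun h => h v / h x).
exists t, (v - t *: x); split=> //; last by rewrite addrC subrK.
apply/hsP => h hh; have hl := hs_lin _ hh.
rewrite (linfunctionB hl) (linfunctionZ hl).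
have [hx|hx|hx] := ltgtP (h x) 0.
- have : h v / h x <= t by apply: tub; exact/List.filter_In.
  by rewrite ler_ndivrMr// subr_ge0.
- case: tE => [->|[k /List.filter_In[ks kx] tE]].
    rewrite mul0r subr0; apply: H; apply/in_cat_iff; left.
    by apply/List.filter_In; rewrite ltW.
  have : 0 <= mix (h, k) v.
    apply: H; apply/in_cat_iff; right; apply/in_map_iff; exists (h, k) => //.
    by apply/List.in_prod_iff; split; apply/List.filter_In.
  rewrite /mix/= => mixh.
  have -> : h v - t * h x = (h x * k v + (- k x) * h v) / (- k x).
    by rewrite tE; field; rewrite lt_eqF.
  by rewrite divr_ge0// oppr_ge0 ltW.
- rewrite hx mulr0 subr0; apply: H; apply/in_cat_iff; left.
  by apply/List.filter_In; rewrite hx lexx.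
Qed.

(** Closedness along a segment: an inequality of the cone violated at [z] would remain violated at
    [z + t *: c] for small [t]. *)
Lemma cone_over_limit s z c :
  (forall e, 0 < e -> exists2 t, 0 < t < e & cone_over s (z + t *: c)) ->
  cone_over s z.
Proof.
have [hs hs_lin hsP] := cone_over_inequalities s.
move=> H; apply/hsP => h hh; have hl := hs_lin _ hh.
rewrite leNgt; apply/negP => hz.
have e0 : 0 < - h z / (1 + `|h c|).
  by rewrite divr_gt0 ?oppr_gt0// ltr_pwDl.
have [t /andP[t0 te] /hsP/(_ _ hh)] := H _ e0.
rewrite (linfunctionD hl) (linfunctionZ hl) => ht.
move: te; rewrite ltr_pdivlMr; last by rewrite ltr_pwDl.
have : t * h c <= t * `|h c| by rewrite ler_wpM2l ?ler_norm// ltW.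
lra.
Qed.

End ClosedCones.

(** Elements enter only through their coordinates [phi], so the lemma serves for linear forms as
    well as for multi-indices. Let [F0] dominate in the first [k] coordinates and let [m] bound its
    last one. Where the last coordinate of [a] is at least [m], [F0] suffices; each of the finitely
    many slices below [m] is handled by induction. *)
Lemma dickson (T : eqType) (k : nat) (phi : T -> nat -> nat) (A : set T) :
  exists2 F : seq T, forall f, f \in F -> A f &
    forall a, A a -> exists2 f, f \in F & forall i, (i < k)%N -> (phi f i <= phi a i)%N.
Proof.
elim: k A => [|k IH] A.
  have [[a Aa]|A0] := pselect (exists a, A a); last first.
    by exists [::] => // a Aa; exfalso; apply: A0; exists a.
  exists [:: a] => [f|b Ab]; first by rewrite inE => /eqP->.
  by exists a => //; rewrite inE.
have [F0 F0A F0P] := IH A.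
pose m := \max_(f <- F0) phi f k.
have /choice[F FP] : forall j, exists F : seq T,
    (forall f, f \in F -> A f /\ phi f k = j) /\
    forall a, A a -> phi a k = j ->
    exists2 f, f \in F & forall i, (i < k)%N -> (phi f i <= phi a i)%N.
  move=> j; have [F FA FP] := IH (A `&` [set a | phi a k = j]).
  by exists F; split=> [f /FA[]//|a Aa aj]; apply: FP.
exists (F0 ++ flatten [seq F j | j <- iota 0 m]).
  move=> f; rewrite mem_cat => /orP[/F0A//|/flatten_mapP[j _ fF]].
  by have [/(_ _ fF)[]] := FP j.
move=> a Aa; have [mk|km] := leqP m (phi a k).
  have [f fF fa] := F0P _ Aa; exists f; first by rewrite mem_cat fF.
  move=> i; rewrite ltnS leq_eqVlt => /orP[/eqP->|]; last exact: fa.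
  by apply: leq_trans mk; exact: leq_bigmax_seq.
have [fF FF] := FP (phi a k); have [f ff fa] := FF _ Aa erefl.
exists f.
  rewrite mem_cat; apply/orP; right; apply/flatten_mapP.
  by exists (phi a k) => //; rewrite mem_iota.
move=> i; rewrite ltnS leq_eqVlt => /orP[/eqP->|]; last exact: fa.
by have [_ ->] := fF _ ff.
Qed.

(** * Lattices and Dirichlet approximation *)

Section Subgroups.
Variables (R : realType) (V : vectType R).
Implicit Types (u v w x y : V) (L : set V).

Definition subgroup L := L 0 /\ forall u v, L u -> L v -> L (u - v).

Lemma subgroupN L u : subgroup L -> L u -> L (- u).
Proof. by move=> [L0 LB] Lu; rewrite -sub0r; exact: LB. Qed.

Lemma subgroupD L u v : subgroup L -> L u -> L v -> L (u + v).
Proof. by move=> sL Lu Lv; have := sL.2 _ _ Lu (subgroupN sL Lv); rewrite opprK. Qed.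

Lemma subgroupMn L u n : subgroup L -> L u -> L (n%:R *: u).
Proof.
move=> sL Lu; elim: n => [|n IH]; first by rewrite scale0r; exact: sL.1.
by rewrite -addn1 natrD scalerDl scale1r; apply: subgroupD.
Qed.

Lemma subgroupMz L u (m : int) : subgroup L -> L u -> L (m%:~R *: u).
Proof.
move=> sL Lu; case: m => n; first exact: subgroupMn.
by rewrite NegzE mulrNz scaleNr; apply: subgroupN => //; exact: subgroupMn.
Qed.

Lemma subgroup_sum L (I : Type) (r : seq I) (P : pred I) (F : I -> V) :
  subgroup L -> (forall i, P i -> L (F i)) -> L (\sum_(i <- r | P i) F i).
Proof.
move=> sL LF; apply: big_ind => //; first exact: sL.1.
by move=> u v; exact: subgroupD.
Qed.

Lemma lattice_subgroup L : is_lattice L -> subgroup L.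
Proof.
move=> [b [_ ->]]; split.
  by exists (fun=> 0) => //; rewrite big1// => i _; rewrite scale0r.
move=> _ _ [m _ <-] [n _ <-]; exists (fun i => m i - n i) => //.
by rewrite -sumrB; apply: eq_bigr => i _; rewrite intrB scalerBl.
Qed.

(** Weaker than a basis over the integers: [L] merely contains a basis of the space, which is enough
    for approximation and for rational coordinates. *)
Definition spanned_by L (b : seq V) := basis_of fullv b /\ forall x, x \in b -> L x.

Lemma lattice_spanned L : is_lattice L -> exists b, spanned_by L b.
Proof.
move=> [b [bb ->]]; exists b; split=> // x /(nthP 0)[i ib <-].
exists (fun j => (j == i)%:Z) => //; rewrite (bigD1 (Ordinal ib))//= eqxx scale1r.
rewrite big1 ?addr0// => j ji; rewrite (_ : (_ == _) = false) ?scale0r//.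
by apply/negbTE; apply: contra ji => /eqP ji; apply/eqP/val_inj.
Qed.

Lemma linfunction_coord (b : seq V) (i : 'I_(size b)) :
  linfunction (fun v => coord (in_tuple b) i v).
Proof. by split=> *; rewrite ?linearD ?linearZ. Qed.

Lemma basis_expansion (b : seq V) v : basis_of fullv b ->
  v = \sum_(i < size b) coord (in_tuple b) i v *: b`_i.
Proof. by move=> bb; exact: (coord_basis (X := in_tuple b) bb (memvf v)). Qed.

Lemma coord_basis_sum (b : seq V) (a : nat -> R) (i : 'I_(size b)) :
  basis_of fullv b ->
  coord (in_tuple b) i (\sum_(j < size b) a j *: b`_j) = a i.
Proof.
by move=> bb; exact: (coord_sum_free (X := in_tuple b) (fun j => a j) i (basis_free bb)).
Qed.

Lemma lattice_bounded_finite L (M : R) : is_lattice L ->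
  finite_set (L `&` [set v | vnorm v <= M]).
Proof.
move=> [b [bb ->]]; set n := size b.
have /choice[K KP] : forall i : 'I_n, exists K : R, 0 < K /\
    forall v, `|coord (in_tuple b) i v| <= K * vnorm v.
  by move=> i; have [K K0 KP] := linfunction_bounded (linfunction_coord i); exists K.
pose B := (Num.truncn (\sum_i K i * `|M|)).+1.
(* Integers between [- B] and [B] are encoded as ordinals by a shift of [B]. *)
pose F (f : {ffun 'I_n -> 'I_(B + B).+1}) : V :=
  \sum_i ((f i)%:Z - B%:Z)%:~R *: b`_i.
apply: (@sub_finite_set _ _ (F @` setT)); last first.
  apply: finite_image; exact: finite_finset.
move=> _ [[m _ <-] /=]; set v := \sum_(i < _) _ => vM.
have mB (i : 'I_n) : (`|m i| <= B%:Z)%R.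
  rewrite -(ler_int R) intr_norm.
  have -> : (m i)%:~R = coord (in_tuple b) i v.
    by rewrite /v (coord_basis_sum (fun j => (m j)%:~R) i bb).
  apply: le_trans ((KP i).2 _) _; apply: (@le_trans _ _ (K i * `|M|)).
    by rewrite ler_wpM2l ?(ltW (KP i).1)// (le_trans vM)// ler_norm.
  apply: (@le_trans _ _ (\sum_i K i * `|M|)).
    rewrite (bigD1 i)//= lerDl sumr_ge0// => j _.
    by rewrite mulr_ge0// (ltW (KP j).1).
  exact/ltW/truncnS_gt.
exists [ffun i : 'I_n => inord (absz (m i + B%:Z))] => //.
apply: eq_bigr => i _; congr (_ %:~R *: _); rewrite ffunE inordK; last first.
  have := mB i; lia.
have := mB i; lia.
Qed.

(* Pigeonhole principle on the fractional parts of the coordinates of the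
   multiples of [e]. *)
Lemma dirichlet_recurrence L b e (eps T0 : R) : subgroup L -> spanned_by L b ->
  0 < eps -> exists T l, [/\ T0 <= T, 1 <= T, L l & vnorm (l - T *: e) < eps].
Proof.
move=> sL [bb bL] eps0; set n := size b.
pose c (i : 'I_n) : R := coord (in_tuple b) i e.
pose K := \sum_(i < n) vnorm b`_i.
have K0 : 0 <= K by apply: sumr_ge0 => i _; exact: vnorm_ge0.
pose N := (Num.truncn (K / eps)).+1.
have NK : K < N%:R * eps by rewrite -ltr_pdivrMr// truncnS_gt.
(* Only multiples of [k0] are compared, so that the difference of two distinct ones is at least
   [T0]. *)
pose k0 := (Num.truncn T0).+1.
pose z (j : nat) i : R := (j * k0)%:R * c i.
pose fr (j : nat) i : R := z j i - (Num.floor (z j i))%:~R.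
have fr01 j i : 0 <= fr j i < 1.
    have := floor_itv (z j i); rewrite intrD /fr => /andP[*].
  by apply/andP; split; lra.
pose f (j : 'I_(#|{ffun 'I_n -> 'I_N}|.+1)) : {ffun 'I_n -> 'I_N} :=
  [ffun i => inord (Num.truncn (N%:R * fr j i))].
have [j1 [j2 [j12 fj]]] : exists j1 j2 : 'I_(#|{ffun 'I_n -> 'I_N}|.+1), (j1 < j2)%N /\ f j1 = f j2.
  apply: contrapT => H; suff /leq_card : injective f by rewrite card_ord ltnn.
  move=> j1 j2 fj; apply/val_inj; have [j12|j12|//] := ltngtP j1 j2.
    by exfalso; apply: H; exists j1, j2.
  by exfalso; apply: H; exists j2, j1.
exists ((j2 - j1) * k0)%:R.
exists (\sum_(i < n) (Num.floor (z j2 i) - Num.floor (z j1 i))%:~R *: b`_i).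
split.
- apply: (@le_trans _ _ k0%:R); first exact/ltW/truncnS_gt.
  by rewrite ler_nat leq_pmull// subn_gt0.
- by rewrite ler1n muln_gt0 subn_gt0 j12.
- apply: subgroup_sum => // i _; apply: subgroupMz => //.
  by apply: bL; exact: mem_nth.
rewrite [X in _ *: X](basis_expansion e bb) scaler_sumr -sumrB.
apply: le_lt_trans (vnorm_sum _ _ _) _.
apply: (@le_lt_trans _ _ (\sum_(i < n) N%:R^-1 * vnorm b`_i)); last first.
  by rewrite -mulr_sumr ltr_pdivrMl ?ltr0n.
apply: ler_sum => i _; rewrite scalerA -scalerBl vnormZ ler_wpM2r ?vnorm_ge0//.
have -> : (Num.floor (z j2 i) - Num.floor (z j1 i))%:~R
    - ((j2 - j1) * k0)%:R * coord (in_tuple b) i e = fr j1 i - fr j2 i.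
  by rewrite intrB natrM natrB ?(ltnW j12)// /fr /z !natrM /c; ring.
have trE j : (Num.truncn (N%:R * fr j i))%:R <= N%:R * fr j i.
  by rewrite truncn_le// mulr_ge0//; have /andP[] := fr01 j i.
have trS j : N%:R * fr j i < (Num.truncn (N%:R * fr j i)).+1%:R := truncnS_gt _.
have frN j : (Num.truncn (N%:R * fr j i) < N)%N.
  have /andP[f0 f1] := fr01 j i.
  rewrite -(ltr_nat R); apply: le_lt_trans (trE j) _.
  by rewrite gtr_pMr// ltr0n.
have := congr1 (fun g : {ffun 'I_n -> 'I_N} => nat_of_ord (g i)) fj.
rewrite /f !ffunE !inordK ?frN// => tE.
rewrite -[leRHS]mul1r ler_pdivlMr ?ltr0n// -[X in _ * X]ger0_norm ?ler0n//.
rewrite -normrM mulrC mulrBr.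
have := trE j1; have := trS j1; have := trE j2; have := trS j2.
by rewrite tE -natr1 => *; rewrite ler_norml; apply/andP; split; lra.
Qed.

End Subgroups.

(** * Open cones and lattices *)

Section OpenCones.
Variables (R : realType) (V : vectType R).
Implicit Types (u v w x y : V) (C : set V).

(** Convexity appears as closure under sums. Nondegeneracy is left out because the cones [C + U] of
    the induction contain lines. *)
Definition open_cone C := [/\ lin_open C,
  forall x y, C x -> C y -> C (x + y),
  forall r x, 0 < r -> C x -> C (r *: x) & C !=set0].

Lemma open_nondegenerate_open_cone C :
  open_nondegenerate_convex_cone C -> open_cone C.
Proof.
move=> [oC _ /convex_setP cC [C0 CZ]]; split=> // x y Cx Cy.
have h2 : 0 < (2 : R)^-1 < 1 by rewrite invr_gt0 ltr0n/= invf_lt1 ?ltr1n.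
have := CZ 2 _ _ (cC _ _ _ Cx Cy h2); rewrite ltr0n => /(_ isT).
rewrite scalerDr !scalerA mulfV ?scale1r//.
by have -> : 2 * (1 - 2^-1) = 1 :> R; [lra|rewrite scale1r].
Qed.

Lemma open_cone_ball C x : open_cone C -> C x ->
  exists2 r, 0 < r & forall y, vnorm (y - x) < r -> C y.
Proof. by move=> [/lin_openP oC _ _ _] /oC. Qed.

(** A point [z] of [C] close to [y] is split off; the small remainder [y - z] is absorbed by the
    ball around [x]. *)
Lemma open_cone_addcl C x y : open_cone C -> C x -> lin_closure C y -> C (x + y).
Proof.
move=> oC Cx /lin_closureP cly; have [r r0 rC] := open_cone_ball oC Cx.
have [z Cz yz] := cly _ r0; case: oC => _ CD _ _.
rewrite (_ : x + y = (x + (y - z)) + z); last by rewrite addrA subrK.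
by apply: CD => //; apply: rC; rewrite [X in vnorm X]addrC addKr vnormC.
Qed.

Lemma closure_coneD C x y : open_cone C -> lin_closure C x -> lin_closure C y ->
  lin_closure C (x + y).
Proof.
move=> oC /lin_closureP clx cly; apply/lin_closureP => r r0.
have [z Cz xz] := clx _ r0; exists (z + y); first exact: open_cone_addcl.
by rewrite opprD addrACA subrr addr0.
Qed.

Lemma closure_coneZ C c x : open_cone C -> 0 <= c -> lin_closure C x ->
  lin_closure C (c *: x).
Proof.
move=> oC; rewrite le_eqVlt => /orP[/eqP <- _|c0 /lin_closureP clx].
  rewrite scale0r; apply/lin_closureP => r r0.
  case: oC => _ _ CZ [z Cz]; exists ((r / (vnorm z + 1)) *: z).
    by apply: CZ => //; rewrite divr_gt0// ltr_wpDl// vnorm_ge0.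
  rewrite subr0 vnormZ gtr0_norm ?divr_gt0 ?ltr_wpDl ?vnorm_ge0//.
  rewrite mulrAC ltr_pdivrMr ?ltr_wpDl ?vnorm_ge0//.
  by rewrite mulrDr mulr1 ltrDl.
apply/lin_closureP => r r0; have [z Cz zx] := clx _ (divr_gt0 r0 c0).
exists (c *: z); first by case: oC => _ _ CZ _; exact: CZ.
by rewrite -scalerBr vnormZ gtr0_norm// mulrC -ltr_pdivlMr.
Qed.

Lemma closure_cone0 C : open_cone C -> lin_closure C 0.
Proof.
move=> oC; have [_ _ _ [z Cz]] := oC.
rewrite -(scale0r z); apply: closure_coneZ => //; exact: sub_lin_closure.
Qed.

End OpenCones.

(** * Nonnegative combinations with bounded coefficients *)

Section BoundedCones.
Variables (R : realType) (V : vectType R).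
Implicit Types (u v w x y : V) (s t : seq V) (B : R).

Definition bcone s B : set V := [set v | exists2 a : nat -> R,
  (forall i, 0 <= a i <= B) & v = \sum_(i < size s) a i *: s`_i].

Lemma bcone_cone s B v : bcone s B v -> cone_over s v.
Proof. by move=> [a aB ->]; exists a => // i; have /andP[] := aB i. Qed.

Lemma bcone_ge0 s B v : bcone s B v -> 0 <= B.
Proof. by move=> [a aB _]; have /andP[/le_trans] := aB 0%N; apply. Qed.

Lemma bcone_le s B B' v : B <= B' -> bcone s B v -> bcone s B' v.
Proof.
move=> BB [a aB ->]; exists a => // i.
by have /andP[-> /=] := aB i; move=> /le_trans; apply.
Qed.

Lemma bcone0 s B : 0 <= B -> bcone s B 0.
Proof.
move=> B0; exists (fun=> 0) => [i|]; first by rewrite lexx.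
by rewrite big1// => i _; rewrite scale0r.
Qed.

Lemma bconeZ s B c v : 0 <= c -> bcone s B v -> bcone s (c * B) (c *: v).
Proof.
move=> c0 [a aB ->]; exists (fun i => c * a i) => [i|].
  by have /andP[a0 ab] := aB i; rewrite mulr_ge0//= ler_wpM2l.
by rewrite scaler_sumr; apply: eq_bigr => i _; rewrite scalerA.
Qed.

Lemma bcone_cat s t B u v : bcone s B u -> bcone t B v -> bcone (s ++ t) B (u + v).
Proof.
move=> [a aB ->] [b bB ->].
exists (fun i => if (i < size s)%N then a i else b (i - size s)%N).
  by move=> i; case: ifP.
rewrite size_cat big_split_ord/=; congr (_ + _); apply: eq_bigr => i _.
  by rewrite nth_cat ltn_ord.
by rewrite nth_cat ltnNge leq_addr/= addKn.
Qed.

Lemma bcone_flatten (T : eqType) (f : T -> seq V) (l : seq T) z B v : z \in l ->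
  bcone (f z) B v -> bcone (flatten [seq f i | i <- l]) B v.
Proof.
move=> + zv; have B0 := bcone_ge0 zv.
elim: l => // a l IH; rewrite inE => /orP[/eqP <-|/IH h] /=.
  by rewrite -[v]addr0; apply: bcone_cat => //; exact: bcone0.
by rewrite -[v]add0r; apply: bcone_cat => //; exact: bcone0.
Qed.

Lemma bcone_map (f : V -> V) s B (a : 'I_(size s) -> R) : 0 <= B ->
  (forall i, 0 <= a i <= B) ->
  bcone [seq f y | y <- s] B (\sum_(i < size s) a i *: f s`_i).
Proof.
(* Coefficients indexed by ordinals are extended by 0, which lies within the bounds because
   [0 <= B]. *)
move=> B0 aB; exists (fun n => odflt 0 (omap a (insub n))).
  by move=> n; case: insub => [i|] /=; rewrite ?aB ?lexx.
rewrite size_map; apply: eq_bigr => i _; rewrite (nth_map 0)//; congr (_ *: _).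
rewrite insubT//= => li; congr a; exact/val_inj.
Qed.

End BoundedCones.

(** * The cone generated by lattice points of an open cone, seen from one of them *)

Section VertexCone.
Variables (R : realType) (V : vectType R) (L : set V) (b : seq V).
Hypotheses (sL : subgroup L) (bL : spanned_by L b).
Implicit Types (u v w x y e : V) (C : set V) (W U : {vspace V}).

(** The parameter [t] is nonnegative so that [t *: e] lies in the closure of [C] when [e] does; see
    [ray_near_translate]. *)
Let ray_near W e (rho : R) l := exists (t : R) w,
  [/\ 0 <= t, w \in W & vnorm (l - t *: e - w) < rho].

Let ray_nearW W e rho rho' l : rho <= rho' ->
  ray_near W e rho l -> ray_near W e rho' l.
Proof. by move=> le [t [w [t0 wW h]]]; exists t, w; split=> //; exact: lt_le_trans le. Qed.

(* [U] is the smallest subspace containing [W] and the points of [L] that are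
   close to the ray of [e] modulo [W]; it does not depend on how close. *)
Let recurrent W U e := [/\ (W <= U)%VS, e \in U,
  exists2 rho : R, 0 < rho & forall l, L l -> ray_near W e rho l -> l \in U &
  forall rho : R, 0 < rho -> exists ls : seq V,
    [/\ forall l, l \in ls -> L l /\ ray_near W e rho l,
        (size ls <= \dim {:V})%N & U = (W + <<ls>>)%VS]].

(** [U] is of least dimension among the subspaces that contain [W] and all lattice points [rho]-near
    the ray for some [rho]. By minimality the points for a smaller [rho] still span [U] modulo
    [W]. *)
Let recurrent_exists W e : exists U, recurrent W U e.
Proof.
pose P d := `[< exists U, [/\ \dim U = d, (W <= U)%VS &
  exists2 rho : R, 0 < rho & forall l, L l -> ray_near W e rho l -> l \in U] >].
have exP : exists d, P d.
  exists (\dim {:V}); apply/asboolP; exists fullv; split=> //; first exact: subvf.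
  by exists 1 => // l _ _; exact: memvf.
have [d /asboolP[U [Ud WU [rho1 rho10 rhoU]]] dmin] := ex_minnP exP.
exists U; split=> //; first last.
- move=> rho rho0; pose rho' := Order.min rho rho1.
  have rho'0 : 0 < rho' by rewrite lt_min rho0.
  (* A list spanning as much as possible. Its length is kept below the dimension it spans: a point
     outside the span could be added, raising both by at least one. *)
  pose Q k := `[< exists ls : seq V, [/\ forall l, l \in ls -> L l /\ ray_near W e rho' l,
     (size ls <= \dim (W + <<ls>>))%N & \dim (W + <<ls>>) = k] >].
  have exQ : exists k, Q k.
    by exists (\dim (W + <<[::]>>)); apply/asboolP; exists [::].
  have Qb k : Q k -> (k <= \dim {:V})%N.
    by move=> /asboolP[ls [_ _ <-]]; exact/dimvS/subvf.
  have [k /asboolP[ls [lsL lsk lsd]] kmax] := ex_maxnP exQ Qb.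
  have sat l : L l -> ray_near W e rho' l -> l \in (W + <<ls>>)%VS.
    move=> Ll lr; apply: contrapT => /negP nl.
    have lt : (\dim (W + <<ls>>) < \dim (W + <<l :: ls>>))%N.
      have -> : (W + <<l :: ls>> = W + <<ls>> + <[l]>)%VS.
        by rewrite span_cons [(<[l]> + _)%VS]addvC addvA.
      rewrite ltnNge; apply: contraNN nl => le.
      have : (W + <<ls>> == W + <<ls>> + <[l]>)%VS by rewrite eqEdim addvSl.
      move=> /eqP ->; apply: (subvP (addvSr _ _)); exact: memv_line.
    have := kmax (\dim (W + <<l :: ls>>)); rewrite -lsd leqNgt lt => H.
    suff: false by []; apply: H; apply/asboolP; exists (l :: ls); split=> //.
      by move=> l'; rewrite inE => /orP[/eqP ->|/lsL].
    exact: leq_ltn_trans lt.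
  exists ls; split.
  + move=> l /lsL[Ll]; split=> //; apply: ray_nearW; last by eassumption.
    by rewrite ge_min lexx.
  + by rewrite (leq_trans lsk)//; exact/dimvS/subvf.
  apply/eqP; rewrite eq_sym eqEdim; apply/andP; split.
    rewrite subv_add WU; apply/span_subvP => l /lsL[Ll lr]; apply: rhoU => //.
    by apply: ray_nearW lr; rewrite ge_min lexx orbT.
  rewrite Ud; apply: dmin; apply/asboolP; exists (W + <<ls>>)%VS; split=> //.
    exact: addvSl.
  by exists rho'.
- by exists rho1.
(* [g] has kernel [U]. Dirichlet gives a lattice point of [U] close to [T *: e] with [1 <= T], so
   [g e] is arbitrarily small. *)
pose g := (\1 - projv U)%VF.
have gE v : g v = v - projv U v by rewrite !lfun_simp.
have [K K0 KP] := linear_vnorm_bounded g.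
suff : g e = 0 by rewrite gE => /eqP; rewrite subr_eq0 => /eqP ->; exact: memv_proj.
apply/vnorm_eq0/eqP; rewrite eq_le vnorm_ge0 andbT; apply/ler_addgt0Pr => eps eps0.
rewrite add0r; pose del := Order.min rho1 (eps / K).
have del0 : 0 < del by rewrite lt_min rho10 divr_gt0.
have [T [l [_ T1 Ll lT]]] := dirichlet_recurrence e 0 sL bL del0.
have T0 : 0 < T by rewrite (lt_le_trans _ T1).
have lU : l \in U.
  apply: rhoU => //; exists T, 0; rewrite mem0v subr0 ltW//; split=> //.
  by rewrite (lt_le_trans lT)// ge_min lexx.
have gl : g l = 0 by rewrite gE projv_id ?subrr.
have : vnorm (T *: g e) <= eps.
  rewrite -linearZ/= -vnormN -sub0r -gl -linearB; apply: le_trans (KP _) _.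
  rewrite mulrC -ler_pdivlMr// (le_trans (ltW lT))// ge_min lexx orbT//.
rewrite vnormZ gtr0_norm//; apply: le_trans.
by rewrite ler_peMl ?vnorm_ge0.
Qed.

(* The differences [l'' - l] with [l''] a much closer point further along the
   ray turn a spanning set into one whose cone is a neighbourhood of [e]. *)
Let recurrent_near_cone W U e rho : recurrent W U e -> 0 < rho ->
  exists ls (r M : R), [/\ 0 < r, 0 <= M,
    forall l, l \in ls -> [/\ L l, l \in U & ray_near W e rho l],
    (size ls <= (\dim {:V}).*2.+1)%N &
    forall u, u \in U -> vnorm (u - e) < r ->
      exists2 w, w \in W & bcone ls M (u - w)].
Proof.
move=> [WU eU [rho1 rho10 rhoU] rec] rho0.
have rho20 : 0 < rho / 2 by lra.
have [ls [lsL lsn UE]] := rec _ rho20; set m := size ls.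
pose h (i : 'I_m) v : R := coord (in_tuple ls) i (addv_pi2 W <<ls>>%VS v).
have hl i : linfunction (h i) by split=> *; rewrite /h ?linearD ?linearZ.
have hE q : q \in U -> q = addv_pi1 W <<ls>>%VS q + \sum_i h i q *: ls`_i.
  move=> qU; rewrite {1}UE in qU; rewrite -{1}(addv_pi1_pi2 qU); congr (_ + _).
  exact: (coord_span (X := in_tuple ls) (memv_pi2 _ _ _)).
have /choice[K KP] : forall i : 'I_m, exists K : R, 0 < K /\
    forall v, `|h i v| <= K * vnorm v.
  by move=> i; have [K K0 KP] := linfunction_bounded (hl i); exists K.
pose K1 := 1 + \sum_i K i.
have K10 : 0 < K1 by rewrite ltr_pwDl// sumr_ge0// => i _; exact: ltW (KP i).1.
have hK i v : `|h i v| <= K1 * vnorm v.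
  apply: le_trans ((KP i).2 v) _; rewrite ler_wpM2r ?vnorm_ge0// /K1 (bigD1 i)//=.
  by rewrite addrCA lerDl addr_ge0// sumr_ge0// => j _; exact: ltW (KP j).1.
have /choice[t tP] : forall i : 'I_m, exists t : R, exists w,
    [/\ 0 <= t, w \in W & vnorm (ls`_i - t *: e - w) < rho / 2].
  by move=> i; have [] := lsL ls`_i (mem_nth _ (ltn_ord i)).
pose eta : R := m.+1%:R^-1.
have eta0 : 0 < eta by rewrite invr_gt0 ltr0n.
(* The three bounds put [l''] into [U], keep the differences [l'' - l] within [rho] of the ray, and
   make the coordinates of the later remainder [q] at most [eta]. *)
pose eps := Order.min (Order.min rho1 (rho / 2)) (eta / (2 * K1)).
have eps0 : 0 < eps by rewrite !lt_min rho10 rho20 divr_gt0// mulr_gt0.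
(* [T] exceeds every [t i], so that [l'' - ls_i] is near the ray with the nonnegative parameter
   [T - t i]. *)
have [T [l'' [Tt T1 Ll'' l''T]]] := dirichlet_recurrence e (\sum_i t i) sL bL eps0.
have T0 : 0 < T by rewrite (lt_le_trans _ T1).
have ti0 i : 0 <= t i by have [w []] := tP i.
have tT i : t i <= T.
  by rewrite (le_trans _ Tt)// (bigD1 i)//= lerDl sumr_ge0.
have l''near rho' : eps <= rho' -> ray_near W e rho' l''.
  by move=> le; exists T, 0; rewrite mem0v subr0 ltW//; split=> //; exact: lt_le_trans le.
have l''U : l'' \in U.
  by apply: rhoU => //; apply: l''near; rewrite !ge_min lexx.
have lsU l : l \in ls -> l \in U.
  by move=> lls; rewrite UE; apply: (subvP (addvSr _ _)); exact: memv_span.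
exists ((l'' :: ls) ++ [seq l'' - l | l <- ls]), (eta / (2 * K1 * T)), 2.
split=> //.
- by rewrite divr_gt0// !mulr_gt0.
- move=> l; rewrite mem_cat inE -orbA => /or3P[/eqP ->|lls|/mapP[l0 l0ls ->]].
  + by split=> //; apply: l''near; rewrite !ge_min; apply/orP; left; apply/orP; right; lra.
  + have [Ll lr] := lsL _ lls; split=> //; first exact: lsU.
    by apply: ray_nearW lr; lra.
  + have [Ll _] := lsL _ l0ls; split; first exact: sL.2.
      by rewrite rpredB// lsU.
    have i0 : (index l0 ls < m)%N by rewrite index_mem.
    have [w [_ wW ht]] := tP (Ordinal i0); rewrite /= nth_index// in ht.
    exists (T - t (Ordinal i0)), (- w); rewrite subr_ge0 tT rpredN wW; split=> //.
    rewrite scalerBl.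
    have -> : l'' - l0 - (T *: e - t (Ordinal i0) *: e) - - w =
      (l'' - T *: e) - (l0 - t (Ordinal i0) *: e - w).
      by vec_ring.
    apply: le_lt_trans (vnormD _ _) _; rewrite vnormN.
    have : eps <= rho / 2 by rewrite !ge_min lexx orbT.
    lra.
- by rewrite size_cat/= size_map ltnS -addnn leq_add.
move=> u uU ue.
pose q := T *: u - l''.
have qU : q \in U by rewrite rpredB// rpredZ.
have qn : vnorm q <= eta / K1.
  have -> : q = T *: (u - e) - (l'' - T *: e) by rewrite scalerBr opprB addrA subrK.
  apply: le_trans (vnormD _ _) _; rewrite vnormN vnormZ gtr0_norm//.
  have e1 : vnorm (l'' - T *: e) <= eta / (2 * K1).
    by rewrite (le_trans (ltW l''T))// ge_min lexx orbT.
  have e2 : T * vnorm (u - e) <= eta / (2 * K1).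
    rewrite mulrC -ler_pdivlMr// (le_trans (ltW ue))// le_eqVlt; apply/orP; left.
    by apply/eqP; field; rewrite !gt_eqF.
  have -> : eta / K1 = eta / (2 * K1) + eta / (2 * K1) by field; rewrite gt_eqF.
  by rewrite addrC lerD.
have hq i : - eta <= h i q <= eta.
  rewrite -ler_norml (le_trans (hK _ _))//.
  by rewrite mulrC -ler_pdivlMr.
pose w := T^-1 *: addv_pi1 W <<ls>>%VS q.
exists w; first by rewrite rpredZ// memv_pi1.
pose S1 := \sum_(i < m) h i q *: ls`_i; pose S0 := \sum_(i < m) ls`_i.
have E1 : \sum_(i < m) (h i q + eta) *: ls`_i = S1 + eta *: S0.
  by rewrite scaler_sumr -big_split; apply: eq_bigr => i _; rewrite scalerDl.
have E2 : \sum_(i < m) eta *: (l'' - ls`_i) = (m%:R * eta) *: l'' - eta *: S0.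
  rewrite -scaler_sumr sumrB scalerBr sumr_const card_ord; congr (_ - _).
  by rewrite -scaler_nat scalerA mulrC.
(* The signed coefficients [h i q] are shifted by [eta] to become nonnegative; the differences
   [l'' - ls_i] compensate the shift at the cost of [m * eta <= 1] copies of [l'']. *)
have -> : u - w = T^-1 *: ((1 - m%:R * eta) *: l'' +
    \sum_(i < m) (h i q + eta) *: ls`_i + \sum_(i < m) eta *: (l'' - ls`_i)).
  have qE := hE q qU; rewrite -/S1 in qE.
  have -> : u = T^-1 *: (q + l'').
    by rewrite subrK scalerA mulVf ?gt_eqF// scale1r.
  rewrite {}E1 {}E2 {1}qE /w; move: (addv_pi1 _ _ q) => p1.
  move: (S1) (S0) (T^-1) (m%:R : R) (eta) => x1 x2 x3 x4 x5; vec_ring.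
have etam : m%:R * eta <= 1.
  by rewrite ler_pdivrMr ?ltr0n// mul1r ler_nat.
have eta1 : eta <= 1 by rewrite invf_le1 ?ltr0n// ler1n.
have TV : T^-1 <= 1 by rewrite invf_le1.
have TV0 : 0 <= T^-1 by rewrite invr_ge0 ltW.
apply: (@bcone_le _ _ _ (T^-1 * 2)); first lra.
apply: bconeZ => //; apply: bcone_cat; last first.
  by apply: (@bcone_map _ _ (fun y => l'' - y)) => // i; apply/andP; split; lra.
rewrite -cat1s; apply: bcone_cat.
  exists (fun=> 1 - m%:R * eta) => [i|]; last by rewrite big_ord1.
  have : 0 <= m%:R * eta by rewrite mulr_ge0// ltW.
  by move=> ?; apply/andP; split; lra.
rewrite -[X in bcone X](map_id ls); apply: (@bcone_map _ _ id) => // i.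
by have /andP[] := hq i => *; apply/andP; split; lra.
Qed.

Let ray_near_translate C W e rho c l : open_cone C ->
  (forall c w, C c -> w \in W -> C (c + w)) -> lin_closure C e ->
  (forall y, vnorm (y - c) < rho -> C y) -> ray_near W e rho l -> C (c + l).
Proof.
move=> oC CW cle ball [t [w [t0 wW lt]]].
rewrite (_ : c + l = (c + (l - t *: e - w)) + t *: e + w); last by vec_ring.
apply: CW => //; apply: open_cone_addcl => //; last exact: closure_coneZ.
by apply: ball; rewrite addrC addKr.
Qed.

(** For large [s] the vector [s *: e - u] is, modulo [W], a nonnegative combination of lattice
    points near the ray. Rounding the coefficients up gives [l]; it cancels [u] up to multiples of
    [e], elements of [W] and an error that the ball around [c] absorbs. *)
Let recurrent_lift C W U e y c u : open_cone C ->
  (forall c w, C c -> w \in W -> C (c + w)) -> lin_closure C e ->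
  recurrent W U e -> L y -> C c -> u \in U -> y = c + u ->
  exists l, [/\ l \in U, L l & C (y + l)].
Proof.
move=> oC CW cle rec Ly Cc uU yE.
have [rc rc0 rcP] := open_cone_ball oC Cc.
(* [n] bounds the number of generators whatever [rho] is, so [rho] can be fixed beforehand with a
   total rounding error below [rc]. *)
set n := (\dim {:V}).*2.+1; pose rho := rc / n.+1%:R.
have rho0 : 0 < rho by rewrite divr_gt0.
have [ls [r [M [r0 M0 lsP lsn near]]]] := recurrent_near_cone rec rho0.
have [_ eU _ _] := rec.
(* Large enough for [e - s^-1 *: u] to be within [r] of [e]. *)
pose s := (vnorm u + 1) / r.
have s0 : 0 < s by rewrite divr_gt0// ltr_wpDl// vnorm_ge0.
have [||w wW [a aM aE]] := near (e - s^-1 *: u).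
- by rewrite rpredB// rpredZ.
- rewrite addrC addKr vnormN vnormZ gtr0_norm ?invr_gt0// invf_div mulrAC.
  rewrite ltr_pdivrMr ?ltr_wpDl ?vnorm_ge0//.
  by rewrite mulrDr mulr1 ltrDl.
have /choice[p pP] : forall i : 'I_(size ls), exists p : R * V,
    [/\ 0 <= p.1, p.2 \in W & vnorm (ls`_i - p.1 *: e - p.2) < rho].
  move=> i; have [_ _ [t [w' h]]] := lsP ls`_i (mem_nth _ (ltn_ord i)).
  by exists (t, w').
pose k i : int := Num.ceil (s * a i); pose th i : R := (k i)%:~R - s * a i.
have th01 i : 0 <= th i <= 1.
  have := ceil_itv (s * a i); rewrite intrB -/(k i) /th => /andP[*].
  by apply/andP; split; lra.
exists (\sum_(i < size ls) (k i)%:~R *: ls`_i); split.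
- by apply: rpred_sum => i _; rewrite rpredZ//; have [] := lsP _ (mem_nth 0 (ltn_ord i)).
- apply: subgroup_sum => // i _; apply: subgroupMz => //.
  by have [] := lsP _ (mem_nth 0 (ltn_ord i)).
pose D := \sum_(i < size ls) th i *: (ls`_i - (p i).1 *: e - (p i).2).
pose T := \sum_(i < size ls) th i * (p i).1.
pose W' := \sum_(i < size ls) th i *: (p i).2.
have lE : \sum_(i < size ls) (k i)%:~R *: ls`_i =
    s *: (e - s^-1 *: u - w) + (D + T *: e + W').
  rewrite aE scaler_sumr /D /T /W' scaler_suml -!big_split; apply: eq_bigr => i _ /=.
  rewrite (_ : (k i)%:~R = s * a i + th i); last by rewrite /th; ring.
  by move: (th i) (a i) (p i).1 (p i).2 => x1 x2 x3 x4; vec_ring.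
rewrite lE yE.
have -> : c + u + (s *: (e - s^-1 *: u - w) + (D + T *: e + W')) =
   (c + D) + (s + T) *: e + (W' - s *: w).
  rewrite !scalerBr scalerA mulfV ?gt_eqF// scale1r.
  by move: (D) (T) (W') (s) => x1 x2 x3 x4; vec_ring.
apply: CW; last first.
  by rewrite rpredB ?rpredZ//; apply: rpred_sum => i _; rewrite rpredZ//; have [] := pP i.
apply: open_cone_addcl => //; last first.
  apply: closure_coneZ => //; rewrite addr_ge0 ?(ltW s0)// sumr_ge0// => i _.
  by rewrite mulr_ge0//; [have /andP[] := th01 i|have [] := pP i].
apply: rcP; rewrite addrC addKr; apply: le_lt_trans (vnorm_sum _ _ _) _.
apply: (@le_lt_trans _ _ (\sum_(i < size ls) rho)).
  apply: ler_sum => i _; rewrite vnormZ; have /andP[t0 t1] := th01 i.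
  rewrite ger0_norm//; have [_ _ h] := pP i; apply: le_trans (ltW h).
  by rewrite ler_piMl// vnorm_ge0.
rewrite sumr_const card_ord -mulr_natr /rho mulrAC ltr_pdivrMr//.
by rewrite ltr_pM2l// ltr_nat ltnS.
Qed.

(** The hypothesis treats [v - e] modulo [U] with coefficients of the order of its norm. Once its
    generators are lifted into [C], what remains of [v] lies in [U] close to [e], where the cone of
    lattice points near the ray applies. *)
Let vertex_local C W U x e : open_cone C ->
  (forall c w, C c -> w \in W -> C (c + w)) -> C x -> L x -> lin_closure C e ->
  recurrent W U e ->
  (exists ys M, [/\ 0 <= M,
     forall y, y \in ys -> L y /\ exists c u, [/\ C c, u \in U & y = c + u] &
     forall v, lin_closure C (v + e) ->
       exists2 w, w \in U & bcone [seq y - x | y <- ys] (M * vnorm v) (v - w)]) ->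
  exists ys r M, [/\ 0 < r, 0 <= M, forall y, y \in ys -> C y /\ L y &
     forall v, lin_closure C v -> vnorm (v - e) < r ->
       exists2 w, w \in W & bcone [seq y - x | y <- ys] M (v - w)].
Proof.
move=> oC CW Cx Lx cle rec [ys [M [M0 ysP IH]]].
have [_ eU _ _] := rec.
(* [f y] is the lift of [y] from [C + U] to a lattice point of [C], congruent to [y] modulo [U]. *)
have /choice[f fP] : forall y, exists z, y \in ys -> [/\ z - y \in U, C z & L z].
  move=> y; have [yys|] := boolP (y \in ys); last by exists 0.
  have [Ly [c [u [Cc uU yE]]]] := ysP _ yys.
  have [l [lU Ll Cyl]] := recurrent_lift oC CW cle rec Ly Cc uU yE.
  by exists (y + l) => _; split=> //; [rewrite addrC addKr|exact: subgroupD].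
have [rx rx0 rxP] := open_cone_ball oC Cx.
have [ls [r1 [M1 [r10 M10 lsP _ near]]]] := recurrent_near_cone rec rx0.
pose K := \sum_(i < size ys) vnorm (f ys`_i - x).
have K0 : 0 <= K by apply: sumr_ge0 => i _; exact: vnorm_ge0.
have MK : 0 < 1 + M * K by rewrite ltr_pwDl// mulr_ge0.
(* The lifted part [S] has norm at most [M * K * vnorm (v - e)], so [v - S] is within [r1] of
   [e]. *)
pose r := r1 / (1 + M * K); have r0 : 0 < r by rewrite divr_gt0.
exists ([seq f y | y <- ys] ++ [seq x + l | l <- ls]), r, (M * r + M1).
split=> //.
- by rewrite addr_ge0// mulr_ge0// ltW.
- move=> y; rewrite mem_cat => /orP[/mapP[z /fP[_ Cz Lz] -> //]|/mapP[l lls ->]].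
  have [Ll _ lr] := lsP _ lls; split; last exact: subgroupD.
  exact: (ray_near_translate oC CW cle rxP lr).
move=> v clv ve.
have [|w0 w0U [a aM aE]] := IH (v - e); first by rewrite subrK.
rewrite size_map in aE.
have {}aE : v - e - w0 = \sum_(i < size ys) a i *: (ys`_i - x).
  by rewrite aE; apply: eq_bigr => i _; rewrite (nth_map 0).
pose S := \sum_(i < size ys) a i *: (f ys`_i - x).
have SU : v - S \in U.
  have -> : v - S = e + w0 - \sum_(i < size ys) a i *: (f ys`_i - ys`_i).
    apply/eqP; rewrite -subr_eq0 (_ : _ - _ = (v - e - w0) - (S -
      \sum_(i < size ys) a i *: (f ys`_i - ys`_i))); last by move: (S) (\sum_(i < _) _) => x1 x2; vec_ring.
    rewrite aE /S -sumrB subr_eq0; apply/eqP; apply: eq_bigr => i _.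
    by move: (f ys`_i) ys`_i (a i) => x1 x2 x3; vec_ring.
  apply: rpredB; first exact: rpredD.
  apply: rpred_sum => i _; rewrite rpredZ//.
  by have [] := fP _ (mem_nth 0 (ltn_ord i)).
have Sn : vnorm S <= M * vnorm (v - e) * K.
  apply: le_trans (vnorm_sum _ _ _) _; rewrite mulr_sumr; apply: ler_sum => i _.
  by rewrite vnormZ ler_wpM2r ?vnorm_ge0//; have /andP[a0 a1] := aM i; rewrite ger0_norm.
have [|w1 w1W bw] := near _ SU.
  rewrite (_ : v - S - e = (v - e) - S); last by move: (S) => x1; vec_ring.
  apply: le_lt_trans (vnormD _ _) _; rewrite vnormN.
  apply: (@le_lt_trans _ _ (vnorm (v - e) * (1 + M * K))); first by lra.
  by rewrite -ltr_pdivlMr.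
exists w1 => //; rewrite (_ : v - w1 = S + (v - S - w1)); last by move: (S) => x1; vec_ring.
rewrite map_cat -!map_comp; apply: bcone_cat.
  apply: (@bcone_le _ _ _ (M * r)); first lra.
  apply: (@bcone_map _ _ (fun y => f y - x)); first by rewrite mulr_ge0// ltW.
  move=> i; have /andP[-> /= a1] := aM i; apply: le_trans a1 _.
  by rewrite ler_wpM2l// ltW.
rewrite (@eq_map _ _ _ id) ?map_id; last by move=> l /=; rewrite addrC addKr.
by apply: bcone_le bw; rewrite lerDr mulr_ge0// ltW.
Qed.

(** Induction on the codimension of a subspace [W] under which [C] is invariant. The bound
    [M * vnorm v] is what [vertex_local] requires of the next smaller codimension. *)
Let vertex_cone_rec n C W x : (\dim {:V} - \dim W < n)%N -> open_cone C ->
  (forall c w, C c -> w \in W -> C (c + w)) -> C x -> L x ->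
  exists ys M, [/\ 0 <= M, forall y, y \in ys -> C y /\ L y &
    forall v, lin_closure C v ->
      exists2 w, w \in W & bcone [seq y - x | y <- ys] (M * vnorm v) (v - w)].
Proof.
elim: n C W => // n IHn C W dW oC CW Cx Lx.
(* Modulo [W] every direction is represented in a complement, where the unit vectors of the closure
   form a compact set. *)
pose D := [set e | [/\ lin_closure C e, e \in (W^C)%VS & vnorm e = 1]].
have loc e : exists q : seq V * R * R, D e ->
    [/\ 0 < q.1.2, 0 <= q.2, forall y, y \in q.1.1 -> C y /\ L y &
     forall v, lin_closure C v -> vnorm (v - e) < q.1.2 ->
       exists2 w, w \in W & bcone [seq y - x | y <- q.1.1] q.2 (v - w)].
  have [De|nDe] := pselect (D e); last by exists ([::], 0, 0).
  have [cle eW e1] := De.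
  have [U rec] := recurrent_exists W e.
  have [WU eU _ _] := rec.
  suff [ys [r [M h]]] : exists ys r M, [/\ 0 < r, 0 <= M,
     forall y, y \in ys -> C y /\ L y &
     forall v, lin_closure C v -> vnorm (v - e) < r ->
       exists2 w, w \in W & bcone [seq y - x | y <- ys] M (v - w)].
    by exists (ys, r, M).
  apply: (vertex_local oC CW Cx Lx cle rec).
  pose C' := [set y | exists c u, [/\ C c, u \in U & y = c + u]].
  have CC' c : C c -> C' c by move=> Cc; exists c, 0; rewrite mem0v addr0.
  have C'U c u : C' c -> u \in U -> C' (c + u).
    move=> [c1 [u1 [Cc1 uU1 ->]]] uU; exists c1, (u1 + u).
    by rewrite rpredD// addrA.
  have [_ CD CZ [c0 Cc0]] := oC.
  have oC' : open_cone C'.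
    split.
    - apply/lin_openP => _ [c [u [Cc uU ->]]].
      have [r r0 rP] := open_cone_ball oC Cc; exists r => // y yr.
      exists (y - u), u; rewrite uU subrK; split=> //; apply: rP.
      by rewrite -addrA -opprD [u + c]addrC.
    - move=> _ _ [c [u [Cc uU ->]]] [c1 [u1 [Cc1 uU1 ->]]].
      by exists (c + c1), (u + u1); rewrite addrACA rpredD//; split=> //; exact: CD.
    - move=> r _ r0 [c [u [Cc uU ->]]].
      by exists (r *: c), (r *: u); rewrite scalerDr rpredZ//; split=> //; exact: CZ.
    - by exists c0; exact: CC'.
  have dU : (\dim {:V} - \dim U < n)%N.
    (* The induction progresses because [U] contains the nonzero vector [e] of the complement of
       [W]. *)
    have dWU : (\dim W < \dim U)%N.
      rewrite ltn_neqAle dimvS// andbT; apply/negP => /eqP dE.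
      have WE : W = U by apply/eqP; rewrite eqEdim WU dE/=.
      have : e \in (W :&: W^C)%VS by rewrite memv_cap eW WE eU.
      rewrite capv_compl memv0 => /eqP e0; move: e1; rewrite e0 vnorm0.
      by move=> /eqP; rewrite eq_sym oner_eq0.
    have := dimvS (subvf U); have := dimvS (subvf W); move: dW dWU; lia.
  have [ys [M [M0 ysP ysM]]] := IHn C' U dU oC' C'U (CC' _ Cx) Lx.
  exists ys, M; split=> // [y /ysP[]//|v /lin_closureP cl].
  apply: ysM; apply/lin_closureP => r r0; have [y Cy yr] := cl _ r0.
  (* Translating by [- e] keeps [C'] stable, so a vector [v] with [v + e] in the closure of [C] lies
     in the closure of [C']. *)
  exists (y - e); first by apply: C'U; [exact: CC'|rewrite rpredN].
  by rewrite -addrA -opprD [e + v]addrC.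
have /choice[q qP] := loc.
have [] := @compact_finite_cover _ V D 1 (fun e => (q e).1.2).
- move=> z /lin_closureP clz; have clC : lin_closure C z.
    apply: lin_closure_idem; apply/lin_closureP => r r0.
    by have [y [cly _ _] yr] := clz _ r0; exists y.
  split=> //.
    pose g := (\1 - projv (W^C)%VS)%VF.
    have gE v : g v = v - projv (W^C)%VS v by rewrite !lfun_simp.
    have [K K0 KP] := linear_vnorm_bounded g.
    suff : g z = 0.
      by rewrite gE => /eqP; rewrite subr_eq0 => /eqP ->; exact: memv_proj.
    apply/vnorm_eq0/eqP; rewrite eq_le vnorm_ge0 andbT; apply/ler_addgt0Pr => eps eps0.
    rewrite add0r; have [y [_ yW _] yz] := clz _ (divr_gt0 eps0 K0).
    have -> : g z = g (z - y) by rewrite linearB/= [g y]gE projv_id// subrr subr0.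
    apply: le_trans (KP _) _.
    by rewrite mulrC -ler_pdivlMr// vnormC ltW.
  apply/eqP; rewrite eq_le; apply/andP; split; apply/ler_addgt0Pr => eps eps0.
    have [y [_ _ y1] yz] := clz _ eps0.
    have := vnorm_triangle y z 0; rewrite !subr0 y1 vnormC; lra.
  have [y [_ _ y1] yz] := clz _ eps0.
  have := vnorm_triangle z y 0; rewrite !subr0 y1; lra.
- by move=> v [_ _ ->].
- by move=> v Dv; have [] := qP v Dv.
move=> es [esD esP].
pose M := \sum_(e <- es) (q e).2.
have M0 : 0 <= M by rewrite /M big_seq sumr_ge0// => e /esD/qP[].
pose ys := flatten [seq (q e).1.1 | e <- es].
pose pr := (\1 - projv W)%VF.
have prE v : pr v = v - projv W v by rewrite !lfun_simp.
have [K K0 KP] := linear_vnorm_bounded pr.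
exists ys, (K * M); split.
- by rewrite mulr_ge0// ltW.
- move=> y /flatten_mapP[e ees ye]; have [_ _ + _] := qP e (esD _ ees); exact.
move=> v clv.
have clp : lin_closure C (pr v).
  apply/lin_closureP => r r0; move/lin_closureP : clv => /(_ _ r0)[y Cy yv].
  exists (y - projv W v); first by apply: CW => //; rewrite rpredN memv_proj.
  by rewrite prE opprB addrA subrK.
have [p0|p0] := eqVneq (vnorm (pr v)) 0.
  exists v; last by rewrite subrr; apply: bcone0; rewrite mulr_ge0 ?vnorm_ge0// mulr_ge0// ltW.
  by have := vnorm_eq0 p0; rewrite prE => /eqP; rewrite subr_eq0 => /eqP ->; exact: memv_proj.
have pp : 0 < vnorm (pr v) by rewrite lt_neqAle eq_sym p0 vnorm_ge0.
have Dv : D ((vnorm (pr v))^-1 *: pr v).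
  split.
  - by apply: closure_coneZ => //; rewrite invr_ge0 ltW.
  - by rewrite rpredZ// prE memv_projC.
  - by rewrite vnormZ gtr0_norm ?invr_gt0// mulVf.
have [e ees ed] := esP _ Dv.
have [r0 Me0 _ /(_ _ _ ed)[|w wW bw]] := qP e (esD _ ees); first by have [] := Dv.
exists (projv W v + vnorm (pr v) *: w); first by rewrite rpredD ?memv_proj// rpredZ.
have -> : v - (projv W v + vnorm (pr v) *: w) =
    vnorm (pr v) *: ((vnorm (pr v))^-1 *: pr v - w).
  by rewrite scalerBr scalerA mulfV// scale1r opprD addrA -prE.
apply: (@bcone_le _ _ _ (vnorm (pr v) * (q e).2)).
  rewrite mulrAC; apply: ler_pM => //; [exact: vnorm_ge0|exact: KP|].
  rewrite /M (perm_big _ (perm_to_rem ees)) big_cons lerDl big_seq sumr_ge0//.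
  by move=> e' /mem_rem/esD/qP[].
apply: bconeZ; first exact: vnorm_ge0.
rewrite /ys; rewrite map_flatten -map_comp.
exact: (bcone_flatten (f := fun e => [seq y - x | y <- (q e).1.1]) ees bw).
Qed.

(* No group is involved here: this is what makes the convex hull of [C `&` L]
   locally polyhedral at its vertices, even towards irrational boundary rays. *)
Lemma vertex_cone C x : open_cone C -> C x -> L x ->
  exists2 ys, forall y, y \in ys -> C y /\ L y &
    lin_closure C `<=` cone_over [seq y - x | y <- ys].
Proof.
move=> oC Cx Lx.
have [|ys [M [_ ysP H]]] := @vertex_cone_rec _ C 0%VS x (ltnSn _) oC _ Cx Lx.
  by move=> c w Cc; rewrite memv0 => /eqP ->; rewrite addr0.
exists ys => // v /H[w]; rewrite memv0 => /eqP ->; rewrite subr0.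
exact: bcone_cone.
Qed.

End VertexCone.

(** * Rational structures *)

Section RationalStructures.
Variables (R : realType) (V : vectType R).
Implicit Types (u v w x y : V) (VQ L : set V) (b : seq V).

Definition rational_span b : set V := [set v | exists2 q : nat -> rat,
  True & v = \sum_(i < size b) ratr (q i) *: b`_i].

Lemma rational_span_Q_subspace b : Q_subspace (rational_span b).
Proof.
split.
- by exists (fun=> 0) => //; rewrite big1// => i _; rewrite rmorph0 scale0r.
- move=> _ _ [p _ ->] [q _ ->]; exists (fun i => p i + q i) => //.
  by rewrite -big_split; apply: eq_bigr => i _; rewrite rmorphD scalerDl.
- move=> c _ [q _ ->]; exists (fun i => c * q i) => //.
  by rewrite scaler_sumr; apply: eq_bigr => i _; rewrite rmorphM scalerA.
Qed.

Lemma Q_subspaceB VQ u v : Q_subspace VQ -> VQ u -> VQ v -> VQ (u - v).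
Proof.
by move=> [_ QD QZ] Qu Qv; apply: QD => //; have := QZ (-1) _ Qv; rewrite rmorphN1 scaleN1r.
Qed.

Lemma Q_subspace_sum VQ (I : Type) (r : seq I) (F : I -> V) :
  Q_subspace VQ -> (forall i, VQ (F i)) -> VQ (\sum_(i <- r) F i).
Proof.
by move=> [Q0 QD _] QF; apply: big_ind => // u v; exact: QD.
Qed.

Lemma rational_span_mem b x : x \in b -> rational_span b x.
Proof.
move=> /(nthP 0)[i ib <-].
exists (fun j => (j == i)%:R) => //; rewrite (bigD1 (Ordinal ib))//= eqxx rmorph1 scale1r.
rewrite big1 ?addr0// => j ji; rewrite (_ : (_ == _) = false) ?rmorph0 ?scale0r//.
by apply/negbTE; apply: contra ji => /eqP ji; apply/eqP/val_inj.
Qed.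

(* A maximal rational subspace containing the span of [b] but not [u] has
   codimension one, so there is a rational linear form that kills [b] and not
   [u]; it could not extend to a real linear form. *)
Lemma Q_structure_rational_span VQ b : Q_structure VQ -> basis_of fullv b ->
  (forall x, x \in b -> VQ x) -> VQ `<=` rational_span b.
Proof.
move=> [sQ univ] bb bQ u Qu; apply: contrapT => nu.
set B := rational_span b in nu.
have [B0 BD BZ] := rational_span_Q_subspace b; rewrite -/B in B0 BD BZ.
(* Taking the union with [B] makes the empty set admissible, as needed for the union of the empty
   chain. *)
pose P (H : set V) := Q_subspace (H `|` B) /\ ~ (H `|` B) u.
have [F FP totF|A [[sA nuA] Amax]] := @Zorn_bigcup V P.
  split; last by move=> [[H FH Hu]|//]; have [_] := FP _ FH; apply; left.
  split.
  - by right.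
  - move=> x y [[H FH Hx]|Bx] [[H' FH' Hy]|By].
    + have [HH|HH] := totF _ _ FH FH'.
        have [[_ D _] _] := FP _ FH'; have [?|?] := D x y (or_introl (HH _ Hx)) (or_introl Hy).
          by left; exists H'.
        by right.
      have [[_ D _] _] := FP _ FH; have [?|?] := D x y (or_introl Hx) (or_introl (HH _ Hy)).
        by left; exists H.
      by right.
    + have [[_ D _] _] := FP _ FH; have [?|?] := D x y (or_introl Hx) (or_intror By).
        by left; exists H.
      by right.
    + have [[_ D _] _] := FP _ FH'; have [?|?] := D x y (or_intror Bx) (or_introl Hy).
        by left; exists H'.
      by right.
    + by right; exact: BD.
  - move=> q x [[H FH Hx]|Bx]; last by right; exact: BZ.
    have [[_ _ D] _] := FP _ FH; have [?|?] := D q x (or_introl Hx).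
      by left; exists H.
    by right.
set M := A `|` B in sA nuA; have [M0 MD MZ] := sA.
(* If [v] is not in [M], then [M] enlarged by the rational multiples of [v] contains [u] by
   maximality; solving for [v] gives the coefficient. *)
have coef v : exists q : rat, M (v - ratr q *: u).
  have [Mv|nMv] := pselect (M v); first by exists 0; rewrite rmorph0 scale0r subr0.
  pose M' := [set x | exists m (q : rat), M m /\ x = m + ratr q *: v].
  have MM' m : M m -> M' m.
    by move=> Mm; exists m, 0; rewrite rmorph0 scale0r addr0.
  have M'v : M' v by exists 0, 1; rewrite rmorph1 scale1r add0r.
  have M'B : M' `|` B = M'.
    by apply/seteqP; split=> [x [//|Bx]|x]; [apply: MM'; right|left].
  have sM' : Q_subspace M'.
    split; first exact: MM'.
      move=> _ _ [m [q [Mm ->]]] [m' [q' [Mm' ->]]].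
      exists (m + m'), (q + q'); split; first exact: MD.
      by rewrite rmorphD scalerDl addrACA.
    move=> q _ [m [q' [Mm ->]]]; exists (ratr q *: m), (q * q').
    split; first exact: MZ.
    by rewrite rmorphM scalerDr scalerA.
  have : ~ P M'.
    apply: Amax; split=> [x Ax|E]; first by apply: MM'; left.
    by apply: nMv; left; exact: E.
  have [M'u|nM'u] := pselect (M' u); last by move=> H; exfalso; apply: H; rewrite /P M'B.
  move=> _; have [m [q [Mm uE]]] := M'u.
  have [q0|q0] := eqVneq q 0; first by exfalso; apply: nuA; rewrite uE q0 rmorph0 scale0r addr0.
  exists q^-1; have qq : ratr q^-1 * ratr q = 1 :> R by rewrite -rmorphM mulVf// rmorph1.
  rewrite uE (_ : v - _ = 0 - ratr q^-1 *: m).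
    exact: (Q_subspaceB sA M0 (MZ _ _ Mm)).
  move: (ratr q^-1) (ratr q) qq => c1 c2 c12.
  by vec_coord; rewrite mulrDr mulrA c12; ring.
have uniq_coef v p q : M (v - ratr p *: u) -> M (v - ratr q *: u) -> p = q.
  move=> Mp Mq; apply/eqP; rewrite -subr_eq0; apply/negPn/negP => pq.
  apply: nuA; have := MZ (p - q)^-1 _ (Q_subspaceB sA Mq Mp).
  have -> : v - ratr q *: u - (v - ratr p *: u) = ratr (p - q) *: u.
    have -> : ratr (p - q) = ratr p - ratr q :> R by exact: rmorphB.
    by move: (ratr p) (ratr q) => c1 c2; vec_ring.
  have -> : ratr (p - q)^-1 *: (ratr (p - q) *: u) = u; last by [].
  by rewrite scalerA -rmorphM mulVf// rmorph1 scale1r.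
have /choice[c cP] := coef.
(* This rational form takes the value 1 at [u] and 0 on [b], while an extension linear over the
   reals vanishes with the basis [b]. *)
pose f v : R^o := ratr (c v).
have [F [FE _]] : exists F : {linear V -> R^o}, (forall u, VQ u -> F u = f u) /\
    forall G : {linear V -> R^o}, (forall u, VQ u -> G u = f u) -> G =1 F.
  apply: univ; split=> [x y _ _|q x _]; rewrite /f.
    rewrite -rmorphD; congr ratr; apply: uniq_coef (cP _) _.
    by rewrite rmorphD scalerDl opprD addrACA; apply: MD.
  rewrite /GRing.scale/= -rmorphM; congr ratr; apply: uniq_coef (cP _) _.
  by have := MZ q _ (cP x); rewrite scalerBr scalerA -rmorphM.
have fb x : x \in b -> f x = 0.
  move=> xb; rewrite /f (uniq_coef x (c x) 0) ?rmorph0// scale0r subr0.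
  by right; exact: rational_span_mem.
have : F u = 0.
  rewrite (basis_expansion u bb) linear_sum big1// => i _.
  have xb : b`_i \in b by exact: mem_nth.
  have Fb : F b`_i = 0 by rewrite FE; [exact: fb|exact: bQ].
  by rewrite linearZ Fb; exact: scaler0.
rewrite FE// /f (uniq_coef u (c u) 1) ?rmorph1//.
  by move=> /eqP; rewrite oner_eq0.
by rewrite scale1r subrr.
Qed.

Lemma Q_structure_of_basis VQ b : Q_subspace VQ -> basis_of fullv b ->
  (forall x, x \in b -> VQ x) -> VQ `<=` rational_span b -> Q_structure VQ.
Proof.
move=> sQ bb bQ Qb; split=> // W f [fD fZ].
have [Q0 QD QZ] := sQ.
have f0 : f 0 = 0.
  by have := fZ 0 0 Q0; rewrite rmorph0 !scale0r.
pose F v : W := \sum_(i < size b) coord (in_tuple b) i v *: f b`_i.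
have linF : linear F.
  move=> a u v; rewrite /F scaler_sumr -big_split; apply: eq_bigr => i _ /=.
  by rewrite linearD linearZ/= scalerDl scalerA.
pose h : {linear V -> W} := HB.pack F (GRing.isLinear.Build _ _ _ _ F linF).
exists h; split=> [u /Qb[q _ uE]|G GE v]; last first.
  rewrite {1}(basis_expansion v bb) linear_sum; apply: eq_bigr => i _.
  by rewrite linearZ GE//; apply: bQ; exact: mem_nth.
rewrite -[LHS]/(F u) {2}uE.
(* Since [f] is additive only on [VQ], membership of the partial sums is proved along with the
   formula. *)
have fsum (r : seq 'I_(size b)) :
    VQ (\sum_(i <- r) ratr (q i) *: b`_i) /\
    f (\sum_(i <- r) ratr (q i) *: b`_i) = \sum_(i <- r) ratr (q i) *: f b`_i.
  elim: r => [|i r [IH1 IH2]]; first by rewrite !big_nil.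
  have bi : VQ b`_i by apply: bQ; exact: mem_nth.
  by rewrite !big_cons fD ?IH2 ?fZ//; [split=> //; apply: QD => //; exact: QZ|exact: QZ].
rewrite (fsum _).2 /F; apply: eq_bigr => i _.
by rewrite uE (coord_basis_sum (fun i => ratr (q i)) i bb).
Qed.

Lemma rational_span_multiple VQ L : Q_structure VQ -> lattice_in VQ L ->
  forall u, VQ u -> exists2 N, (0 < N)%N & L (N%:R *: u).
Proof.
move=> hQ [lL LQ] u Qu; have sL := lattice_subgroup lL.
have [b [bb bL]] := lattice_spanned lL.
have [|q _ ->] := Q_structure_rational_span hQ bb _ Qu; first by move=> x /bL/LQ.
(* [N] is the product of the denominators of the coordinates. *)
have [N N0 NP] : exists2 N, (0 < N)%N & forall i, (i < size b)%N ->
    exists m : int, N%:R * ratr (q i) = m%:~R :> R.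
  elim: (size b) => [|n [N N0 NP]]; first by exists 1%N.
  exists (N * absz (denq (q n)))%N; first by rewrite muln_gt0 N0 absz_gt0 denq_neq0.
  have dE : (absz (denq (q n)))%:R = (denq (q n))%:~R :> R.
    by rewrite -[in RHS](gtz0_abs (denq_gt0 _)).
  move=> i; rewrite ltnS leq_eqVlt => /orP[/eqP ->|/NP[m mE]].
    exists (N%:Z * numq (q n)); rewrite natrM dE -mulrA intrM; congr (_ * _).
    have d0 : (denq (q n))%:~R != 0 :> R by rewrite intr_eq0 denq_neq0.
    by rewrite /ratr mulrCA mulfV// mulr1.
  by exists ((denq (q n)) * m); rewrite natrM dE intrM -mE; ring.
exists N => //; rewrite scaler_sumr; apply: subgroup_sum => // i _.
have [m mE] := NP i (ltn_ord i).
rewrite scalerA mE; apply: subgroupMz => //; apply: bL; exact: mem_nth.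
Qed.

Lemma cone_over_basis (b : seq V) v : basis_of fullv b -> cone_over (b ++ map -%R b) v.
Proof.
move=> bb; rewrite (basis_expansion v bb); apply: big_ind => [||i _].
- exact: cone_over0.
- exact: cone_overD.
set c := coord _ _ _; have bi : b`_i \in b by exact: mem_nth.
have [c0|c0] := leP 0 c.
  by apply: cone_overZ => //; apply: cone_over_mem; rewrite mem_cat bi.
rewrite -[c]opprK scaleNr -scalerN; apply: cone_overZ; first by rewrite oppr_ge0 ltW.
by apply: cone_over_mem; rewrite mem_cat map_f ?orbT.
Qed.

(** These rational generators of the whole space are the starting point of the double
    description. *)
Lemma Q_structure_generators VQ L : Q_structure VQ -> lattice_in VQ L ->
  exists2 s : seq V, forall v, cone_over s v & forall v, v \in s -> VQ v.
Proof.
move=> hVQ [lL LQ]; have [b [bb bL]] := lattice_spanned lL.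
exists (b ++ map -%R b) => v; first exact: cone_over_basis.
have [Q0 _ _] := hVQ.1.
rewrite mem_cat => /orP[/bL/LQ//|/mapP[y /bL/LQ Qy ->]].
by rewrite -sub0r; exact: (Q_subspaceB hVQ.1).
Qed.

(* The coordinates of a point of [C] are made rational one at a time. *)
Lemma open_sub_convex VQ b (C H : set V) : Q_subspace VQ -> basis_of fullv b ->
  (forall x, x \in b -> VQ x) -> lin_open C ->
  convex_set (H : set (convex_lmodType V)) -> C `&` VQ `<=` H -> C `<=` H.
Proof.
move=> sQ bb bQ /lin_openP oC /convex_setP cH CQH.
(* The coordinates of index at least [k] are rational. To free coordinate [k], [v] is written as a
   convex combination of two nearby points whose coordinate [k] is rational. *)
suff main k : (k <= size b)%N -> forall v, C v ->
    (forall i : 'I_(size b), (k <= i)%N -> exists q : rat, coord (in_tuple b) i v = ratr q) ->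
    H v.
  by move=> v Cv; apply: (main (size b)) => // i; rewrite leqNgt ltn_ord.
elim: k => [|k IH] kb v Cv vq.
  apply: CQH; split=> //; rewrite (basis_expansion v bb); apply: Q_subspace_sum => // i.
  have [q ->] := vq i isT; case: sQ => _ _; apply; apply: bQ; exact: mem_nth.
have [r r0 rP] := oC _ Cv.
pose ik := Ordinal kb; pose c := coord (in_tuple b) ik v.
pose d := r / (1 + vnorm b`_k).
have d0 : 0 < d by rewrite divr_gt0// ltr_pwDl// vnorm_ge0.
have mv (q : rat) : `|ratr q - c| < d -> H (v + (ratr q - c) *: b`_k).
  move=> qc; apply: IH; first exact: ltnW.
    apply: rP; rewrite addrC addKr vnormZ.
    apply: (@le_lt_trans _ _ (`|ratr q - c| * (1 + vnorm b`_k))).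
      by rewrite ler_wpM2l// lerDr.
    by rewrite -ltr_pdivlMr// ltr_pwDl// vnorm_ge0.
  move=> i ki; rewrite linearD linearZ/=.
  have -> : coord (in_tuple b) i b`_k = (i == k :> nat)%:R.
    have := coord_free ik i (basis_free bb : free (in_tuple b)).
    by rewrite eq_sym -val_eqE.
  have [ik'|ik'] := eqVneq (i : nat) k.
    have -> : i = ik by exact/val_inj.
    by exists q; rewrite -/c /= mulr1 addrC subrK.
  by rewrite mulr0 addr0; apply: vq; rewrite ltn_neqAle eq_sym ik'.
have [|p] := @rat_in_itvoo R (c - d) c; first by lra.
have [|q] := @rat_in_itvoo R c (c + d); first by lra.
rewrite !in_itv/= => /andP[q1 q2] /andP[p1 p2].
pose t := (ratr q - c) / (ratr q - ratr p).
have qp : 0 < ratr q - ratr p :> R by lra.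
have t0 : 0 < t < 1.
  by rewrite divr_gt0//=; [rewrite ltr_pdivrMr// mul1r; lra|lra].
have -> : v = t *: (v + (ratr p - c) *: b`_k) + (1 - t) *: (v + (ratr q - c) *: b`_k).
  have E : t * (ratr p - c) + (1 - t) * (ratr q - c) = 0.
    by rewrite /t; field; rewrite gt_eqF.
  rewrite !scalerDr addrACA -scalerDl [t + _]addrC subrK scale1r.
  by rewrite !scalerA -scalerDl E scale0r addr0.
apply: cH => //; apply: mv; rewrite ltr_norml; apply/andP; split; lra.
Qed.

End RationalStructures.

(** * The open dual cone *)

Section LinearForms.
Variables (R : realType) (V : vectType R).
Implicit Types (u v w x y : V) (f g : 'Hom(V, R^o)).

Lemma hom_linfunction f : linfunction (fun v => f v : R).
Proof. by split=> *; [exact: linearD|exact: linearZ]. Qed.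

Lemma eval_linfunction v : linfunction (fun f : 'Hom(V, R^o) => f v : R).
Proof. by split=> *; [exact: add_lfunE|exact: scale_lfunE]. Qed.

Lemma linfunction_hom (h : V -> R) : linfunction h ->
  exists f : 'Hom(V, R^o), forall v, (f v : R) = h v.
Proof.
move=> [hD hZ]; have lin : linear (h : V -> R^o).
  by move=> a u v; rewrite hD hZ.
pose k : {linear V -> R^o} := HB.pack (h : V -> R^o) (GRing.isLinear.Build _ _ _ _ (h : V -> R^o) lin).
by exists (linfun k) => v; rewrite lfunE.
Qed.

Lemma vnorm_le_coord v (a : R) : 0 <= a ->
  (forall i, `|v2r v 0 i : R| <= a) -> vnorm v <= a.
Proof.
move=> a0 va; rewrite /vnorm [leLHS]mx_normrE; apply/bigmax_leP; split=> // -[i j] _ /=.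
by rewrite ord1.
Qed.

Lemma coord_le_vnorm v i : `|v2r v 0 i : R| <= vnorm v.
Proof.
rewrite /vnorm [leRHS]mx_normrE.
exact: (le_bigmax _ (fun ij => `|v2r v ij.1 ij.2|) (0, i)).
Qed.

Lemma hom_bounded : exists2 K : R, 0 < K & forall f v, `|f v : R| <= K * vnorm f * vnorm v.
Proof.
pose e (i : 'I_(dim V)) : V := r2v (delta_mx 0 i).
have /choice[K KP] : forall i : 'I_(dim V), exists K : R, 0 < K /\
    forall f, `|f (e i) : R| <= K * vnorm f.
  by move=> i; have [K K0 KP] := linfunction_bounded (eval_linfunction (e i)); exists K.
exists (1 + \sum_i K i).
  by rewrite ltr_pwDl// sumr_ge0// => i _; exact: ltW (KP i).1.
move=> f v; have vE : v = \sum_i (v2r v 0 i : R) *: e i.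
  rewrite -{1}[v]v2rK [v2r v in LHS]row_sum_delta linear_sum; apply: eq_bigr => i _.
  by rewrite linearZ.
rewrite [X in f X]vE (linfunction_sum (hom_linfunction f)).
apply: le_trans (ler_norm_sum _ _ _) _.
apply: (@le_trans _ _ (\sum_i K i * vnorm f * vnorm v)).
  apply: ler_sum => i _; rewrite (linfunctionZ (hom_linfunction f)) normrM mulrC.
  by apply: ler_pM => //; [exact: (KP i).2|exact: coord_le_vnorm].
rewrite -!mulr_suml ler_wpM2r ?vnorm_ge0// ler_wpM2r ?vnorm_ge0//.
by rewrite lerDr.
Qed.

(** [vnorm] is a maximum norm. Nearest points and the choice of an extreme minimizer call for a
    strictly convex function, provided by the Euclidean form [sqn]. *)
Let ip u v : R := \sum_i v2r u 0 i * v2r v 0 i.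

Let ip_linfunction u : linfunction (ip u).
Proof.
split=> [v w|a v]; rewrite /ip.
  by rewrite -big_split; apply: eq_bigr => i _; rewrite v2r_coordD mulrDr.
by rewrite mulr_sumr; apply: eq_bigr => i _; rewrite v2r_coordZ; ring.
Qed.

Let ipC u v : ip u v = ip v u.
Proof. by apply: eq_bigr => i _; rewrite mulrC. Qed.

Definition sqn v : R := ip v v.

Lemma sqn_ge0 v : 0 <= sqn v.
Proof. by apply: sumr_ge0 => i _; rewrite -expr2 sqr_ge0. Qed.

Lemma sqn_eq0 v : sqn v = 0 -> v = 0.
Proof.
move=> s0; apply: eq_v2r_coord => i; rewrite v2r_coord0; apply/eqP.
rewrite -sqrf_eq0 expr2 eq_le -expr2 sqr_ge0 andbT expr2 -s0 /sqn /ip (bigD1 i)//= lerDl.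
by apply: sumr_ge0 => j _; rewrite -expr2 sqr_ge0.
Qed.

Let sqnD u v : sqn (u + v) = sqn u + 2 * ip u v + sqn v.
Proof.
rewrite /sqn (linfunctionD (ip_linfunction _)) ![ip (u + v) _]ipC.
rewrite !(linfunctionD (ip_linfunction _)) (ipC v u); ring.
Qed.

Let sqnZ a u : sqn (a *: u) = a * a * sqn u.
Proof.
by rewrite /sqn (linfunctionZ (ip_linfunction _)) ipC (linfunctionZ (ip_linfunction _)); ring.
Qed.

Lemma sqn_strictly_convex u v t : 0 < t < 1 -> u <> v ->
  sqn (t *: u + (1 - t) *: v) < t * sqn u + (1 - t) * sqn v.
Proof.
move=> /andP[t0 t1] uv.
have d0 : 0 < sqn (u - v).
  rewrite lt_neqAle sqn_ge0 andbT eq_sym; apply/negP => /eqP /sqn_eq0 /eqP.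
  by rewrite subr_eq0 => /eqP.
rewrite -subr_gt0.
have -> : t * sqn u + (1 - t) * sqn v - sqn (t *: u + (1 - t) *: v) =
   t * (1 - t) * sqn (u - v).
  rewrite -[- v]scaleN1r !sqnD !sqnZ !(linfunctionZ (ip_linfunction _)).
  by rewrite [ip (t *: _) _]ipC (linfunctionZ (ip_linfunction _)) [ip v u]ipC; ring.
by rewrite !mulr_gt0// subr_gt0.
Qed.

Let vnorm_le_sqn v : vnorm v <= 1 + sqn v.
Proof.
apply: vnorm_le_coord; first by rewrite addr_ge0 ?sqn_ge0.
move=> i; have : `|v2r v 0 i| ^+ 2 <= sqn v.
  rewrite real_normK ?num_real// /sqn /ip (bigD1 i)//= -expr2 lerDl.
  by apply: sumr_ge0 => j _; rewrite -expr2 sqr_ge0.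
have := normr_ge0 (v2r v 0 i : R); move: `|_| (sqn v) => x s; nra.
Qed.

Let sqn_continuous x e : 0 < e ->
  exists2 r, 0 < r & forall y, vnorm (y - x) < r -> `|sqn y - sqn x| < e.
Proof.
move=> e0; have [K K0 KP] := linfunction_bounded (ip_linfunction x).
pose n : R := (dim V)%:R; have n0 : 0 <= n by rewrite ler0n.
pose r := Order.min 1 (e / (2 * K + n + 1)).
have D0 : 0 < 2 * K + n + 1 by lra.
have r0 : 0 < r by rewrite lt_min ltr01 divr_gt0.
exists r => // y; rewrite lt_min => /andP[y1 ye].
have -> : sqn y - sqn x = 2 * ip x (y - x) + sqn (y - x).
  have := sqnD x (y - x); rewrite (addrC x) subrK => ->.
  by move: (ip x (y - x)) (sqn (y - x)) (sqn x) => s1 s2 s3; ring.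
have h1 := KP (y - x).
have h2 : sqn (y - x) <= n * vnorm (y - x).
  apply: (@le_trans _ _ (\sum_(i < dim V) vnorm (y - x))); last first.
    by rewrite sumr_const card_ord mulr_natl.
  apply: ler_sum => i _; apply: le_trans (ler_norm _) _; rewrite normrM.
  rewrite -[leRHS]mul1r; apply: ler_pM => //; last exact: coord_le_vnorm.
  by rewrite (le_trans (coord_le_vnorm _ _))// ltW.
have h3 := sqn_ge0 (y - x); have h4 := vnorm_ge0 (y - x).
have h5 : vnorm (y - x) * (2 * K + n + 1) < e by rewrite -ltr_pdivlMr.
move: h1; rewrite ler_norml => /andP[h1 h1'].
by rewrite ltr_norml; apply/andP; split; nra.
Qed.

(* Separation by the nearest point. *)
Lemma bipolar C v : open_cone C ->
  (forall f, dual_cone C f -> 0 <= (f v : R)) -> lin_closure C v.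
Proof.
move=> oC H; apply: contrapT => nv.
(* Only points at least as near to [v] as 0 compete; this makes the set of competitors compact. *)
pose A := lin_closure C `&` [set k | sqn (v - k) <= sqn v].
have [| | | |d [cld dv] dmin] := @compact_attains_min _ V A (vnorm v + 1 + sqn v) (fun k => sqn (v - k)).
- by exists 0; split; [exact: closure_cone0|rewrite /= subr0].
- move=> z /lin_closureP clz; split.
    apply: lin_closure_idem; apply/lin_closureP => r r0.
    by have [y [cly _] yr] := clz _ r0; exists y.
  rewrite /=; apply/ler_addgt0Pr => e e0.
  have [r r0 rP] := sqn_continuous (v - z) e0.
  have [y [_ /= yv] yz] := clz _ r0.
  have := rP (v - y); rewrite (_ : v - y - (v - z) = z - y); last by vec_ring.
  by rewrite vnormC => /(_ yz); rewrite ltr_norml => /andP[+ _]; lra.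
- move=> k [_ /= kv]; have := vnorm_triangle v k 0; rewrite !subr0 => h.
  have h'' := vnorm_le_sqn (v - k); rewrite vnormC in h''; lra.
- move=> x _ e e0; have [r r0 rP] := sqn_continuous (v - x) e0.
  exists r => // y yx; apply: rP; rewrite (_ : v - y - (v - x) = x - y); last by vec_ring.
  by rewrite vnormC.
have dmin' k : lin_closure C k -> sqn (v - d) <= sqn (v - k).
  move=> clk; have [le|lt] := leP (sqn (v - k)) (sqn v); first exact: dmin.
  by rewrite (le_trans dv)// ltW.
pose p := v - d.
have pN0 : p <> 0 by move=> /eqP; rewrite subr_eq0 => /eqP E; apply: nv; rewrite E.
have sp : 0 < sqn p.
  by rewrite lt_neqAle sqn_ge0 andbT eq_sym; apply/negP => /eqP /sqn_eq0.
clear pN0.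
(* First-order condition at a minimum: the linear term dominates the quadratic one for small [t]. *)
have small (a s : R) : 0 <= s -> (forall t, 0 < t <= 1 -> 0 <= t * a + t * t * s) -> 0 <= a.
  move=> s0 h; rewrite leNgt; apply/negP => a0.
  pose t := Order.min 1 (- a / (1 + s + s)).
  have t0 : 0 < t by rewrite lt_min ltr01 divr_gt0; lra.
  have := h t; rewrite t0 ge_min lexx => /(_ isT).
  have : t * (1 + s + s) <= - a by rewrite -ler_pdivlMr ?ge_min ?lexx ?orbT//; lra.
  nra.
have ipk k : lin_closure C k -> 0 <= - ip p k.
  move=> clk; suff : 0 <= - (2 * ip p k) by lra.
  apply: (small _ (sqn k)); first exact: sqn_ge0.
  move=> t /andP[t0 _].
  have := dmin' (d + t *: k) (closure_coneD oC cld (closure_coneZ oC (ltW t0) clk)).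
  have -> : v - (d + t *: k) = p + (- t) *: k by rewrite /p; vec_ring.
  by rewrite -/p (sqnD p) sqnZ (linfunctionZ (ip_linfunction _)); lra.
have ipd : 0 <= ip p d.
  suff : 0 <= 2 * ip p d by lra.
  apply: (small _ (sqn d)); first exact: sqn_ge0.
  move=> t /andP[t0 t1].
  have := dmin' ((1 - t) *: d) (closure_coneZ oC _ cld); rewrite subr_ge0 => /(_ t1).
  have -> : v - (1 - t) *: d = p + t *: d by rewrite /p; vec_ring.
  by rewrite -/p (sqnD p) sqnZ (linfunctionZ (ip_linfunction _)); lra.
(* This form is nonnegative on the closure of [C], but at [v = p + d] it is at most
   [- sqn p < 0]. *)
have [f fE] : exists f : 'Hom(V, R^o), forall v, (f v : R) = - ip p v.
  apply: linfunction_hom; split=> *.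
    by rewrite (linfunctionD (ip_linfunction _)) opprD.
  by rewrite (linfunctionZ (ip_linfunction _)) mulrN.
have := H f; rewrite fE => h.
have : 0 <= - ip p v by apply: h => x Cx; rewrite fE; apply: ipk; exact: sub_lin_closure.
have -> : v = p + d by rewrite subrK.
rewrite (linfunctionD (ip_linfunction _)) -/(sqn p); lra.
Qed.

End LinearForms.

Section DualCone.
Variables (R : realType) (V : vectType R) (C : set V).
Hypothesis hC : open_nondegenerate_convex_cone C.
Implicit Types (u v w x y : V) (f g : 'Hom(V, R^o)).

Let oC : open_cone C := open_nondegenerate_open_cone hC.

Lemma dual_cone_closure f v : dual_cone C f -> lin_closure C v -> 0 <= (f v : R).
Proof.
move=> fC /lin_closureP clv; rewrite -oppr_le0; apply/ler_addgt0Pr => e e0.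
have [K K0 KP] := linfunction_bounded (hom_linfunction f).
have [y Cy yv] := clv _ (divr_gt0 e0 K0).
have := fC _ Cy; rewrite -[y](subrK v) (linfunctionD (hom_linfunction f)).
have := KP (y - v); rewrite ler_norml => /andP[_ h1] h2.
rewrite ltr_pdivlMr// in yv; lra.
Qed.

Lemma dual_coneD f g : dual_cone C f -> dual_cone C g -> dual_cone C (f + g).
Proof.
by move=> fC gC x Cx; rewrite (linfunctionD (eval_linfunction x)) addr_ge0; [|exact: fC|exact: gC].
Qed.

Lemma dual_coneZ (a : R) f : 0 <= a -> dual_cone C f -> dual_cone C (a *: f).
Proof.
by move=> a0 fC x Cx; rewrite (linfunctionZ (eval_linfunction x)) mulr_ge0//; exact: fC.
Qed.

Lemma dual_cone_closed : lin_closure (dual_cone C) `<=` dual_cone C.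
Proof.
move=> f /lin_closureP clf x Cx; rewrite -oppr_le0; apply/ler_addgt0Pr => e e0.
have [K K0 KP] := linfunction_bounded (eval_linfunction x).
have [g gC gf] := clf _ (divr_gt0 e0 K0).
have := gC _ Cx; rewrite -[g](subrK f) (linfunctionD (eval_linfunction x)).
have := KP (g - f); rewrite ler_norml => /andP[_ h1] h2.
rewrite ltr_pdivlMr// in gf; lra.
Qed.

Lemma closure_pointed v : lin_closure C v -> lin_closure C (- v) -> v = 0.
Proof.
move=> clv clNv; apply: contrapT => /eqP v0.
have [_ nd _ [[x Cx] _]] := hC; apply: nd; exists x, v; split=> // t.
apply: open_cone_addcl => //; have [t0|t0] := leP 0 t.
  exact: closure_coneZ.
by rewrite -[t]opprK scaleNr -scalerN; apply: closure_coneZ => //; rewrite oppr_ge0 ltW.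
Qed.

(** Take finitely many forms with a common kernel of least dimension. If [v <> 0] lies in that
    kernel, then [v] or [- v] is outside the pointed closure of [C], and the bipolar theorem
    provides a form that shrinks the kernel. *)
Let separating : exists2 fs : seq 'Hom(V, R^o), forall f, f \in fs -> dual_cone C f &
  forall v, (forall f, f \in fs -> f v = 0) -> v = 0.
Proof.
pose ker (fs : seq 'Hom(V, R^o)) := (\bigcap_(f <- fs) lker f)%VS.
pose P d := `[< exists fs, (forall f, f \in fs -> dual_cone C f) /\ \dim (ker fs) = d >].
have exP : exists d, P d by exists (\dim (ker [::])); apply/asboolP; exists [::].
have [d /asboolP[fs [fsC fsd]] dmin] := ex_minnP exP.
have kerP fs' v : v \in ker fs' -> forall f, f \in fs' -> f v = 0.
  move=> + f ffs; rewrite /ker (big_rem f)//= memv_cap => /andP[+ _].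
  by rewrite memv_ker => /eqP.
have kerI fs' v : (forall f, f \in fs' -> f v = 0) -> v \in ker fs'.
  rewrite /ker; elim: fs' => [|f fs' IH] h; first by rewrite big_nil memvf.
  rewrite big_cons memv_cap memv_ker h ?inE ?eqxx//= IH// => g gf.
  by apply: h; rewrite inE gf orbT.
exists fs => // v /kerI vk; apply: contrapT => v0.
have [f fC fv] : exists2 f, dual_cone C f & f v != 0.
  apply: contrapT => H; apply: v0; apply: closure_pointed; apply: bipolar => // f fC.
    by rewrite leNgt; apply/negP => fv; apply: H; exists f => //; rewrite lt_eqF.
  rewrite (linfunctionN (hom_linfunction f)) oppr_ge0 leNgt; apply/negP => fv.
  by apply: H; exists f => //; rewrite gt_eqF.
have : (d <= \dim (ker (f :: fs)))%N.
  apply: dmin; apply/asboolP; exists (f :: fs); split=> // g.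
  by rewrite inE => /orP[/eqP ->|/fsC].
rewrite -fsd leqNgt => /negP; apply.
have sub : (ker (f :: fs) <= ker fs)%VS by rewrite /ker big_cons capvSr.
rewrite ltn_neqAle dimvS// andbT; apply/negP => /eqP dE.
have : v \in ker (f :: fs).
  suff /eqP -> : ker (f :: fs) == ker fs by [].
  by rewrite eqEdim sub dE/=.
by move=> /kerP/(_ f); rewrite inE eqxx => /(_ isT) E; rewrite E eqxx in fv.
Qed.

(** The sum of the separating forms bounds the norm on [C] up to a constant, so it stays nonnegative
    there after a small perturbation. *)
Lemma open_dual_nonempty : open_dual C !=set0.
Proof.
have [fs fsC sep] := separating.
pose phi v : 'rV[R]_(size fs) := \row_j (fs`_j v : R).
have lin : linear phi.
  move=> a u v; apply/rowP => j; rewrite !mxE.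
  by rewrite (linfunctionD (hom_linfunction _)) (linfunctionZ (hom_linfunction _)).
pose k : {linear V -> 'rV[R]_(size fs)} := HB.pack phi (GRing.isLinear.Build _ _ _ _ phi lin).
pose F := linfun k.
have kerF : lker F == 0%VS.
  apply/eqP/vspaceP => v; rewrite memv_ker memv0; apply/eqP/eqP => [|->]; last by rewrite linear0.
  rewrite lfunE /= => /rowP h; apply: sep => f ffs.
  have jf : (index f fs < size fs)%N by rewrite index_mem.
  by have := h (Ordinal jf); rewrite !mxE /= nth_index.
have [K K0 KP] := linear_vnorm_bounded (F^-1)%VF.
have nv v : vnorm v <= K * vnorm (F v).
  by rewrite -{1}[v](lker0_lfunK kerF); exact: KP.
(* On row vectors [vnorm] is again defined through [v2r], so it has to be compared with the matrix
   norm. *)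
have [K' K'0 KP'] : exists2 K' : R, 0 < K' & forall a : 'rV[R]_(size fs), vnorm a <= K' * `|a|.
  have [K1 K10 KP1] := @seminorm_bounded R 'rV[R]_(size fs) (fun a => vnorm a) (@vnormD _ _) (@vnormZ _ _).
  pose e j : 'rV[R]_(size fs) := delta_mx 0 j.
  exists (1 + \sum_j vnorm (e j)); first by rewrite ltr_pwDl// sumr_ge0// => j _; exact: vnorm_ge0.
  move=> a; rewrite {1}[a]row_sum_delta; apply: le_trans (vnorm_sum _ _ _) _.
  rewrite mulrDl mul1r mulr_suml -[leLHS]add0r lerD//.
  apply: ler_sum => j _; rewrite vnormZ mulrC ler_wpM2l ?vnorm_ge0//.
  rewrite [leRHS]mx_normrE.
  exact: (le_bigmax _ (fun ij => `|a ij.1 ij.2|) (0, j)).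
pose eta := \sum_(j < size fs) fs`_j.
have etaE v : (eta v : R) = \sum_(j < size fs) (fs`_j v : R).
  exact: (linfunction_sum (eval_linfunction v)).
have etaP v : C v -> vnorm v <= K * K' * (eta v : R).
  move=> Cv; apply: le_trans (nv v) _; rewrite -mulrA ler_wpM2l ?(ltW K0)//.
  apply: le_trans (KP' _) _; rewrite ler_wpM2l ?(ltW K'0)//.
  have fv j : (j < size fs)%N -> 0 <= (fs`_j v : R).
    by move=> jf; apply: (fsC _ (mem_nth _ jf)).
  rewrite lfunE /= [leLHS]mx_normrE; apply/bigmax_leP; split.
    by rewrite etaE sumr_ge0// => j _; exact: fv.
  move=> [i j] _ /=; rewrite mxE ger0_norm ?fv// etaE (bigD1 j)//= lerDl.
  by apply: sumr_ge0 => l _; exact: fv.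
have [M M0 MP] := @hom_bounded R V.
exists eta; apply/lin_interiorP; exists (K * K' * M)^-1.
  by rewrite invr_gt0 !mulr_gt0.
move=> f fe x Cx; have := MP (f - eta) x; have := etaP _ Cx.
rewrite (linfunctionB (eval_linfunction x)) ler_norml => h1 /andP[h2 _].
have KK : 0 < K * K' by rewrite mulr_gt0.
have : M * vnorm (f - eta) * vnorm x <= (eta x : R).
  apply: (@le_trans _ _ ((K * K')^-1 * vnorm x)); last by rewrite ler_pdivrMl.
  rewrite ler_wpM2r ?vnorm_ge0// mulrC -ler_pdivlMr// -invfM; exact: ltW.
lra.
Qed.

Lemma open_dual_sub : open_dual C `<=` dual_cone C.
Proof. exact: (@interior_subset (lin_top _)). Qed.

Lemma open_dual_add f g : open_dual C f -> dual_cone C g -> open_dual C (f + g).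
Proof.
move=> /lin_interiorP[r r0 rP] gC; apply/lin_interiorP; exists r => // k kr.
by rewrite -[k](subrK g); apply: dual_coneD => //; apply: rP; rewrite -addrA -opprD [g + f]addrC.
Qed.

Lemma open_dual_scale (a : R) f : 0 < a -> open_dual C f -> open_dual C (a *: f).
Proof.
move=> a0 /lin_interiorP[r r0 rP]; apply/lin_interiorP; exists (a * r); first exact: mulr_gt0.
move=> k kr; have -> : k = a *: (a^-1 *: k) by rewrite scalerA mulfV ?gt_eqF// scale1r.
apply: dual_coneZ; first exact: ltW.
apply: rP; have -> : a^-1 *: k - f = a^-1 *: (k - a *: f).
  by rewrite scalerBr scalerA mulVf ?gt_eqF// scale1r.
by rewrite vnormZ gtr0_norm ?invr_gt0// ltr_pdivrMl.
Qed.

Lemma open_dual_open_nondegenerate : open_nondegenerate_convex_cone (open_dual C).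
Proof.
split.
- by apply: (@open_interior (lin_top _)).
- move=> [f [g [/eqP g0 h]]]; apply: g0.
  have gC x : C x -> g x = 0.
    move=> Cx; apply: contrapT => /eqP gx.
    have := open_dual_sub (h (- (1 + (f x : R)) / (g x : R))) Cx.
    rewrite (linfunctionD (eval_linfunction x)) (linfunctionZ (eval_linfunction x)).
    by rewrite mulrAC -mulrA mulfV// mulr1; lra.
  apply/lfunP => v; rewrite lfunE /=.
  have [_ _ _ [x Cx]] := oC; have [r r0 rP] := open_cone_ball oC Cx.
  pose s := r / (1 + vnorm v).
  have s0 : 0 < s by rewrite divr_gt0// ltr_pwDl// vnorm_ge0.
  have : g (x + s *: v) = 0.
    apply: gC; apply: rP; rewrite addrC addKr vnormZ gtr0_norm//.
    rewrite mulrAC ltr_pdivrMr ?ltr_pwDl ?vnorm_ge0//.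
    by rewrite mulrDr mulr1 ltrDr.
  have gl := hom_linfunction g; rewrite -[g _]/(g _ : R) (linfunctionD gl) (linfunctionZ gl).
  rewrite -[g x]/(g x : R) (gC _ Cx : (g x : R) = 0) add0r => /eqP.
  by rewrite mulf_eq0 gt_eqF//= => /eqP.
- apply/convex_setP => f g t fC gC /andP[t0 t1]; apply: open_dual_add.
    exact: open_dual_scale.
  by apply: dual_coneZ; [lra|exact: open_dual_sub].
- by split; [exact: open_dual_nonempty|move=> r f; exact: open_dual_scale].
Qed.

Lemma closure_open_dual : lin_closure (open_dual C) = dual_cone C.
Proof.
apply/seteqP; split=> f.
  move=> /lin_closureP clf; apply: dual_cone_closed; apply/lin_closureP => r r0.
  by have [g /open_dual_sub gC gf] := clf _ r0; exists g.
move=> fC; have [eta etaC] := open_dual_nonempty.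
apply/lin_closureP => r r0; pose s := r / (1 + vnorm eta).
have s0 : 0 < s by rewrite divr_gt0// ltr_pwDl// vnorm_ge0.
exists (s *: eta + f); first by apply: open_dual_add => //; exact: open_dual_scale.
rewrite addrK vnormZ gtr0_norm// mulrAC ltr_pdivrMr ?ltr_pwDl ?vnorm_ge0//.
by rewrite mulrDr mulr1 ltrDr.
Qed.

(** As [f] is interior, adding plus or minus [c] times a coordinate form stays in the dual cone, and
    this bounds each coordinate of [v]. It follows that [f] has finite sublevel sets on lattice
    points. *)
Lemma open_dual_lower_bound f : open_dual C f ->
  exists2 c, 0 < c & forall v, lin_closure C v -> c * vnorm v <= (f v : R).
Proof.
move=> /lin_interiorP[r r0 rP].
have /choice[g gP] : forall i : 'I_(dim V), exists g : 'Hom(V, R^o), forall v, (g v : R) = v2r v 0 i.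
  by move=> i; apply: linfunction_hom; exact: linfunction_v2r.
pose c := r / (1 + \sum_i vnorm (g i)).
have G0 : 0 <= \sum_i vnorm (g i) by apply: sumr_ge0 => i _; exact: vnorm_ge0.
have c0 : 0 < c by rewrite divr_gt0// ltr_pwDl.
exists c => // v clv.
have near s i : `|s| <= c -> 0 <= (f v : R) + s * v2r v 0 i.
  move=> sc; have : dual_cone C (f + s *: g i).
    apply: rP; rewrite addrC addKr vnormZ; apply: (@le_lt_trans _ _ (c * vnorm (g i))).
      by rewrite ler_wpM2r// vnorm_ge0.
    rewrite mulrAC ltr_pdivrMr ?ltr_pwDl// ltr_pM2l//.
    rewrite (bigD1 i)//= addrCA ltrDl ltr_pwDl//.
    by apply: sumr_ge0 => j _; exact: vnorm_ge0.
  move=> /dual_cone_closure/(_ clv).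
  by rewrite (linfunctionD (eval_linfunction v)) (linfunctionZ (eval_linfunction v)) gP.
rewrite mulrC -ler_pdivlMr//; apply: vnorm_le_coord.
  rewrite divr_ge0 ?(ltW c0)//; apply: dual_cone_closure clv.
  by apply: rP; rewrite subrr vnorm0.
move=> i; rewrite ler_pdivlMr// -[X in _ * X](gtr0_norm c0) -normrM ler_norml.
have := near c i; have := near (- c) i; rewrite normrN gtr0_norm// lexx mulNr mulrC.
by move=> /(_ isT) h1 /(_ isT) h2; apply/andP; split; lra.
Qed.

(** The mirror image: [v] is moved inside [C] along the vectors of a basis, which bounds the values
    of [f] on that basis. *)
Lemma eval_lower_bound v : C v ->
  exists2 c, 0 < c & forall f, dual_cone C f -> c * vnorm f <= (f v : R).
Proof.
move=> Cv; have [r r0 rP] := open_cone_ball oC Cv.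
pose e := vbasis (@fullv _ V).
pose n := \dim (@fullv _ V).
have bb : basis_of fullv e := vbasisP _.
pose s := r / (1 + \sum_(i < n) vnorm e`_i).
have G0 : 0 <= \sum_(i < n) vnorm e`_i by apply: sumr_ge0 => i _; exact: vnorm_ge0.
have s0 : 0 < s by rewrite divr_gt0// ltr_pwDl.
have near f i : dual_cone C f -> (i < n)%N -> s * `|f e`_i : R| <= (f v : R).
  move=> fC ni; have Cs (t : R) : `|t| = s -> C (v + t *: e`_i).
    move=> ts; apply: rP; rewrite addrC addKr vnormZ ts.
    rewrite mulrAC ltr_pdivrMr ?ltr_pwDl// ltr_pM2l//.
    rewrite (bigD1 (Ordinal ni))//= addrCA ltrDl ltr_pwDl//.
    by apply: sumr_ge0 => j _; exact: vnorm_ge0.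
  have := fC _ (Cs s (gtr0_norm s0)).
  have := fC (v + (- s) *: e`_i); rewrite (linfunctionD (hom_linfunction f)).
  rewrite (linfunctionZ (hom_linfunction f)) mulNr => /(_ (Cs _ _))h1.
  rewrite (linfunctionD (hom_linfunction f)) (linfunctionZ (hom_linfunction f)) => h2.
  rewrite -[X in X * _](gtr0_norm s0) -normrM ler_norml.
  by have := h1 (etrans (normrN s) (gtr0_norm s0)) => h3; apply/andP; split; lra.
have /choice[cf cfP] : forall i : 'I_n, exists g : 'Hom(V, R^o), forall v, (g v : R) = coord e i v.
  move=> i; apply: (@linfunction_hom R V (coord e i)).
  by split=> *; rewrite ?linearD ?linearZ.
pose K := 1 + \sum_i vnorm (cf i).
have K0 : 0 < K by rewrite ltr_pwDl// sumr_ge0// => i _; exact: vnorm_ge0.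
exists (s / K); first exact: divr_gt0.
move=> f fC; have fE : f = \sum_(i < n) (f e`_i : R) *: cf i.
  apply/lfunP => x; rewrite {1}(coord_basis bb (memvf x)) linear_sum sum_lfunE.
  apply: eq_bigr => i _; rewrite linearZ scale_lfunE -[cf i x]/(cf i x : R) cfP.
  by rewrite /GRing.scale/= mulrC.
rewrite mulrAC ler_pdivrMr// {1}fE; apply: le_trans (ler_wpM2l (ltW s0) (vnorm_sum _ _ _)) _.
rewrite mulr_sumr; apply: (@le_trans _ _ (\sum_i (f v : R) * vnorm (cf i))).
  apply: ler_sum => i _; rewrite vnormZ mulrA ler_wpM2r ?vnorm_ge0//.
  exact: near.
by rewrite -mulr_sumr ler_wpM2l ?lerDr//; exact: fC.
Qed.

Lemma open_dual_bipolar v : (forall f, open_dual C f -> 0 <= (f v : R)) -> lin_closure C v.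
Proof.
move=> H; apply: bipolar => // f; rewrite -closure_open_dual => /lin_closureP clf.
have [K K0 KP] := linfunction_bounded (eval_linfunction v).
rewrite -oppr_le0; apply/ler_addgt0Pr => e e0; rewrite add0r.
have [g gC gf] := clf _ (divr_gt0 e0 K0); have := H _ gC.
rewrite -[g](subrK f) (linfunctionD (eval_linfunction v)).
have := KP (g - f); rewrite ler_norml => /andP[_ h1] h2.
rewrite ltr_pdivlMr// in gf; lra.
Qed.

End DualCone.

(** * Finite sets and minima over lattice points *)

Section FiniteSets.

Lemma finite_attains_min (R : realType) (T : choiceType) (A : set T) (h : T -> R) a :
  finite_set A -> A a -> exists2 m, A m & forall y, A y -> h m <= h y.
Proof.
move=> /finite_seqP[s ->] /=; elim: s a => // x s IH a _.
have [[y ys]|ys] := pselect (exists y, y \in s); last first.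
  exists x; first by rewrite /= inE eqxx.
  move=> z /=; rewrite inE => /orP[/eqP ->//|zs].
  by exfalso; apply: ys; exists z.
have [m ms mP] := IH y ys.
have [le|lt] := leP (h x) (h m).
  exists x; first by rewrite /= inE eqxx.
  by move=> z /=; rewrite inE => /orP[/eqP ->//|/mP]; exact: le_trans.
exists m; first by rewrite /= inE ms orbT.
by move=> z /=; rewrite inE => /orP[/eqP ->|/mP//]; exact: ltW.
Qed.

Lemma finite_set_seqs (T : choiceType) (A : set T) n : finite_set A ->
  finite_set [set s : seq T | size s = n /\ forall x, x \in s -> A x].
Proof.
move=> fA; elim: n => [|n IH].
  apply: (@sub_finite_set _ _ [set [::]]); last exact: finite_set1.
  by move=> s [/size0nil -> _].
apply: (@sub_finite_set _ _ ((fun p => p.1 :: p.2) @` (A `*`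
  [set s : seq T | size s = n /\ forall x, x \in s -> A x]))).
  move=> [|x s] [//= [sn] h]; exists (x, s) => //=; split=> /=.
    by apply: h; rewrite inE eqxx.
  by split=> // y ys; apply: h; rewrite inE ys orbT.
by apply: finite_image; exact: finite_setX.
Qed.

Lemma finite_pigeonhole (T : choiceType) (A : set T) (f : nat -> T) :
  finite_set A -> (forall n, A (f n)) ->
  exists a, forall N, exists2 n, (N <= n)%N & f n = a.
Proof.
move=> /finite_seqP[s ->] fs; apply: contrapT => H.
have /choice[g gP] : forall a, exists N, forall n, (N <= n)%N -> f n <> a.
  move=> a; apply: contrapT => h; apply: H; exists a => N; apply: contrapT => h'.
  by apply: h; exists N => n Nn fa; apply: h'; exists n.
pose N := \max_(a <- s) g a.
exact: (gP (f N) N (leq_bigmax_seq _ (fs N) isT) erefl).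
Qed.

End FiniteSets.

Section LatticeMinima.
Variables (R : realType) (V : vectType R).

Lemma lattice_attains_min (L A : set V) (h : V -> R) (c : R) :
  is_lattice L -> A `<=` L -> 0 < c -> (forall v, A v -> c * vnorm v <= h v) ->
  forall a, A a -> exists2 m, A m & forall v, A v -> h m <= h v.
Proof.
move=> lL AL c0 hc a Aa.
have fin : finite_set (A `&` [set v | h v <= h a]).
  apply: sub_finite_set (lattice_bounded_finite (h a / c) lL) => v [Av /= hv].
  split; first exact: AL.
  by rewrite /= ler_pdivlMr// mulrC (le_trans (hc _ Av)).
have [|m [Am ma] mP] := @finite_attains_min R _ _ h a fin; first by split=> /=.
exists m => // v Av; have [va|av] := leP (h v) (h a); first exact: mP.
by rewrite (le_trans ma)// ltW.
Qed.

Lemma open_cone_lattice_point VQ (L C : set V) : Q_structure VQ -> lattice_in VQ L ->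
  open_cone C -> exists2 x, C x & L x.
Proof.
move=> hQ lLQ oC; have [lL LQ] := lLQ; have [b [bb bL]] := lattice_spanned lL.
have [oC' CD CZ [x Cx]] := oC.
have [y [Cy Qy]] : exists y, (C `&` VQ) y.
  apply: contrapT => nQ.
  (* If [C] had no rational point, density would place [C] inside the empty convex set. *)
  apply: (open_sub_convex (H := set0) hQ.1 bb _ oC' _ _ Cx).
  - by move=> z /bL/LQ.
  - by apply/convex_setP => u v t [].
  - by move=> z CQz; exfalso; apply: nQ; exists z.
have [N N0 LN] := rational_span_multiple hQ lLQ Qy.
by exists (N%:R *: y) => //; apply: CZ => //; rewrite ltr0n.
Qed.

End LatticeMinima.

(** * Dual lattices and the dual rational structure *)

Section DualLattice.
Variables (R : realType) (V : vectType R).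
Implicit Types (f : 'Hom(V, R^o)) (L VQ : set V).

Definition dual_lattice L : set 'Hom(V, R^o) :=
  [set f | forall l, L l -> exists m : int, (f l : R) = m%:~R].

Lemma exists_dual_basis (b : seq V) : basis_of fullv b ->
  exists b' : seq 'Hom(V, R^o), [/\ basis_of fullv b', size b' = size b,
    forall i j, (i < size b)%N -> (j < size b)%N -> (b'`_i b`_j : R) = (i == j)%:R &
    forall f, f = \sum_(i < size b) (f b`_i : R) *: b'`_i].
Proof.
move=> bb; set n := size b.
have /choice[g gP] : forall i : 'I_n, exists g : 'Hom(V, R^o),
    forall v, (g v : R) = coord (in_tuple b) i v.
  by move=> i; apply: linfunction_hom; exact: linfunction_coord.
pose b' := [seq g i | i <- enum 'I_n].
have sb' : size b' = n by rewrite size_map size_enum_ord.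
have b'E (i : 'I_n) : b'`_i = g i.
  by rewrite (nth_map i) ?size_enum_ord// nth_ord_enum.
have dual i j : (i < n)%N -> (j < n)%N -> (b'`_i b`_j : R) = (i == j)%:R.
  move=> ni nj; rewrite (b'E (Ordinal ni)) gP.
  have := coord_free (Ordinal nj) (Ordinal ni) (basis_free bb : free (in_tuple b)).
  by rewrite /= => ->; rewrite eq_sym.
have expand f : f = \sum_(i < n) (f b`_i : R) *: b'`_i.
  apply/lfunP => x; rewrite {1}(basis_expansion x bb) linear_sum sum_lfunE.
  apply: eq_bigr => i _; rewrite linearZ scale_lfunE b'E -[g i x]/(g i x : R) gP.
  by rewrite /GRing.scale/= mulrC.
exists b'; split=> //; rewrite basisEfree.
have free' : free b'.
  apply/(@freeP _ _ _ (in_tuple b')) => k k0 i.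
  have ni : (i < n)%N by rewrite -sb'.
  have /(congr1 (fun f : 'Hom(V, R^o) => (f b`_i : R))) := k0.
  rewrite (linfunction_sum (eval_linfunction _)) (bigD1 i)//= big1 ?addr0.
    rewrite (linfunctionZ (eval_linfunction _)) dual// eqxx mulr1 => ->.
    by rewrite lfunE.
  move=> j ji; rewrite (linfunctionZ (eval_linfunction _)) dual -?sb'//.
  by rewrite (negbTE ji : (j == i :> nat) = false) mulr0.
have spanf : (fullv <= <<b'>>)%VS.
  apply/subvP => f _; rewrite (expand f); apply: rpred_sum => i _; rewrite rpredZ//.
  by apply: memv_span; rewrite mem_nth// sb'.
rewrite free' subvf/=.
exact: leq_trans (dimvS spanf) (dim_span _).
Qed.

Lemma dual_lattice_is_lattice L : is_lattice L -> is_lattice (dual_lattice L).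
Proof.
move=> [b [bb LE]]; have [b' [bb' sb' dual expand]] := exists_dual_basis bb.
exists b'; split=> //; apply/seteqP; split=> f.
  move=> fL; have bL j : (j < size b)%N -> L b`_j.
    move=> jb; rewrite LE; exists (fun i => (i == j)%:Z) => //.
    rewrite (bigD1 (Ordinal jb))//= eqxx scale1r big1 ?addr0// => i ij.
    rewrite (_ : (_ == _) = false) ?scale0r//.
    by apply/negbTE; apply: contra ij => /eqP ij; apply/eqP/val_inj.
  have /choice[m mP] : forall j, exists m : int, (j < size b)%N -> (f b`_j : R) = m%:~R.
    move=> j; have [jb|] := boolP (j < size b)%N; last by exists 0.
    by have [m mE] := fL _ (bL _ jb); exists m.
  exists m => //; rewrite sb' [RHS](expand f); apply: eq_bigr => i _.
  by rewrite (mP i).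
move=> [m _ <-] l; rewrite LE => -[k _ <-].
exists (\sum_(i < size b) k i * m i).
rewrite (linfunction_sum (hom_linfunction _)) rmorph_sum; apply: eq_bigr => i _.
rewrite (linfunctionZ (hom_linfunction _)) rmorphM; congr (_ * _).
rewrite (linfunction_sum (eval_linfunction _)) sb' (bigD1 i)//= big1 ?addr0.
  by rewrite (linfunctionZ (eval_linfunction _)) dual// eqxx mulr1.
move=> j ji; rewrite (linfunctionZ (eval_linfunction _)) dual//.
by rewrite (negbTE ji : (j == i :> nat) = false) mulr0.
Qed.

Lemma dual_Q_structure VQ : Q_structure VQ -> (exists L, lattice_in VQ L) ->
  Q_structure (dual_Q VQ) /\ forall L, lattice_in VQ L -> lattice_in (dual_Q VQ) (dual_lattice L).
Proof.
move=> hQ [L0 lL0].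
have dL L : lattice_in VQ L -> lattice_in (dual_Q VQ) (dual_lattice L).
  move=> lLQ; have [lL LQ] := lLQ.
  split; first exact: dual_lattice_is_lattice.
  move=> f fL u /(rational_span_multiple hQ lLQ)[N N0 /fL[m]].
  rewrite (linfunctionZ (hom_linfunction f)) => NE.
  exists (m%:~R / N%:R); rewrite fmorph_div /= ratr_int ratr_nat -NE mulrAC mulfV ?mul1r//.
  by rewrite pnatr_eq0 -lt0n.
split=> //; have [lL LQ] := lL0.
have [b [bb bL]] := lattice_spanned lL.
have [b' [bb' sb' dual expand]] := exists_dual_basis bb.
have sQ : Q_subspace (dual_Q VQ).
  split.
  - by move=> u _; exists 0; rewrite lfunE rmorph0.
  - move=> f g fQ gQ u Qu; have [p pE] := fQ u Qu; have [q qE] := gQ u Qu.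
    by exists (p + q); rewrite (linfunctionD (eval_linfunction u)) pE qE rmorphD.
  - move=> q f fQ u Qu; have [p pE] := fQ u Qu.
    by exists (q * p); rewrite (linfunctionZ (eval_linfunction u)) pE rmorphM.
have bQ x : x \in b -> VQ x by move=> /bL/LQ.
apply: (Q_structure_of_basis sQ bb').
  move=> f /(nthP 0)[i ib <-] u /(Q_structure_rational_span hQ bb bQ)[q _ ->].
  rewrite sb' in ib; exists (q i); rewrite (linfunction_sum (hom_linfunction _)).
  rewrite (bigD1 (Ordinal ib))//= big1 ?addr0.
    by rewrite (linfunctionZ (hom_linfunction _)) dual// eqxx mulr1.
  move=> j ji; rewrite (linfunctionZ (hom_linfunction _)) dual// (_ : (_ == _) = false) ?mulr0//.
  by apply/negbTE; apply: contra ji => /eqP ji; apply/eqP/val_inj.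
move=> f fQ; have /choice[q qP] : forall j, exists q : rat, (j < size b)%N -> (f b`_j : R) = ratr q.
  move=> j; have [jb|] := boolP (j < size b)%N; last by exists 0.
  by have [q qE] := fQ _ (bQ _ (mem_nth 0 jb)); exists q.
exists q => //; rewrite {1}(expand f) sb'; apply: eq_bigr => i _.
by rewrite -(qP i).
Qed.

End DualLattice.

(** * The Siegel property *)

Section GroupActions.
Variables (R : realType) (V : vectType R) (VQ C L : set V) (Gam : set 'End(V)).
Hypotheses (hVQ : Q_structure VQ) (hC : open_nondegenerate_convex_cone C)
  (hGam : GL_subgroup Gam) (hGamC : stabilizes Gam C)
  (hL : lattice_in VQ L) (hGamL : stabilizes Gam L).
Implicit Types (g : 'End(V)) (x y z v : V) (e s : seq V) (f : 'Hom(V, R^o)).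

Let oC : open_cone C := open_nondegenerate_open_cone hC.
Let sL : subgroup L := lattice_subgroup hL.1.

Lemma GL_subgroup_lker g : Gam g -> lker g == 0%VS.
Proof. by move=> Gg; have [_ _ /(_ _ Gg)[-> _]] := hGam. Qed.

Lemma GL_subgroupV g : Gam g -> Gam (g^-1)%VF.
Proof. by move=> Gg; have [_ _ /(_ _ Gg)[_]] := hGam. Qed.

Lemma GL_subgroupK g : Gam g -> cancel g (g^-1)%VF.
Proof. by move=> /GL_subgroup_lker/lker0_lfunK. Qed.

Lemma GL_subgroupVK g : Gam g -> cancel (g^-1)%VF g.
Proof. by move=> /GL_subgroup_lker/lker0_lfunVK. Qed.

Lemma stabilizes_mem (A : set V) g x : stabilizes Gam A -> Gam g -> A x -> A (g x).
Proof. by move=> sA Gg Ax; rewrite -(sA g Gg); exists x. Qed.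

Lemma lin_closure_image (A : set V) g x : stabilizes Gam A -> Gam g ->
  lin_closure A x -> lin_closure A (g x).
Proof.
move=> sA Gg /lin_closureP clx; apply/lin_closureP => r r0.
have [K K0 KP] := linear_vnorm_bounded g.
have [y Ay yx] := clx _ (divr_gt0 r0 K0).
exists (g y); first exact: stabilizes_mem.
rewrite -linearB; apply: le_lt_trans (KP _) _.
by rewrite mulrC -ltr_pdivlMr.
Qed.

(** Only a lattice is assumed invariant; [VQ] consists of rational multiples of its points. *)
Lemma stabilizes_Q g x : Gam g -> VQ x -> VQ (g x).
Proof.
move=> Gg Qx; have [N N0 LN] := rational_span_multiple hVQ hL Qx.
have [_ _ QZ] := hVQ.1.
have := QZ (N%:R)^-1 _ (hL.2 _ (stabilizes_mem hGamL Gg LN)).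
rewrite fmorphV /= ratr_nat linearZ scalerA mulVf ?scale1r//.
by rewrite pnatr_eq0 -lt0n.
Qed.

Lemma C_plus_image g x : Gam g -> C_plus VQ C x -> C_plus VQ C (g x).
Proof.
move=> Gg; move: x.
apply: (@convex_hull_min R V _ [set x | C_plus VQ C (g x)]).
  apply/convex_setP => x y t Cx Cy t01 /=; rewrite linearD !linearZ.
  by have /convex_setP := @convex_hull_convex _ _ (lin_closure C `&` VQ); apply.
move=> x [clx Qx]; apply: sub_convex_hull; split; first exact: lin_closure_image.
exact: stabilizes_Q.
Qed.

Lemma C_plus_closure : C_plus VQ C `<=` lin_closure C.
Proof.
apply: convex_hull_min => [|x []//].
apply/convex_setP => x y t Cx Cy /andP[t0 t1]; apply: closure_coneD => //.
  by apply: closure_coneZ => //; exact: ltW.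
by apply: closure_coneZ => //; lra.
Qed.

Lemma sub_C_plus : C `<=` C_plus VQ C.
Proof.
have [b [bb bL]] := lattice_spanned hL.1; have [oC' _ _ _] := oC.
apply: (open_sub_convex hVQ.1 bb _ oC').
- by move=> x /bL/hL.2.
- exact: convex_hull_convex.
- by move=> x [Cx Qx]; apply: sub_convex_hull; split=> //; exact: sub_lin_closure.
Qed.

Definition integral_generators e := forall x, x \in e -> lin_closure C x /\ L x.

Lemma C_plus_integral x : C_plus VQ C x ->
  exists2 e, integral_generators e & cone_over e x.
Proof.
move: x; apply: (@convex_hull_min R V _ [set x | exists2 e, integral_generators e & cone_over e x]).
  apply/convex_setP => x y t [e ee ex] [e' ee' ey] /andP[t0 t1].
  exists (e ++ e').
    by move=> z; rewrite mem_cat => /orP[/ee|/ee'].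
  apply: cone_overD; apply: cone_overZ; [lra| |lra|].
    by apply: cone_over_subset ex => z ze; rewrite mem_cat ze.
  by apply: cone_over_subset ey => z ze; rewrite mem_cat ze orbT.
move=> x [clx Qx]; have [N N0 LN] := rational_span_multiple hVQ hL Qx.
exists [:: N%:R *: x].
  move=> y; rewrite inE => /eqP ->; split=> //.
  by apply: closure_coneZ => //; exact: ler0n.
have : cone_over [:: N%:R *: x] (N%:R^-1 *: (N%:R *: x)).
  apply: cone_overZ; first by rewrite invr_ge0 ler0n.
  by apply: cone_over_mem; rewrite inE.
by rewrite scalerA mulVf ?scale1r// pnatr_eq0 -lt0n.
Qed.

Lemma polyhedral_integral P : polyhedral_cone P -> P `<=` C_plus VQ C ->
  exists2 e, integral_generators e & P `<=` cone_over e.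
Proof.
move=> /polyhedral_coneP[s ->] sC.
have /choice[f fP] : forall x, exists e, x \in s -> integral_generators e /\ cone_over e x.
  move=> x; have [xs|] := boolP (x \in s); last by exists [::].
  by have [e ee ex] := C_plus_integral (sC _ (cone_over_mem xs)); exists e.
exists (flatten [seq f x | x <- s]).
  by move=> y /flatten_mapP[x /fP[fx _]]; exact: fx.
apply: cone_over_sub => x xs; have [_ fx] := fP _ xs.
by apply: cone_over_subset fx => y yx; apply/flatten_mapP; exists x.
Qed.

Lemma open_dual_comp g f : Gam g -> open_dual C f -> open_dual C (f \o g)%VF.
Proof.
move=> Gg /lin_interiorP[r r0 rP]; have [K K0 KP] := linear_vnorm_bounded (contragredient_map g).
apply/lin_interiorP; exists (r / K); first exact: divr_gt0.
move=> k kf x Cx; have : dual_cone C (contragredient_map g k).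
  apply: rP; have {1}-> : f = contragredient_map g (f \o g)%VF.
    by rewrite contragredient_mapE -comp_lfunA lker0_compfV ?comp_lfun1r// GL_subgroup_lker.
  rewrite -linearB; apply: le_lt_trans (KP _) _.
  by rewrite mulrC -ltr_pdivlMr.
move=> /(_ _ (stabilizes_mem hGamC Gg Cx)).
by rewrite contragredient_mapE comp_lfunE GL_subgroupK.
Qed.

Lemma dual_lattice_comp g f : Gam g -> dual_lattice L f -> dual_lattice L (f \o g)%VF.
Proof.
move=> Gg fL l Ll; rewrite comp_lfunE; apply: fL; exact: stabilizes_mem.
Qed.

Let A : set 'Hom(V, R^o) := open_dual C `&` dual_lattice L.

Let minimizes x f := A f /\ forall f', A f' -> (f x : R) <= (f' x : R).

Let minimizes_exists x : C x -> exists f, minimizes x f.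
Proof.
move=> Cx; have [c c0 cP] := eval_lower_bound hC Cx.
have hdQ := dual_Q_structure hVQ (ex_intro _ L hL).
have oC' := open_nondegenerate_open_cone (open_dual_open_nondegenerate hC).
have [f fC fL] := open_cone_lattice_point hdQ.1 (hdQ.2 _ hL) oC'.
have [|||m Am mP] := @lattice_attains_min _ _ (dual_lattice L) A
  (fun f => f x : R) c (dual_lattice_is_lattice hL.1) _ c0 _ f.
- by move=> k [].
- by move=> k [/open_dual_sub kC _]; exact: cP.
- by [].
by exists m.
Qed.

(* Only the generators entering [x] with a positive coefficient matter, and
   their sum lies in C; Dickson's lemma bounds the minimizers on that sum. *)
Let minimizes_finite e : integral_generators e ->
  finite_set [set f | exists x, [/\ C x, cone_over e x & minimizes x f]].
Proof.
move=> ee; set k := size e.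
(* Truncation loses nothing: forms of [A] take natural values on integral generators. *)
pose phi (I : {set 'I_k}) (f : 'Hom(V, R^o)) i : nat :=
  if insub i is Some j then (if j \in I then Num.truncn (f e`_i : R) else 0%N) else 0%N.
pose eI (I : {set 'I_k}) := \sum_(i in I) e`_i.
have /choice[F FP] : forall I : {set 'I_k}, exists F : seq 'Hom(V, R^o),
    (forall f, f \in F -> A f) /\ forall f, A f ->
    exists2 f', f' \in F & forall i, (i < k)%N -> (phi I f' i <= phi I f i)%N.
  by move=> I; have [F FA FP] := dickson k (phi I) A; exists F.
(* All these values are nonnegative, so the sum bounds each of them. *)
pose B I : R := \sum_(f <- F I) (f (eI I) : R).
pose S (I : {set 'I_k}) := [set f | [/\ C (eI I), A f & (f (eI I) : R) <= B I]].
apply: (@sub_finite_set _ _ (\bigcup_(I in [set: {set 'I_k}]) S I)); last first.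
  apply: bigcup_finite => [|I _]; first exact: finite_finset.
  have [CI|nCI] := pselect (C (eI I)); last first.
    by apply: (@sub_finite_set _ _ set0) => // f [].
  have [c c0 cP] := eval_lower_bound hC CI.
  apply: sub_finite_set (lattice_bounded_finite (B I / c) (dual_lattice_is_lattice hL.1)).
  move=> f [_ [fC fL] fB]; split=> //=.
  by rewrite ler_pdivlMr// mulrC (le_trans (cP _ (open_dual_sub fC))).
have fe f i : A f -> (i < k)%N -> exists n : nat, (f e`_i : R) = n%:R.
  move=> [/open_dual_sub fC fL] ik; have [cli Li] := ee _ (mem_nth 0 ik).
  have := dual_cone_closure fC cli; have [m ->] := fL _ Li.
  by case: m => n; rewrite ?ler0z//; exists n.
move=> f [x [Cx [a a0 xE] [Af fmin]]].
pose I : {set 'I_k} := finset (fun i : 'I_k => 0 < a i); exists I => //.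
have [f' f'F ff'] := (FP I).2 _ Af.
have Af' := (FP I).1 _ f'F.
have le_on i : i \in I -> (f' e`_i : R) <= (f e`_i : R).
  move=> iI; have := ff' _ (ltn_ord i); rewrite /phi insubT//= => ik.
  have -> : Sub (nat_of_ord i) ik = i by exact/val_inj.
  rewrite iI; have [n nE] := fe _ i Af (ltn_ord i); have [n' n'E] := fe _ i Af' (ltn_ord i).
  by rewrite nE n'E !natrK ler_nat.
have sum_f (h : 'Hom(V, R^o)) : (h x : R) = \sum_(i in I) a i * (h e`_i : R).
  rewrite xE (linfunction_sum (hom_linfunction h)).
  rewrite (bigID (mem I))/= [X in _ + X]big1 ?addr0.
    by apply: eq_bigr => i _; rewrite (linfunctionZ (hom_linfunction h)).
  move=> i; rewrite inE -leNgt => ai; have -> : a i = 0 by apply/eqP; rewrite eq_le ai a0.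
  by rewrite scale0r linear0.
(* A strict decrease at one generator of [I] would make [f'] smaller than [f] at [x], against the
   minimality of [f]. *)
have eq_on i : i \in I -> (f e`_i : R) = (f' e`_i : R).
  move=> iI; apply/eqP; rewrite eq_le le_on// andbT leNgt; apply/negP => lt.
  have := fmin _ Af'; rewrite !sum_f leNgt => /negP; apply.
  rewrite (bigD1 i)//= [ltRHS](bigD1 i)//= ltr_leD//.
    by rewrite ltr_pM2l//; move: iI; rewrite inE.
  by apply: ler_sum => j /andP[jI _]; rewrite ler_wpM2l//; exact: le_on.
split=> //.
  (* With this [t] every [t * a i] is at most 1, so [eI I] is [t *: x] plus a nonnegative
     combination and lies in [C]. *)
  pose t := (1 + \sum_(i < k) a i)^-1.
  have s0 : 0 <= \sum_(i < k) a i by apply: sumr_ge0 => i _; exact: a0.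
  have t0 : 0 < t by rewrite invr_gt0 ltr_pwDl.
  have -> : eI I = t *: x + \sum_(i in I) (1 - t * a i) *: e`_i.
    rewrite xE (bigID (mem I))/= [X in _ *: (_ + X)]big1.
      rewrite addr0 scaler_sumr -big_split; apply: eq_bigr => i _ /=.
      by rewrite scalerA -scalerDl addrC subrK scale1r.
    move=> i; rewrite inE -leNgt => ai; have -> : a i = 0 by apply/eqP; rewrite eq_le ai a0.
    by rewrite scale0r.
  have [_ CD CZ _] := oC.
  apply: open_cone_addcl => //; first exact: CZ.
  apply: big_ind => [|u v|i iI]; [exact: closure_cone0|exact: closure_coneD|].
  apply: closure_coneZ => //; last by have [] := ee _ (mem_nth 0 (ltn_ord i)).
  rewrite subr_ge0 mulrC ler_pdivrMr ?ltr_pwDl// mul1r.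
  rewrite (bigD1 i)//= addrCA lerDl addr_ge0//.
  by apply: sumr_ge0 => j _; exact: a0.
have -> : (f (eI I) : R) = (f' (eI I) : R).
  by rewrite !(linfunction_sum (hom_linfunction _)); apply: eq_bigr => i; exact: eq_on.
have pos (h : 'Hom(V, R^o)) : A h -> 0 <= (h (eI I) : R).
  move=> Ah; rewrite (linfunction_sum (hom_linfunction _)); apply: sumr_ge0 => i _.
  by have [n ->] := fe _ i Ah (ltn_ord i).
rewrite /B (perm_big _ (perm_to_rem f'F)) big_cons lerDl big_seq; apply: sumr_ge0 => h.
by move=> /mem_rem hF; apply: pos; exact: (FP I).1.
Qed.

(** Basis vectors are pushed into [C] by a large multiple of an interior lattice point. The group
    maps these test vectors to lattice points of [C], and an endomorphism is determined by its
    values on them. *)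
Lemma lattice_spanned_in_cone : exists2 vs : seq V,
  forall v, v \in vs -> C v /\ L v &
  forall g g' : 'End(V), {in vs, g =1 g'} -> g = g'.
Proof.
have [x Cx Lx] := open_cone_lattice_point hVQ hL oC.
have [b [bb bL]] := lattice_spanned hL.1; have [_ CD CZ _] := oC.
have [r r0 rP] := open_cone_ball oC Cx.
pose N := (Num.truncn (\sum_(i < size b) vnorm b`_i / r)).+1.
have N0 : 0 < N%:R :> R by rewrite ltr0n.
have CN i : (i < size b)%N -> C (N%:R *: x + b`_i).
  move=> ib; have -> : N%:R *: x + b`_i = N%:R *: (x + N%:R^-1 *: b`_i).
    by rewrite scalerDr scalerA mulfV ?gt_eqF// scale1r.
  apply: CZ => //; apply: rP; rewrite addrC addKr vnormZ gtr0_norm ?invr_gt0//.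
  rewrite ltr_pdivrMl// -ltr_pdivrMr//.
  apply: le_lt_trans (truncnS_gt _); rewrite (bigD1 (Ordinal ib))//= lerDl.
  by apply: sumr_ge0 => j _; rewrite divr_ge0 ?vnorm_ge0// ltW.
exists (x :: [seq N%:R *: x + y | y <- b]).
  move=> v; rewrite inE => /orP[/eqP -> //|/mapP[y yb ->]].
  split; last by apply: subgroupD => //; [exact: subgroupMn|exact: bL].
  by have := CN (index y b); rewrite index_mem nth_index//; exact.
move=> g g' gg'; apply/lfunP => v; rewrite (basis_expansion v bb) !linear_sum.
apply: eq_bigr => i _; rewrite !linearZ; congr (_ *: _).
have gx : g x = g' x by apply: gg'; rewrite inE eqxx.
have := gg' (N%:R *: x + b`_i); rewrite inE map_f ?mem_nth// orbT => /(_ isT).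
by rewrite !linearD !linearZ /= gx => /addrI.
Qed.

(** On a test vector [v] the value [f (g v) = f' v] is prescribed; as [f] bounds the norm on the
    closure of [C], only finitely many lattice points can be [g v]. *)
Let transporter_finite f f' : A f -> A f' ->
  finite_set [set g | Gam g /\ (f \o g)%VF = f'].
Proof.
move=> [fC fL] [f'C f'L]; have [vs vsP vsI] := lattice_spanned_in_cone.
have [c c0 cP] := open_dual_lower_bound fC.
pose M : R := \sum_(v <- vs) (f' v : R).
pose T := [set v | L v /\ vnorm v <= M / c].
have fT : finite_set T by exact: (lattice_bounded_finite _ hL.1).
have fTs := finite_set_seqs (size vs) fT.
(* A left inverse, on endomorphisms, of evaluation at the test vectors; 0 is the value for lists
   that do not arise. *)
pose G (s : seq V) : 'End(V) := xget 0 [set g : 'End(V) | [seq g v | v <- vs] = s].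
apply: sub_finite_set (finite_image G fTs) => g [Gg gE].
exists [seq g v | v <- vs].
  split; first by rewrite size_map.
  move=> _ /mapP[v vvs ->]; have [Cv Lv] := vsP _ vvs.
  split; first exact: stabilizes_mem.
  rewrite ler_pdivlMr// mulrC.
  have clg : lin_closure C (g v) by apply: sub_lin_closure; exact: stabilizes_mem.
  apply: le_trans (cP _ clg) _; rewrite -[f (g v)]comp_lfunE gE.
  rewrite /M (perm_big _ (perm_to_rem vvs)) big_cons lerDl big_seq sumr_ge0// => w.
  by move=> /mem_rem/vsP[Cw _]; exact: (open_dual_sub f'C).
rewrite /G; apply: vsI => v vvs.
have := @xgetPex _ (0 : 'End(V)) [set h : 'End(V) | [seq h v | v <- vs] = [seq g v | v <- vs]].
by move=> /(_ (ex_intro _ g erefl)) /eq_in_map; exact.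
Qed.

(** If [f] is minimal at [g x], then [f \o g] is minimal at [x]. Both range over finite sets, and
    each pair of forms allows finitely many [g]. *)
Lemma siegel e1 e2 : integral_generators e1 -> integral_generators e2 ->
  finite_set [set g | Gam g /\ exists x, [/\ C x, cone_over e1 x & cone_over e2 (g x)]].
Proof.
move=> ee1 ee2.
pose F e := [set f | exists x, [/\ C x, cone_over e x & minimizes x f]].
have FA e f : F e f -> A f by move=> [x [_ _ []]].
apply: (@sub_finite_set _ _ (\bigcup_(f in F e2) \bigcup_(f' in F e1)
    [set g | Gam g /\ (f \o g)%VF = f'])); last first.
  apply: bigcup_finite => [|f Ff]; first exact: minimizes_finite.
  apply: bigcup_finite => [|f' Ff']; first exact: minimizes_finite.
  exact: transporter_finite (FA _ _ Ff) (FA _ _ Ff').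
move=> g [Gg [x [Cx ex egx]]].
have Cgx : C (g x) by exact: stabilizes_mem.
have [f fmin] := minimizes_exists Cgx.
exists f; first by exists (g x).
have [[fC fL] fP] := fmin.
exists (f \o g)%VF => //; exists x; split=> //; split.
  by split; [exact: open_dual_comp|exact: dual_lattice_comp].
move=> f' [f'C f'L]; rewrite comp_lfunE.
have Gg' := GL_subgroupV Gg.
have := fP (f' \o g^-1)%VF; rewrite comp_lfunE GL_subgroupK//; apply.
by split; [exact: open_dual_comp|exact: dual_lattice_comp].
Qed.

Lemma translates_eq_C_plus P : polyhedral_cone P -> P `<=` C_plus VQ C ->
  C `<=` translates Gam P -> translates Gam P = C_plus VQ C.
Proof.
move=> pP PC CP; apply/seteqP; split.
  by move=> _ [g Gg [x Px <-]]; apply: C_plus_image => //; exact: PC.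
move=> z Cz; have [e1 ee1 Pe1] := polyhedral_integral pP PC.
have [e ee ez] := C_plus_integral Cz.
have [c Cc Lc] := open_cone_lattice_point hVQ hL oC.
(* One integral cone containing the whole segment from [z] towards [c]: by [siegel] only finitely
   many group elements are needed to cover it by translates of [P], and one of them recurs
   arbitrarily close to [z]. *)
pose e2 := c :: e.
have ee2 : integral_generators e2.
  by move=> x; rewrite inE => /orP[/eqP ->|/ee//]; split=> //; exact: sub_lin_closure.
have [_ CD CZ _] := oC.
have Cn n : C (z + n.+1%:R^-1 *: c).
  rewrite addrC; apply: open_cone_addcl => //; last exact: C_plus_closure.
  by apply: CZ => //; rewrite invr_gt0 ltr0n.
have /choice[g gP] : forall n, exists g, Gam g /\ P ((g^-1)%VF (z + n.+1%:R^-1 *: c)).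
  by move=> n; have [g Gg [x Px E]] := CP _ (Cn n); exists g; rewrite -E GL_subgroupK.
have [|h hP] := finite_pigeonhole (siegel ee1 ee2) (f := g).
  move=> n; have [Gg Pg] := gP n; split=> //.
  exists ((g n)^-1%VF (z + n.+1%:R^-1 *: c)); split.
  - by apply: stabilizes_mem => //; exact: GL_subgroupV.
  - exact: Pe1.
  - rewrite GL_subgroupVK//; apply: cone_overD.
      by apply: cone_over_subset ez => y ye; rewrite inE ye orbT.
    apply: cone_overZ; first by rewrite invr_ge0 ler0n.
    by apply: cone_over_mem; rewrite inE eqxx.
have Gh : Gam h by have [n _ <-] := hP 0%N; have [] := gP n.
exists h => //; exists ((h^-1)%VF z); last exact: GL_subgroupVK.
move: pP => /polyhedral_coneP[s PE]; rewrite PE.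
apply: (@cone_over_limit _ _ _ _ ((h^-1)%VF c)) => eps eps0.
have [n nN nh] := hP (Num.truncn eps^-1).
exists n.+1%:R^-1.
  rewrite invr_gt0 ltr0n/= -[ltRHS]invrK ltf_pV2 ?posrE ?invr_gt0 ?ltr0n//.
  by rewrite (lt_le_trans (truncnS_gt _))// ler_nat.
have [_] := gP n; rewrite nh PE linearD linearZ.
exact.
Qed.

Lemma cond_i_ii : cond_i (C_plus VQ C) Gam -> cond_ii C (C_plus VQ C) Gam.
Proof.
by move=> [P [pP PC PE]]; exists P; split=> //; rewrite PE; exact: sub_C_plus.
Qed.

Lemma cond_ii_i : cond_ii C (C_plus VQ C) Gam -> cond_i (C_plus VQ C) Gam.
Proof.
by move=> [P [pP PC PE]]; exists P; split=> //; exact: translates_eq_C_plus.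
Qed.

Lemma orbit_of_image g x : Gam g -> orbit_of Gam (g x) = orbit_of Gam x.
Proof.
have [_ GM _] := hGam.
move=> Gg; apply/seteqP; split=> _ [h Gh <-].
  by exists (h \o g)%VF; [exact: GM|rewrite comp_lfunE].
exists (h \o g^-1)%VF; first by apply: GM => //; exact: GL_subgroupV.
by rewrite comp_lfunE GL_subgroupK.
Qed.

Lemma extreme_points_image K g x : (forall h y, Gam h -> K y -> K (h y)) -> Gam g ->
  extreme_points K x -> extreme_points K (g x).
Proof.
move=> sK Gg [Kx ex]; split; first exact: sK.
move=> y z t Ky Kz t01 gxE; have Gg' := GL_subgroupV Gg.
apply: (can_inj (GL_subgroupVK Gg)); apply: (ex _ _ t); [exact: sK|exact: sK|by []|].
by rewrite -(GL_subgroupK Gg x) gxE linearD !linearZ.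
Qed.

Lemma hull_image (L1 : set V) g x : stabilizes Gam L1 -> Gam g ->
  convex_hull (C `&` L1) x -> convex_hull (C `&` L1) (g x).
Proof.
move=> sL1 Gg; move: x.
apply: (@convex_hull_min R V _ [set x | convex_hull (C `&` L1) (g x)]).
  apply/convex_setP => x y t Cx Cy t01 /=; rewrite linearD !linearZ.
  by have /convex_setP := @convex_hull_convex _ _ (C `&` L1); apply.
by move=> x [Cx Lx]; apply: sub_convex_hull; split; exact: stabilizes_mem.
Qed.

(* A coefficient larger than 1 at a generator [y] would make [x] the midpoint
   of [x - y] and [x + y]. *)
Lemma extreme_in_cone_finite e : integral_generators e -> 0 \notin e ->
  finite_set [set x | extreme_points (convex_hull (C `&` L)) x /\ cone_over e x].
Proof.
move=> ee e0; pose M := \sum_(y <- e) vnorm y.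
apply: sub_finite_set (lattice_bounded_finite M hL.1).
move=> x [ext [a a0 xE]]; have [Cx Lx] := extreme_points_hull ext.
split=> //=; rewrite xE; apply: le_trans (vnorm_sum _ _ _) _.
rewrite /M (big_nth 0) big_mkord; apply: ler_sum => i _; rewrite vnormZ ger0_norm//.
rewrite ler_piMl ?vnorm_ge0// leNgt; apply/negP => ai.
have [cly Ly] := ee _ (mem_nth 0 (ltn_ord i)).
set y := e`_i in cly Ly; have [_ CD CZ _] := oC.
have Cm : C (x - y).
  (* Since [t * a i = 1], removing [y] from [x] amounts to shrinking [x] by [1 - t] and adding back
     a fraction of the other terms. *)
  pose t := (a i)^-1; have t0 : 0 < t by rewrite invr_gt0; lra.
  have -> : x - y = (1 - t) *: x + t *: \sum_(j < size e | j != i) a j *: e`_j.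
    rewrite xE (bigD1 i)//= -/y; move: (\sum_(j < _ | _) _) => S.
    have ta : t * a i = 1 by rewrite mulVf// gt_eqF//; lra.
    apply: eq_v2r_coord => k; rewrite ?(v2r_coordD, v2r_coordN, v2r_coordZ).
    transitivity (a i * v2r y 0 k - (t * a i) * v2r y 0 k + v2r S 0 k); last by ring.
    by rewrite ta; ring.
  apply: open_cone_addcl => //.
    by apply: CZ => //; rewrite subr_gt0 invf_lt1//; lra.
  apply: closure_coneZ => //; first exact: ltW.
  apply: big_ind => [|u v|j _]; [exact: closure_cone0|exact: closure_coneD|].
  by apply: closure_coneZ => //; have [] := ee _ (mem_nth 0 (ltn_ord j)).
have Cp : C (x + y) by apply: open_cone_addcl.
have [_ /(_ (x - y) (x + y) 2^-1)] := ext.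
have h2 : 0 < (2 : R)^-1 < 1 by rewrite invr_gt0 ltr0n/= invf_lt1 ?ltr1n.
move=> /(_ _ _ h2) H; have : x - y = x + y.
  apply: H; [apply: sub_convex_hull; split=> //; exact: sL.2|
    apply: sub_convex_hull; split=> //; exact: subgroupD|].
  apply: eq_v2r_coord => k; rewrite ?(v2r_coordD, v2r_coordN, v2r_coordZ).
  by field.
move=> /addrI/eqP; rewrite eq_sym -subr_eq0 opprK -mulr2n -scaler_nat scaler_eq0.
rewrite pnatr_eq0/= => /eqP y0; move: e0; rewrite -y0 mem_nth//.
Qed.

Lemma polyhedral_finitely_many_orbits : cond_ii C (C_plus VQ C) Gam ->
  finitely_many_orbits Gam (extreme_points (convex_hull (C `&` L))).
Proof.
move=> [P [pP PC CP]]; have [e0 ee0 Pe0] := polyhedral_integral pP PC.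
(* A zero generator could have an arbitrarily large coefficient, so the argument on coefficients
   needs it removed. *)
pose e := [seq y <- e0 | y != 0].
have ee : integral_generators e by move=> y; rewrite mem_filter => /andP[_ /ee0].
have ne : 0 \notin e by rewrite mem_filter eqxx.
apply: sub_finite_set (finite_image (orbit_of Gam) (extreme_in_cone_finite ee ne)).
move=> _ [x ext <-]; have [Cx _] := extreme_points_hull ext.
have [g Gg [y Py gy]] := CP _ Cx; have Gg' := GL_subgroupV Gg.
exists y; last by rewrite -gy orbit_of_image.
split; last by apply: cone_over_filter0; exact: Pe0.
have -> : y = (g^-1)%VF x by rewrite -gy GL_subgroupK.
apply: extreme_points_image => // h z Gh; exact: hull_image.
Qed.

End GroupActions.

(** * From extreme points to a polyhedral cone in the dual *)

Section DualityOfTypes.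
Variables (R : realType) (V V' : vectType R) (p : V -> V' -> R).
Hypotheses (p_linl : forall xi, linfunction (p^~ xi)) (p_linr : forall v, linfunction (p v)).
Variables (L C : set V) (Gam : set 'End(V)).
Hypotheses (oC : open_cone C) (lL : is_lattice L).
Variables (VQ' C' D' : set V') (Gam' : set 'End(V')).
Implicit Types (v x y z : V) (xi : V').

Let sL : subgroup L := lattice_subgroup lL.

(* By [vertex_cone] and Dickson's lemma the cone spanned by [C `&` L - x] is
   finitely generated; [cone_over s] is its dual. *)
Lemma minimized_at_polyhedral s0 x : C x -> L x -> Q_subspace VQ' ->
  (forall xi, cone_over s0 xi) -> (forall xi, xi \in s0 -> VQ' xi) ->
  (forall v xi, L v -> VQ' xi -> exists q : rat, p v xi = ratr q) ->
  exists2 s, forall xi, xi \in s -> VQ' xi /\ (forall v, lin_closure C v -> 0 <= p v xi) &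
    forall xi, cone_over s xi <-> forall v, C v -> L v -> p x xi <= p v xi.
Proof.
move=> Cx Lx sQ full s0Q rat_p.
have [b bL] := lattice_spanned lL.
have [ys ysP ysC] := vertex_cone sL bL oC Cx Lx.
set k := size ys; pose w i := ys`_i - x.
have wL i : (i < k)%N -> L (w i).
  by move=> ik; apply: sL.2 => //; have [] := ysP _ (mem_nth 0 ik).
have wP v : lin_closure C v -> exists2 a : nat -> R, (forall i, 0 <= a i) &
    v = \sum_(i < k) a i *: w i.
  move=> /ysC[a a0 ->]; exists a => //; rewrite size_map; apply: eq_bigr => i _.
  by rewrite (nth_map 0).
pose M := \sum_(i < k) vnorm (w i).
(* [Z] contains all remainders of lattice points after the integral parts of their coefficients on
   the [w i] are taken off. *)
have /finite_seqP[Z ZE] := lattice_bounded_finite M lL.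
pose pt z (n : seq nat) := z + \sum_(i < k) (nth 0%N n i)%:R *: w i.
have /choice[F FP] : forall z, exists F : seq (seq nat),
    (forall n, n \in F -> C (pt z n)) /\ forall n, C (pt z n) ->
    exists2 n', n' \in F & forall i, (i < k)%N -> (nth 0 n' i <= nth 0 n i)%N.
  move=> z; have [F FA FP] := dickson k (fun n i => nth 0%N n i) [set n | C (pt z n)].
  by exists F.
(* Finitely many tests: [ys] makes [xi] nonnegative on each [w i], and the rest are the minimal
   points of [C] in each class of remainders. *)
pose Y := ys ++ flatten [seq [seq pt z n | n <- F z] | z <- Z].
have YCL y : y \in Y -> C y /\ L y.
  rewrite mem_cat => /orP[/ysP//|/flatten_mapP[z zZ /mapP[n nF ->]]].
  have [Fz _] := FP z; split; first exact: Fz.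
  have : [set` Z] z by [].
  rewrite -ZE => -[Lz _]; apply: subgroupD => //; apply: subgroup_sum => // i _.
  by apply: subgroupMn => //; exact: wL.
have [||||s Qs sP] := @polyhedral_of_inequalities R V' V VQ' Y (fun y xi => p (y - x) xi) s0.
- by move=> y _; exact: p_linr.
- by [].
- by [].
- move=> y yY xi zeta Qxi Qzeta; have [_ Ly] := YCL _ yY.
  have [_ _ QZ] := sQ; have Lyx := sL.2 _ _ Ly Lx.
  have [q ->] := rat_p _ _ Lyx Qxi; have [q' ->] := rat_p _ _ Lyx Qzeta.
  by apply: Q_subspaceB => //; exact: QZ.
have in_dual xi : cone_over s xi -> forall v, lin_closure C v -> 0 <= p v xi.
  move=> /sP h v /wP[a a0 ->]; rewrite (linfunction_sum (p_linl xi)).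
  apply: sumr_ge0 => i _; rewrite (linfunctionZ (p_linl xi)) mulr_ge0//.
  by apply: h; rewrite mem_cat mem_nth.
exists s.
  by move=> xi xis; split; [exact: Qs|apply: in_dual; exact: cone_over_mem].
move=> xi; rewrite sP; split=> [h v Cv Lv|h y yY]; last first.
  by have [Cy Ly] := YCL _ yY; rewrite (linfunctionB (p_linl xi)) subr_ge0; exact: h.
have [a a0 vE] := wP _ (sub_lin_closure Cv).
pose n i := Num.truncn (a i); pose z := v - \sum_(i < k) (n i)%:R *: w i.
have zE : z = \sum_(i < k) (a i - (n i)%:R) *: w i.
  by rewrite /z vE -sumrB; apply: eq_bigr => i _; rewrite scalerBl.
have zZ : z \in Z.
  have : (L `&` [set v | vnorm v <= M]) z.
    split.
      apply: sL.2 => //; apply: subgroup_sum => // i _; by apply: subgroupMn => //; exact: wL.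
    rewrite /= zE; apply: le_trans (vnorm_sum _ _ _) _; apply: ler_sum => i _.
    have ti : (n i)%:R <= a i by rewrite truncn_le.
    have ts := truncnS_gt (a i); rewrite -/(n i) -natr1 in ts.
    by rewrite vnormZ ler_piMl ?vnorm_ge0// ger0_norm ?subr_ge0//; lra.
  by rewrite ZE.
pose ns := mkseq n k.
have nsE i : (i < k)%N -> nth 0%N ns i = n i by move=> ik; rewrite nth_mkseq.
have ptE : pt z ns = v.
  rewrite /pt /z -[RHS](subrK (\sum_(i < k) (n i)%:R *: w i)); congr (_ + _).
  by apply: eq_bigr => i _; rewrite nsE.
(* Going from the minimal point [pt z n'] to [v] adds nonnegative multiples of the [w i], which
   cannot decrease the value of [xi]. *)
have [_ FF] := FP z; have [|n' n'F n'n] := FF ns; first by rewrite ptE.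
have := h (pt z n'); rewrite mem_cat (_ : pt z n' \in flatten _) ?orbT; last first.
  by apply/flatten_mapP; exists z => //; apply: map_f.
move=> /(_ isT); rewrite (linfunctionB (p_linl xi)) subr_ge0 => /le_trans; apply.
rewrite -ptE /pt !(linfunctionD (p_linl xi)) lerD2l !(linfunction_sum (p_linl xi)).
apply: ler_sum => i _; rewrite !(linfunctionZ (p_linl xi)) ler_wpM2r ?ler_nat ?n'n//.
by apply: h; rewrite mem_cat mem_nth.
Qed.

(* Among the finitely many minimizers of [xi] the longest one is extreme. *)
Lemma minimum_at_extreme_point xi c x0 : C x0 -> L x0 -> 0 < c ->
  (forall v, C v -> c * vnorm v <= p v xi) ->
  exists2 x, extreme_points (convex_hull (C `&` L)) x &
    forall v, C v -> L v -> p x xi <= p v xi.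
Proof.
move=> Cx0 Lx0 c0 cP.
have [|||m [Cm Lm] mP] := @lattice_attains_min _ _ L (C `&` L) (p^~ xi) c lL _ c0 _ x0.
- by move=> v [].
- by move=> v [Cv _]; exact: cP.
- by split.
have fin : finite_set ((C `&` L) `&` [set v | p v xi = p m xi]).
  apply: sub_finite_set (lattice_bounded_finite (p m xi / c) lL) => v [[Cv Lv] /= vm].
  by split=> //=; rewrite ler_pdivlMr// mulrC -vm; exact: cP.
have [|x [[Cx Lx] /= xm] xmax] := @finite_attains_min R _ _ (fun v => - sqn v) m fin.
  by split.
exists x => [|v Cv Lv]; last by rewrite xm; apply: mP.
split; first by apply: sub_convex_hull.
(* A convex set containing the hull, ordered first by value and then by length. A segment through
   [x] must have both ends at the minimal value and no longer than [x], and strict convexity makes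
   them equal. *)
pose K := [set v | p m xi < p v xi \/ p v xi = p m xi /\ sqn v <= sqn x].
have pconv y z t : p (t *: y + (1 - t) *: z) xi = t * p y xi + (1 - t) * p z xi.
  by rewrite (linfunctionD (p_linl xi)) !(linfunctionZ (p_linl xi)).
have sconv y z t : 0 < t < 1 -> sqn (t *: y + (1 - t) *: z) <= t * sqn y + (1 - t) * sqn z.
  move=> t01; have [->|yz] := pselect (y = z); last exact/ltW/sqn_strictly_convex.
  by rewrite -scalerDl -mulrDl addrC subrK scale1r mul1r.
have sub : convex_hull (C `&` L) `<=` K.
  apply: convex_hull_min; last first.
    move=> v [Cv Lv]; have := mP v (conj Cv Lv); rewrite le_eqVlt => /orP[/eqP vm|]; last by left.
    right; split=> //; have := xmax v; rewrite lerN2; apply; split=> //=.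
  apply/convex_setP => y z t Ky Kz t01; have /andP[t0 t1] := t01.
  have := sconv y z t t01; rewrite /K /= pconv.
  by case: Ky => [yl|[ye ys]]; case: Kz => [zl|[ze zs]] sq; [left|left|left|right]; try nra;
    split; nra.
move=> y z t /sub Ky /sub Kz t01 xE; have /andP[t0 t1] := t01.
have xp : t * p y xi + (1 - t) * p z xi = p m xi by rewrite -pconv -xE.
apply: contrapT => yz; have := sqn_strictly_convex t01 yz; rewrite -xE.
by case: Ky => [yl|[ye ys]]; case: Kz => [zl|[ze zs]]; nra.
Qed.

(** Real multiples leave [VQ'], but [a *: xi] lies on the segment from 0 to an integral multiple of
    [xi]. *)
Lemma convex_hull_coneZ a xi :
  (forall c zeta, (0 : R) <= c -> D' zeta -> D' (c *: zeta)) -> Q_subspace VQ' -> D' 0 ->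
  0 <= a -> convex_hull (D' `&` VQ') xi -> convex_hull (D' `&` VQ') (a *: xi).
Proof.
move=> DZ sQ D0 a0; move: xi; have [Q0 _ QZ] := sQ.
have /convex_setP cH := @convex_hull_convex _ _ (D' `&` VQ').
apply: (@convex_hull_min R V' _ [set xi | convex_hull (D' `&` VQ') (a *: xi)]).
  apply/convex_setP => x y t hx hy t01 /=.
  rewrite scalerDr !scalerA [a * t]mulrC [a * _]mulrC -!scalerA.
  by apply: cH.
move=> xi [Dxi Qxi] /=.
pose N := (Num.truncn a).+1; have N0 : 0 < N%:R :> R by rewrite ltr0n.
have aN : a < N%:R := truncnS_gt _.
have [->|a_neq0] := eqVneq a 0.
  by rewrite scale0r; apply: sub_convex_hull.
have -> : a *: xi = (a / N%:R) *: (N%:R *: xi) + (1 - a / N%:R) *: 0.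
  by rewrite scaler0 addr0 scalerA mulfVK// gt_eqF.
have agt0 : 0 < a by rewrite lt_neqAle eq_sym a_neq0.
apply: cH; last by rewrite divr_gt0//= ltr_pdivrMr// mul1r.
  apply: sub_convex_hull; split; first by apply: DZ => //; exact: ltW.
  by have := QZ N%:R _ Qxi; rewrite ratr_nat.
exact: sub_convex_hull.
Qed.

(** An abstract pairing lets the same argument run from [V] to its dual and back, without a bidual.
    The cone collects the forms minimal at orbit representatives; any [xi] in [C'] is minimal at
    some extreme point, which the group carries to a representative. *)
Lemma finitely_many_orbits_polyhedral s0 x0 : C x0 -> L x0 -> Q_subspace VQ' ->
  (forall xi, cone_over s0 xi) -> (forall xi, xi \in s0 -> VQ' xi) ->
  (forall v xi, L v -> VQ' xi -> exists q : rat, p v xi = ratr q) ->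
  (forall xi, C' xi -> exists2 c, 0 < c & forall v, C v -> c * vnorm v <= p v xi) ->
  (forall xi, D' xi <-> forall v, lin_closure C v -> 0 <= p v xi) ->
  (forall g x, Gam g -> C x -> C (g x)) -> (forall g x, Gam g -> L x -> L (g x)) ->
  Gam \1%VF ->
  (forall g, Gam g -> exists2 g', Gam' g' & exists2 h' : V' -> V',
     cancel h' g' & forall v xi, p v (h' xi) = p (g v) xi) ->
  finitely_many_orbits Gam (extreme_points (convex_hull (C `&` L))) ->
  cond_ii C' (convex_hull (D' `&` VQ')) Gam'.
Proof.
move=> Cx0 Lx0 sQ full s0Q rat_p C'P D'P GC GL G1 GG' /finite_seqP[os osE].
set E := extreme_points _ in osE.
have /choice[f fP] : forall x, exists s : seq V', C x -> L x ->
    (forall xi, xi \in s -> VQ' xi /\ (forall v, lin_closure C v -> 0 <= p v xi)) /\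
    forall xi, cone_over s xi <-> forall v, C v -> L v -> p x xi <= p v xi.
  move=> x; have [Cx|nCx] := pselect (C x); last by exists [::].
  have [Lx|nLx] := pselect (L x); last by exists [::].
  by have [s sQ' sP] := minimized_at_polyhedral Cx Lx sQ full s0Q rat_p; exists s.
have /choice[rep repP] : forall o : set V, exists x, o \in os -> E x /\ orbit_of Gam x = o.
  move=> o; have [oos|] := boolP (o \in os); last by exists 0.
  have : [set` os] o by [].
  by rewrite -osE => -[x Ex xo]; exists x.
have repCL o : o \in os -> C (rep o) /\ L (rep o).
  by move=> /repP[/extreme_points_hull].
pose s := flatten [seq f (rep o) | o <- os].
have D0 : D' 0 by apply/D'P => v _; rewrite (linfunction0 (p_linr v)).
have DZ c zeta : 0 <= c -> D' zeta -> D' (c *: zeta).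
  move=> c0 /D'P h; apply/D'P => v clv; rewrite (linfunctionZ (p_linr v)) mulr_ge0//.
  exact: h.
exists (cone_over s); split.
- by apply/polyhedral_coneP; exists s.
- have hZ := convex_hull_coneZ DZ sQ D0.
  have /convex_setP cH := @convex_hull_convex _ _ (D' `&` VQ').
  have h2 : 0 < (2 : R)^-1 < 1 by rewrite invr_gt0 ltr0n/= invf_lt1 ?ltr1n.
  apply: cone_over_min.
  + by apply: sub_convex_hull; split=> //; have [] := sQ.
  + move=> u v hu hv; have -> : u + v = 2^-1 *: (2 *: u) + (1 - 2^-1) *: (2 *: v).
      by apply: eq_v2r_coord => k; rewrite ?(v2r_coordD, v2r_coordN, v2r_coordZ); field.
    by apply: cH => //; apply: hZ.
  + by move=> c u c0; exact: hZ.
  move=> xi /flatten_mapP[o oos xif]; have [Cr Lr] := repCL _ oos.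
  have [fQ _] := fP _ Cr Lr; have [Qxi dxi] := fQ _ xif.
  by apply: sub_convex_hull; split=> //; apply/D'P.
move=> xi C'xi; have [c c0 cP] := C'P _ C'xi.
have [x Ex xmin] := minimum_at_extreme_point Cx0 Lx0 c0 cP.
have : [set` os] (orbit_of Gam x) by rewrite -osE; exists x.
move=> /= oos; have [_ rE] := repP _ oos; have [Cr Lr] := repCL _ oos.
have : orbit_of Gam x x by exists \1%VF => //; rewrite id_lfunE.
(* Here [g] sends the representative to [x], so pulling [xi] back along [g] gives a form minimal at
   the representative. *)
rewrite -{1}rE => -[g Gg gx].
have [g' Gg' [h' hK hE]] := GG' _ Gg.
exists g' => //; exists (h' xi) => //.
apply: (@cone_over_subset _ _ (f (rep (orbit_of Gam x)))).
  by move=> zeta zf; apply/flatten_mapP; exists (orbit_of Gam x).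
apply/((fP _ Cr Lr).2) => v Cv Lv; rewrite !hE gx; apply: xmin; [exact: GC|exact: GL].
Qed.

End DualityOfTypes.

(** * The contragredient action and the passage between the two sides *)

Section Contragredient.
Variables (R : realType) (V : vectType R) (VQ C : set V) (Gam : set 'End(V)).
Hypotheses (hVQ : Q_structure VQ) (hC : open_nondegenerate_convex_cone C)
  (hGam : GL_subgroup Gam) (hGamC : stabilizes Gam C).
Implicit Types (g h : 'End(V)) (f : 'Hom(V, R^o)).

Let oC : open_cone C := open_nondegenerate_open_cone hC.

Lemma contragredient_compK g f : Gam g -> contragredient_map g (f \o g)%VF = f.
Proof.
by move=> Gg; rewrite contragredient_mapE -comp_lfunA lker0_compfV ?comp_lfun1r// (GL_subgroup_lker hGam).
Qed.

Lemma stabilizes_contragredient (A : set 'Hom(V, R^o)) :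
  (forall g f, Gam g -> A f -> A (f \o g)%VF) -> stabilizes (contragredient Gam) A.
Proof.
move=> hA _ [g Gg <-]; apply/seteqP; split=> [_ [f Af <-]|f Af].
  by rewrite contragredient_mapE; apply: hA => //; exact: GL_subgroupV.
by exists (f \o g)%VF; [exact: hA|exact: contragredient_compK].
Qed.

Lemma contragredient_GL_subgroup : GL_subgroup (contragredient Gam).
Proof.
have [G1 GM GV] := hGam; split.
- exists \1%VF => //; apply/lfunP => f; rewrite id_lfunE.
  by rewrite -[f in LHS]comp_lfun1r contragredient_compK.
- move=> _ _ [g Gg <-] [h Gh <-]; exists (g \o h)%VF; first exact: GM.
  apply/lfunP => f; rewrite comp_lfunE.
  have {1}-> : f = ((f \o h^-1 \o g^-1) \o (g \o h))%VF.
    have kg := GL_subgroup_lker hGam Gg; have kh := GL_subgroup_lker hGam Gh.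
    by apply/lfunP => v; rewrite !comp_lfunE (GL_subgroupK hGam Gg) (GL_subgroupK hGam Gh).
  by rewrite contragredient_compK ?contragredient_mapE//; exact: GM.
move=> _ [g Gg <-]; have Gg' := GL_subgroupV hGam Gg.
have ker0 : lker (contragredient_map g) == 0%VS.
  apply/lker0P => f f'; rewrite !contragredient_mapE => /(congr1 (fun k => (k \o g)%VF)).
  by rewrite -!comp_lfunA !lker0_compVf ?comp_lfun1r// (GL_subgroup_lker hGam).
split; first exact/eqP.
exists (g^-1)%VF => //; apply/lfunP => f; apply: (can_inj (lker0_lfunK ker0)).
rewrite lker0_lfunVK// !contragredient_mapE.
by apply/lfunP => v; rewrite !comp_lfunE (GL_subgroupK hGam Gg').
Qed.

Lemma cond_iv_dual_ii : cond_iv VQ C Gam ->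
  cond_ii (open_dual C) (dual_plus VQ C) (contragredient Gam).
Proof.
move=> [L [hL sL fin]]; have [G1 _ _] := hGam.
have [x0 Cx0 Lx0] := open_cone_lattice_point hVQ hL oC.
have [hdQ dL] := dual_Q_structure hVQ (ex_intro _ _ hL).
have [s0 full s0Q] := Q_structure_generators hdQ (dL _ hL).
apply: (@finitely_many_orbits_polyhedral _ _ _ (fun v (f : 'Hom(V, R^o)) => f v : R)
  (@hom_linfunction _ _) (@eval_linfunction _ _) L C Gam oC hL.1 _ _ _ _
  s0 x0) => //.
- exact: hdQ.1.
- by move=> v f Lv; apply; exact: hL.2.
- move=> f fC; have [c c0 cP] := open_dual_lower_bound fC.
  by exists c => // v Cv; apply: cP; exact: sub_lin_closure.
- move=> f; split=> [fC v|h v Cv]; first exact: dual_cone_closure.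
  by apply: h; exact: sub_lin_closure.
- by move=> g x Gg Cx; exact: (stabilizes_mem hGamC Gg Cx).
- by move=> g x Gg Lx; exact: (stabilizes_mem sL Gg Lx).
move=> g Gg; exists (contragredient_map g); first by exists g.
exists (fun f => (f \o g)%VF); first by move=> f; exact: contragredient_compK.
by move=> v f; rewrite comp_lfunE.
Qed.

(** [L0] provides rational generators of [V], while [L] is the invariant lattice of the dual. The
    bipolar theorem identifies the closure of [C] with the vectors on which the closure of the open
    dual is nonnegative. *)
Lemma dual_cond_iv_ii L0 : lattice_in VQ L0 ->
  cond_iv (dual_Q VQ) (open_dual C) (contragredient Gam) ->
  cond_ii C (C_plus VQ C) Gam.
Proof.
move=> hL0 [L [hL sL fin]].
have hdC := open_dual_open_nondegenerate hC.
have [hdQ dL] := dual_Q_structure hVQ (ex_intro _ _ hL0).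
have odC := open_nondegenerate_open_cone hdC.
have [x0 Cx0 Lx0] := open_cone_lattice_point hdQ hL odC.
have [s0 full s0Q] := Q_structure_generators hVQ hL0.
have GC : stabilizes (contragredient Gam) (open_dual C).
  by apply: stabilizes_contragredient => g f; exact: open_dual_comp.
have [G1 _ _] := contragredient_GL_subgroup.
apply: (@finitely_many_orbits_polyhedral _ _ _ (fun (f : 'Hom(V, R^o)) v => f v : R)
  (@eval_linfunction _ _) (@hom_linfunction _ _) L (open_dual C) (contragredient Gam) odC hL.1 _ _ _ _
  s0 x0) => //.
- exact: hVQ.1.
- by move=> f v Lf Qv; exact: (hL.2 _ Lf).
- move=> v Cv; have [c c0 cP] := eval_lower_bound hC Cv.
  by exists c => // f /open_dual_sub; exact: cP.
- move=> v; split=> [clv f|h].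
    by rewrite closure_open_dual// => fC; exact: dual_cone_closure clv.
  by apply: open_dual_bipolar => // f fC; apply: h; exact: sub_lin_closure.
- by move=> g x Gg Cx; exact: (stabilizes_mem GC Gg Cx).
- by move=> g x Gg Lx; exact: (stabilizes_mem sL Gg Lx).
move=> _ [g Gg <-]; exists g => //; exists (g^-1)%VF; first exact: (GL_subgroupVK hGam).
by move=> f v; rewrite contragredient_mapE comp_lfunE.
Qed.

End Contragredient.

Theorem mainTheorem2 (R : realType) (V : vectType R) (VQ C : set V)
    (Gam : set 'End(V))
    (hVQ : Q_structure VQ)
    (hC : open_nondegenerate_convex_cone C)
    (hGam : GL_subgroup Gam)
    (hGamC : stabilizes Gam C)
    (hGamL : exists L, lattice_in VQ L /\ stabilizes Gam L) :
  [<-> cond_i (C_plus VQ C) Gam;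
       cond_ii C (C_plus VQ C) Gam;
       cond_iii VQ C Gam;
       cond_iv VQ C Gam;
       cond_i (dual_plus VQ C) (contragredient Gam);
       cond_ii (open_dual C) (dual_plus VQ C) (contragredient Gam);
       cond_iii (dual_Q VQ) (open_dual C) (contragredient Gam);
       cond_iv (dual_Q VQ) (open_dual C) (contragredient Gam)]
  /\
  (forall P : set V,
     polyhedral_cone P -> P `<=` C_plus VQ C -> C `<=` translates Gam P ->
     translates Gam P = C_plus VQ C).
Proof.
have [L [hL sL]] := hGamL.
have hdC := open_dual_open_nondegenerate hC.
have [hdQ dL] := dual_Q_structure hVQ (ex_intro _ _ hL).
have hdL := dL _ hL.
have dGam := contragredient_GL_subgroup hGam.
have dGC : stabilizes (contragredient Gam) (open_dual C).
  by apply: stabilizes_contragredient => // g f; exact: open_dual_comp.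
have dGL : stabilizes (contragredient Gam) (dual_lattice L).
  by apply: stabilizes_contragredient => // g f; exact: dual_lattice_comp.
(* This turns the starred conditions into instances of the unstarred ones, so the results on group
   actions apply to the dual as well. *)
have plusE : dual_plus VQ C = C_plus (dual_Q VQ) (open_dual C).
  by rewrite /C_plus closure_open_dual.
split; last by move=> P; exact: translates_eq_C_plus hL sL P.
(* A single cycle: each crossing from (iv) to (i) of the other side passes through (ii) there and
   then uses the Siegel property. *)
tfae.
- exact: cond_i_ii hL.
- by move=> h L' hL' sL'; exact: polyhedral_finitely_many_orbits h.
- by move=> h; exists L; split=> //; exact: h.
- move=> /(cond_iv_dual_ii hVQ hC hGam hGamC); rewrite plusE.
  exact: cond_ii_i hdL dGL.
- rewrite plusE; exact: cond_i_ii hdL.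
- rewrite plusE => h L' hL' sL'.
  exact: (polyhedral_finitely_many_orbits hdQ hdC dGam dGC hL' sL' h).
- by move=> h; exists (dual_lattice L); split=> //; exact: h.
- move=> /(dual_cond_iv_ii hVQ hC hGam hGamC hL).
  exact: cond_ii_i hL sL.
Qed.
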